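(* Let $p,q,s$ be distinct odd primes with $p\equiv 7\pmod 8$, $q\equiv s\equiv 3\pmod 8$, and with $$\Bigl(\bigl(\tfrac{q}{p}\bigr),\bigl(\tfrac{s}{p}\bigr),\bigl(\tfrac{q}{s}\bigr)\Bigr)\in\{(1,1,1),\,(-1,-1,1)\}.$$ Let $K=L^{+}=\mathbb{Q}(\sqrt2,\sqrt{pq},\sqrt{ps})$ and let $\Theta=\sqrt{\varepsilon_{pq}\varepsilon_{2pq}}\cdot\sqrt{\varepsilon_{ps}\varepsilon_{2ps}}\in K^\times$, with the square roots normalized to be positive under the real embedding $\iota_0$ of the context. Assume that exactly one of the two elements $\Theta$ and $\varepsilon_{pq}\Theta$ is a square in $K$. Let $w$ be a finite place of $K$ such that $\varepsilon_{pq}\notin K_w^{\times2}$, and let $\mathcal{B}_w\subset K_w^\times$ be a finite set mapping to an $\mathbb{F}_2$-basis of $K_w^\times/K_w^{\times2}$. Then the following are equivalent: (i) $\Theta\in K^{\times2}$; (ii) $\Theta\in K_w^{\times2}$; (iii) $(\Theta,b)_w=1$ for all $b\in\mathcal{B}_w$. Consequently, the unique $\mu\in\{1,\varepsilon_{pq}\}$ such that $\mu\Theta\in K^{\times2}$ is given by $\mu=1$ if $(\Theta,b)_w=1$ for all $b\in\mathcal{B}_w$, and $\mu=\varepsilon_{pq}$ otherwise. In particular, there is $\xi\in K^\times$ with $\xi^2=\mu\Theta$, for this explicitly determined $\mu$, and such a $\xi=\sqrt{\mu\Theta}$ can be taken as the final generator in the fundamental system of units of $L^{+}$ described in the context.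
   Context: For squarefree $d>1$, $\varepsilon_d$ denotes the fundamental unit of $\mathbb{Q}(\sqrt d)$, taken $>1$ in the embedding $\sqrt d\mapsto+\sqrt d$. $(\tfrac{\cdot}{\cdot})$ is the Legendre symbol. $K_w$ is the completion of $K$ at $w$, and $K^{\times 2}$, $K_w^{\times2}$ are the groups of nonzero squares. $(\cdot,\cdot)_w:K_w^\times/K_w^{\times2}\times K_w^\times/K_w^{\times2}\to\{\pm1\}$ is the quadratic Hilbert symbol: $(a,b)_w=1$ iff $a$ is a norm from $K_w(\sqrt b)$. The embedding $\iota_0:L^{+}\hookrightarrow\mathbb{R}$ sends $\sqrt2,\sqrt{pq},\sqrt{ps}$ to their positive real values. Under the stated congruence and Legendre-symbol conditions, it is known (El Hamam) that $\varepsilon_{pq}\varepsilon_{2pq}$ and $\varepsilon_{ps}\varepsilon_{2ps}$ are squares in $L^{+}$; for $d\in\{pq,ps\}$, $\sqrt{\varepsilon_d\varepsilon_{2d}}$ denotes the unique square root in $L^{+}$ with positive image under $\iota_0$. A fundamental system of units of $L^{+}$ is a set of $7$ units which, together with $\{\pm1\}$, generates the unit group $E_{L^{+}}$. The imported result (El Hamam) to which the last sentence of the claim refers is: under the stated conditions, exactly one of $\Theta$ and $\varepsilon_{pq}\Theta$ is a square in $L^{+}$, and if $\mu\in\{1,\varepsilon_{pq}\}$ is the unique element with $\mu\Theta\in L^{+\times2}$ and $\xi\in L^{+\times}$ satisfies $\xi^2=\mu\Theta$, then $$\varepsilon_2,\ \varepsilon_{pq},\ \sqrt{\varepsilon_{pq}\varepsilon_{ps}},\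 \sqrt{\varepsilon_{pq}\varepsilon_{qs}},\ \sqrt{\varepsilon_{2qs}},\ \sqrt{\varepsilon_{pq}\varepsilon_{2pq}},\ \xi$$ form a fundamental system of units of $L^{+}$. The ''final generator'' is the seventh unit $\xi$. *)

(* Defs.v *)
From HB Require Import structures.
From mathcomp Require Import all_boot all_order all_algebra all_fingroup all_field.
From mathcomp Require Import finmap boolp reals.

Set Implicit Arguments.
Unset Strict Implicit.
Unset Printing Implicit Defensive.

Import Order.TTheory GRing.Theory Num.Theory.
Local Open Scope ring_scope.

Definition squarefree (d : nat) : Prop :=
  forall k : nat, (k ^ 2 %| d)%N -> k = 1%N.

Definition legendre (a p : nat) : int :=
  if (p %| a)%N then 0
  else if [exists x : 'I_p, x ^ 2 == a %[mod p]]%N then 1 else -1.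

(* Membership in F^{\times 2}. *)
Definition nzsquare (F : fieldType) (x : F) : Prop :=
  exists2 y : F, y != 0 & x = y ^+ 2.

(* r is the square root of x that is positive under the real embedding iota. *)
Definition pos_sqrt (R : realType) (L : fieldExtType rat)
    (iota : {rmorphism L -> R}) (x r : L) : Prop :=
  r ^+ 2 = x /\ 0 < iota r.

Section Units.
Variables (L : fieldExtType rat).

Definition alg_integer (x : L) : Prop := integralOver (intr : int -> L) x.

(* Units of the ring of integers of the subfield E of L. *)
Definition unit_of_integers (E : {vspace L}) (u : L) : Prop :=
  [/\ u \in E, alg_integer u
    & exists v : L, [/\ v \in E, alg_integer v & u * v = 1]].

(* For a real quadratic subfield E of L; iota fixes the real embedding of E. *)
Definition fundamental_unit (R : realType) (iota : {rmorphism L -> R})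
    (E : {vspace L}) (e : L) : Prop :=
  [/\ unit_of_integers E e, 1 < iota e
    & forall u, unit_of_integers E u ->
        exists n : int, u = e ^ n \/ u = - e ^ n].

(* eps d is the fundamental unit of Q(sqrt d) for every squarefree d > 1 such
   that Q(sqrt d) is contained in L; other values of eps are unconstrained. *)
Definition fundamental_units (R : realType) (iota : {rmorphism L -> R})
    (eps : nat -> L) : Prop :=
  forall (d : nat) (r : L), (1 < d)%N -> squarefree d ->
    pos_sqrt iota d%:R r -> fundamental_unit iota <<1; r>>%VS (eps d).

(* A set of n units generating, together with -1, the unit group of L. *)
Definition fundamental_system (n : nat) (us : n.-tuple L) : Prop :=
  [/\ uniq us,
      forall u, u \in us -> unit_of_integers fullv u
    & forall u, unit_of_integers fullv u ->
        exists (b : bool) (k : 'I_n -> int),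
          u = (-1) ^+ b * \prod_(i < n) tnth us i ^ k i].

End Units.

Section Places.
Variable R : realType.

Definition nonarch_absolute_value (F : fieldType) (v : F -> R) : Prop :=
  [/\ forall x, 0 <= v x,
      forall x, v x = 0 <-> x = 0,
      {morph v : x y / x * y}
    & forall x y, v (x + y) <= Num.max (v x) (v y)].

(* A finite place of a number field is given by a nontrivial non-archimedean
   absolute value representing it. *)
Definition finite_place (K : fieldType) (w : K -> R) : Prop :=
  nonarch_absolute_value w /\ exists x, x != 0 /\ w x <> 1.

Definition complete_for (F : fieldType) (v : F -> R) : Prop :=
  forall u : nat -> F,
    (forall e : R, 0 < e -> exists N, forall m n : nat,
       (N <= m)%N -> (N <= n)%N -> v (u m - u n) < e) ->
    exists l : F, forall e : R, 0 < e -> exists N, forall n : nat,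
      (N <= n)%N -> v (u n - l) < e.

(* (Kw, v), with the embedding j, is the completion of (K, w); it is unique up
   to a unique isometric isomorphism over K. *)
Definition is_completion (K : fieldType) (w : K -> R)
    (Kw : fieldType) (j : {rmorphism K -> Kw}) (v : Kw -> R) : Prop :=
  [/\ nonarch_absolute_value v,
      forall x, v (j x) = w x,
      forall (y : Kw) (e : R), 0 < e -> exists x : K, v (y - j x) < e
    & complete_for v].

End Places.

(* a is a norm from F(sqrt b), with F(sqrt b) = F when b is a square in F.
   The field norm is the Galois norm, so this is meant for fields F of
   characteristic different from 2, where F(sqrt b) / F is Galois. *)
Definition norm_from_sqrt (F : fieldType) (a b : F) : Prop :=
  exists (E : splittingFieldType F) (r : E),
    [/\ r ^+ 2 = b%:A, <<1; r>>%VS = fullv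
      & exists z : E, galNorm 1 fullv z = a%:A].

Definition hilbert_symbol (F : fieldType) (a b : F) : int :=
  if `[< norm_from_sqrt a b >] then 1 else -1.

Local Open Scope fset_scope.

(* The image of B in F^{\times} / F^{\times 2} is an F_2-basis: F_2-linear
   combinations of classes are products over finite subsets, and linear
   independence is tested on subsets of B with pairwise distinct classes. *)
Definition basis_mod_squares (F : fieldType) (B : {fset F}) : Prop :=
  [/\ forall b, b \in B -> b != 0,
      forall x : F, x != 0 ->
        exists S : {fset F}, S `<=` B /\ nzsquare (x / \prod_(b <- S) b)
    & forall S : {fset F}, S `<=` B ->
        {in S &, forall b c, nzsquare (b / c) -> b = c} ->
        nzsquare (\prod_(b <- S) b) -> S = fset0].

(* Main.v *)
(* If Theta is not a square in K then eps_pq * Theta is one, so Theta = eps_pq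
   modulo squares both in K and in Kw, and eps_pq is not a square in Kw; hence
   (i) <-> (ii).  A square has trivial symbols.  Conversely, by bilinearity, if
   (Theta, b)_w = 1 on a basis then every element of Kw is a norm from
   Kw(sqrt Theta).  As eps_pq = p modulo squares of K, it is enough to find an
   element of Kw that is not of the form x^2 - p y^2 when p is not a square in Kw.
   For w(2) = 1 this extension is unramified and any element of odd valuation
   will do.  For w(2) < 1, -p is a square in Kw = Q_2(sqrt 2, sqrt 5) and
   1 + om sqrt 2, with om a primitive cube root of unity modulo 2, is not a sum
   of two squares.

   For the unit group, a unit u is determined up to sign by the exponents n_d
   with N(u) = +- eps_d^n_d over the seven quadratic subfields, since u^4 is the
   product of the eps_d^n_d up to sign.  After removing a power of xi one may
   assume n_2ps = 0.  For tau in the Galois group, (u tau(u))^2 is the product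
   of the three eps_d^n_d with tau fixing sqrt d.  Since eps_pq, eps_ps and eps_qs
   are primes modulo squares, hence nonsquares of K, eps_2 has norm -1, and
   eps_2qs = 2 z^2 with z in Q(sqrt(2qs)), these relations force all n_d to be
   even, and one can divide by the generators.  The classes of the eps_d modulo
   squares come from x^2 - d y^2 = 4 by congruences modulo 8. *)

Require Import Defs.
From HB Require Import structures.
From mathcomp Require Import all_boot all_order all_algebra all_fingroup all_field.
From mathcomp Require Import finmap boolp reals.
From mathcomp Require Import ring lra zify.

Set Implicit Arguments.
Unset Strict Implicit.
Unset Printing Implicit Defensive.

Import Order.TTheory GRing.Theory Num.Theory.
Local Open Scope ring_scope.

(** * Norm forms and Hilbert symbols *)

(** The local field enters only through an absolute value, completeness and density of [K]; its
    square classes and norm groups are never computed. The values of [Kw] are those of [K], and one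
    of odd valuation exists because some power of an algebraic element, with exponent at most the
    degree, has the value of a rational number. Over [p] itself [p] is not a unit, but pq is a
    square of [K], so [q] takes its place. At a dyadic place the extension to be treated is
    generated by sqrt(-1) and is ramified, so valuations do not detect non-norms. There x^2 + y^2
    agrees with (x + y)^2 modulo 2, and comparing the coefficients of sqrt 2 leaves the additive
    equation t^2 + t = om over F_4. It is insoluble because om has trace 1 over F_2, which is why om
    appears in the non-norm. On the unit side, norm relations are squared so that unknown signs of
    norms disappear; the square roots are taken back at the end, using that every fundamental unit
    is positive under [iota]. *)

Lemma memv_adjoin_sqrt (F : fieldType) (L : fieldExtType F) (E : {subfield L})
    (r x : L) :
  r ^+ 2 \in E -> x \in <<E; r>>%VS ->
  exists a b, [/\ a \in E, b \in E & x = a + b * r].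
Proof.
move=> Er2 /Fadjoin_polyP[P /polyOverP EP ->]; rewrite horner_coef.
elim/big_ind: _ => [|_ _ [a [b [Ea Eb ->]]] [c [d [Ec Ed ->]]]|i _].
- by exists 0, 0; rewrite !rpred0 mul0r addr0.
- by exists (a + c), (b + d); rewrite !rpredD //; split=> //; ring.
have Ei : P`_i * (r ^+ 2) ^+ i./2 \in E by apply: rpredM; [exact: EP|exact: rpredX].
rewrite -[in r ^+ i](odd_double_half i) exprD -mul2n exprM.
case: (odd i); first exists 0, (P`_i * (r ^+ 2) ^+ i./2).
  by rewrite rpred0; split=> //; rewrite expr1; ring.
by exists (P`_i * (r ^+ 2) ^+ i./2), 0; rewrite rpred0; split=> //; ring.
Qed.

Lemma pchar0_natf_neq0 (F : fieldType) n :
  [pchar F] =i pred0 -> (n.+1)%:R != 0 :> F.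
Proof. by move=> /pcharf0P->. Qed.

(** An automorphism sends [r] to [r] or [- r] and is determined by this value. Since [r] is not in
    the fixed field of the Galois group, both signs occur, and the norm has exactly two factors. *)
Lemma galNorm_sqrt (F : fieldType) (E : splittingFieldType F) (r : E) (b : F) :
    [pchar F] =i pred0 -> r ^+ 2 = b%:A -> <<1; r>>%VS = fullv ->
    r \notin 1%VS ->
  forall x y : F, galNorm 1 fullv (x%:A + y%:A * r) = (x ^+ 2 - b * y ^+ 2)%:A.
Proof.
move=> F0 rb rE r'1 x y.
have E0 : [pchar E] =i pred0 by move=> m; rewrite pchar_lalg.
have galE : galois 1%VS {:E}.
  apply/and3P; split; [exact: sub1v| |exact: normalFieldf].
  by apply/separableP=> u _; apply: pcharf0_separable.
have fixA (g : gal_of {:E}) c : g (c%:A : E) = c%:A.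
  by rewrite linearZ /= rmorph1.
pose s0 := [pick g : gal_of {:E} | g r != r].
have [g0 gr] : exists g : gal_of {:E}, g r != r.
  apply/existsP; apply: contraR r'1; rewrite negb_exists => /forallP rfix.
  rewrite -[1%VS]/(asval 1%AS) -[1%AS in X in _ \in X]/1%AS.
  have /galois_fixedField <- := galE.
  by apply/fixedFieldP=> [|g _]; [exact: memvf|exact/eqP/negbNE/rfix].
have gal1 (g : gal_of {:E}) : g \in 'Gal({:E} / 1)%g.
  rewrite gal_kHom ?sub1v //; apply/kAHomP => _ /vlineP[c ->]; exact: fixA.
have sgn (g : gal_of {:E}) : g r = r \/ g r = - r.
  have : (g r - r) * (g r + r) = 0.
    by rewrite -subr_sqr -rmorphXn /= rb fixA subrr.
  by move/eqP; rewrite mulf_eq0 subr_eq0 addr_eq0 => /orP[] /eqP; [left|right].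
have inj (g h : gal_of {:E}) : g r = h r -> g = h.
  move=> e; apply/eqP/gal_eqP => u _.
  have : u \in <<1; r>>%VS by rewrite rE memvf.
  case/memv_adjoin_sqrt=> [|_ [_ [/vlineP[c ->] /vlineP[d ->] ->]]].
    by rewrite rb memvZ ?mem1v.
  by rewrite !rmorphD !rmorphM /= !fixA e.
have g0r : g0 r = - r by have [e|//] := sgn g0; rewrite e eqxx in gr.
have r0 : r != 0 by apply: contraNneq r'1 => ->; exact: rpred0.
have g01 : g0 != 1%g by apply: contraNneq gr => ->; rewrite gal_id.
have all2 (g : gal_of {:E}) : (g == 1%g) || (g == g0).
  have [e|e] := sgn g; apply/orP; [left|right]; apply/eqP/inj.
    by rewrite gal_id.
  by rewrite g0r.
rewrite /galNorm (bigD1 1%g) ?gal1 //= (bigD1 g0) ?gal1 ?g01 //= big1; last first.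
  by move=> g; case/andP=> /andP[_ /negPf n1] /negPf n2; have := all2 g; rewrite n1 n2.
rewrite gal_id mulr1 rmorphD rmorphM /= !fixA g0r.
have -> : (x%:A + y%:A * r) * (x%:A + y%:A * - r) = x%:A ^+ 2 - r ^+ 2 * y%:A ^+ 2.
  by ring.
by rewrite rb -!in_algE -!rmorphXn -rmorphM -rmorphB.
Qed.

Lemma norm_from_sqrtP (F : fieldType) (a b : F) :
    [pchar F] =i pred0 -> b != 0 ->
  norm_from_sqrt a b <-> exists x y, a = x ^+ 2 - b * y ^+ 2.
Proof.
move=> F0 b0.
have two : 2 != 0 :> F by apply: pchar0_natf_neq0.
have sq_case c : c ^+ 2 = b -> exists x y, a = x ^+ 2 - b * y ^+ 2.
  move=> cb; have c0 : c != 0 by apply: contraNneq b0 => c0; rewrite -cb c0 expr0n.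
  (* With b = c^2 the form factors as (x - c y)(x + c y); the two factors are chosen to be 1 and
     [a]. *)
  exists ((a + 1) / 2), ((a - 1) / (2 * c)); rewrite -cb.
  by field; rewrite two c0.
split=> [[E [r [rb rE [z]]]]|[x [y ->]]].
  have [r1|r'1] := boolP (r \in 1%VS); last first.
    have : z \in <<1; r>>%VS by rewrite rE memvf.
    case/memv_adjoin_sqrt=> [|_ [_ [/vlineP[c ->] /vlineP[d ->] ->]]].
      by rewrite rb memvZ ?mem1v.
    rewrite (galNorm_sqrt F0 rb rE r'1) -!in_algE => /fmorph_inj <-; by exists c, d.
  move=> _; case/vlineP: r1 => c rc; apply: (sq_case c).
  by apply: (fmorph_inj (in_alg E)); rewrite rmorphXn /= -rb rc.
have [[c cb]|nsq] := pselect (exists c, c ^+ 2 = b).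
  (* Here [b] is a square, so [F] itself plays the role of F(sqrt b) and its norm is the
     identity. *)
  pose E : splittingFieldType F := F^o.
  have full1 : (1%VS : {vspace E}) = fullv by rewrite -regular_fullv.
  exists E, c; split.
  - by rewrite /= cb /GRing.scale /= mulr1.
  - by apply/eqP; rewrite eqEsubv subvf /= -full1 sub1v.
  exists (x ^+ 2 - b * y ^+ 2).
  rewrite /galNorm -full1 (eq_bigl (pred1 1%g)) => [|g].
    by rewrite big_pred1_eq gal_id /GRing.scale /= mulr1.
  rewrite /= (_ : g = 1%g) ?eqxx ?group1 //; apply/eqP/gal_eqP => u.
  case/vlineP=> d ->.
  by rewrite linearZ /= rmorph1 linearZ /= rmorph1.
have irr : irreducible_poly ('X^2 - b%:P).
  apply: cubic_irreducible => [|u]; first by rewrite size_XnsubC.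
  apply/negP; rewrite /root !hornerE => /eqP/subr0_eq e.
  by apply: nsq; exists u.
have [L dimL [r root_r rL]] := irredp_FAdjoin irr.
have rb : r ^+ 2 = b%:A.
  apply/eqP; move: root_r.
  by rewrite rmorphB /= map_polyXn map_polyC /root !hornerE subr_eq0.
have axL : SplittingField.axiom L.
  exists ('X^2 - (b%:A)%:P).
    by rewrite rpredB ?rpredX ?polyOverX // polyOverC memvZ ?mem1v.
  exists [:: r; - r]; last first.
    apply/eqP; rewrite eqEsubv subvf -rL /=.
    by apply/FadjoinP; rewrite sub1v seqv_sub_adjoin ?inE ?eqxx.
  rewrite !big_cons big_nil mulr1 polyCN opprK -subr_sqr -polyC_exp.
  by rewrite rb eqpxx.
pose E : splittingFieldType F := HB.pack L (FieldExt_isSplittingField.Build F L axL).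
exists E, r; split=> //.
exists (x%:A + y%:A * r); apply: (@galNorm_sqrt F E r b F0 rb rL).
apply/vlineP=> -[c rc]; apply: nsq; exists c; apply: (fmorph_inj (in_alg L)).
by rewrite rmorphXn /= -rc rb.
Qed.

Lemma hilbert_symbol_nzsquare (F : fieldType) (a b : F) :
  [pchar F] =i pred0 -> b != 0 -> nzsquare a -> hilbert_symbol a b = 1.
Proof.
move=> F0 b0 [c c0 ->]; rewrite /hilbert_symbol asboolT //.
by apply/norm_from_sqrtP => //; exists c, 0; rewrite expr0n mulr0 subr0.
Qed.

(* The elements b with (a, b) = 1 form the norm group of F(sqrt a), so if they
   include a basis modulo squares then every element is a norm. *)
Lemma hilbert_symbol_nondegenerate (F : fieldType) (a : F) (B : {fset F}) :
    [pchar F] =i pred0 -> basis_mod_squares B ->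
    (exists2 c, c != 0 & forall x y : F, c <> x ^+ 2 - a * y ^+ 2) ->
    (forall b, b \in B -> hilbert_symbol a b = 1) -> a != 0 -> nzsquare a.
Proof.
move=> F0 [B0 Bgen _] [c c0 c_not_norm] aB a0; apply: contrapT => a_nsq.
pose N z := exists x y, z = x ^+ 2 - a * y ^+ 2.
have NM z w : N z -> N w -> N (z * w).
  move=> [x [y ->]] [u [v ->]]; exists (x * u + a * y * v), (x * v + y * u).
  by ring.
(* Symmetry of the symbol: solving a = x^2 - b y^2 for [b] exchanges the roles of [a] and [b]. The
   case y = 0 is excluded because [a] is not a square. *)
have NB b : b \in B -> N b.
  move=> Bb; have := aB b Bb; rewrite /hilbert_symbol.
  case: asboolP => // + _; case/norm_from_sqrtP => // [|x [y axy]]; first exact: B0.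
  have y0 : y != 0.
    apply: contra_notN a_nsq => /eqP y0; move: axy.
    rewrite y0 expr0n mulr0 subr0 => ax; exists x => //.
    by apply: contraNneq a0 => x0; rewrite ax x0 expr0n.
  exists (x / y), (1 / y); rewrite axy; by field.
have [S [SB [z z0 cS]]] := Bgen c c0.
have NS : N (\prod_(b <- S) b).
  rewrite big_seq; elim/big_ind: _ => //; last by move=> b bS; exact/NB/(fsubsetP SB).
  by exists 1, 0; rewrite expr0n mulr0 subr0 expr1n.
have S0 : \prod_(b <- S) b != 0.
  by rewrite prodf_seq_neq0; apply/allP=> b bS; exact/B0/(fsubsetP SB).
have [x [y cxy]] : N c.
  rewrite -[c](divfK S0) cS; apply: NM NS; exists z, 0.
  by rewrite expr0n mulr0 subr0.
exact: c_not_norm cxy.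
Qed.

(** * Non-archimedean fields *)

Section NonArchimedean.
Variables (R : realType) (F : fieldType) (v : F -> R).
Hypothesis vP : nonarch_absolute_value v.

Lemma absv_ge0 x : 0 <= v x. Proof. by have [] := vP. Qed.

Lemma absv_eq0 x : (v x == 0) = (x == 0).
Proof. by have [_ h _ _] := vP; apply/eqP/eqP=> /h. Qed.

Lemma absvM x y : v (x * y) = v x * v y. Proof. by have [] := vP. Qed.

Lemma absv_max x y : v (x + y) <= Num.max (v x) (v y).
Proof. by have [] := vP. Qed.

Lemma absv0 : v 0 = 0. Proof. by apply/eqP; rewrite absv_eq0. Qed.

Lemma absv_gt0 x : (0 < v x) = (x != 0).
Proof. by rewrite lt_def absv_ge0 andbT absv_eq0. Qed.

Lemma absv1 : v 1 = 1.
Proof.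
have n0 : v 1 != 0 by rewrite absv_eq0 oner_neq0.
by apply: (mulfI n0); rewrite -absvM !mulr1.
Qed.

Lemma absvN x : v (- x) = v x.
Proof.
have : v (-1) ^+ 2 = 1 by rewrite expr2 -absvM mulrNN mulr1 absv1.
move/eqP; rewrite sqrf_eq1 => /orP[]/eqP e; first by rewrite -mulN1r absvM e mul1r.
by have := absv_ge0 (-1); rewrite e; lra.
Qed.

Lemma absvX x n : v (x ^+ n) = v x ^+ n.
Proof. by elim: n => [|n IH]; rewrite ?absv1 // !exprS absvM IH. Qed.

Lemma absvV x : v x^-1 = (v x)^-1.
Proof.
have [->|x0] := eqVneq x 0; first by rewrite invr0 absv0 invr0.
have n0 : v x != 0 by rewrite absv_eq0.
by apply: (mulfI n0); rewrite -absvM !divff // absv1.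
Qed.

Lemma absvB x y : v (x - y) = v (y - x).
Proof. by rewrite -absvN opprB. Qed.

Lemma absvD_lt e x y : v x < e -> v y < e -> v (x + y) < e.
Proof. by move=> xe ye; apply: le_lt_trans (absv_max _ _) _; rewrite gt_max xe. Qed.

Lemma absvD_le e x y : v x <= e -> v y <= e -> v (x + y) <= e.
Proof. by move=> xe ye; apply: le_trans (absv_max _ _) _; rewrite ge_max xe. Qed.

Lemma absvD_dom x y : v x < v y -> v (x + y) = v y.
Proof.
move=> xy; apply/eqP; rewrite eq_le absvD_le ?(ltW xy) //=.
rewrite leNgt; apply/negP => h.
have : v (x + y - x) < v y by apply: absvD_lt; rewrite ?absvN.
by rewrite addrAC subrr add0r ltxx.
Qed.

Lemma absvD_domr x y : v y < v x -> v (x + y) = v x.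
Proof. by rewrite addrC; exact: absvD_dom. Qed.

Lemma absvD_neq x y : v x != v y -> v (x + y) = Num.max (v x) (v y).
Proof. by case: ltgtP => // h _; [exact: absvD_dom|exact: absvD_domr]. Qed.

Lemma absv_nat_le1 n : v n%:R <= 1.
Proof. by elim: n => [|n IH]; rewrite ?absv0 // -natr1 absvD_le ?absv1. Qed.

Lemma absv_int_le1 (n : int) : v n%:~R <= 1.
Proof. by case: n => n; rewrite ?NegzE ?rmorphN /= ?absvN absv_nat_le1. Qed.

Lemma absv_sum_lt (I : Type) (r : seq I) (P : pred I) (f : I -> F) e :
  0 < e -> (forall i, P i -> v (f i) < e) -> v (\sum_(i <- r | P i) f i) < e.
Proof. by move=> e0 h; elim/big_ind: _ => //; [rewrite absv0|exact: absvD_lt]. Qed.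

End NonArchimedean.

(** Bernoulli's inequality for [d^-1] = 1 + h makes the powers of [d^-1] grow at least linearly. *)
Lemma expr_lt1_small (R : realType) (d e : R) :
  0 <= d < 1 -> 0 < e -> exists N, forall n, (N <= n)%N -> d ^+ n < e.
Proof.
move=> /andP[d0 d1] e0.
have [->|dn0] := eqVneq d 0; first by exists 1%N => -[|n] // _; rewrite expr0n.
have dp : 0 < d by rewrite lt_def dn0.
pose h := d^-1 - 1.
have h0 : 0 < h by rewrite subr_gt0 invf_gt1.
have bern n : 1 + n%:R * h <= d^-1 ^+ n.
  elim: n => [|n IH]; first by rewrite mul0r addr0 expr0.
  rewrite exprS {1}(_ : d^-1 = 1 + h) -?natr1; last by rewrite /h; ring.
  have := ler_wpM2l (ltW (addr_gt0 ltr01 h0)) IH.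
  have : 0 <= n%:R * h * h by rewrite !mulr_ge0 ?(ltW h0).
  lra.
exists (Num.truncn (e^-1 / h)).+1 => n Nn.
have : e^-1 / h < n%:R.
  apply: (lt_le_trans (truncnS_gt _)); by rewrite ler_nat.
rewrite ltr_pdivrMr // => en.
rewrite -[d]invrK exprVn -[e]invrK ltf_pV2 ?qualifE /= ?invr_gt0 ?exprn_gt0 ?invr_gt0 //.
by have := bern n; lra.
Qed.

(** * Hensel's lemma and norms from unramified extensions *)

Section Hensel.
Variables (R : realType) (F : fieldType) (v : F -> R).
Hypotheses (vP : nonarch_absolute_value v) (vC : complete_for v).

(* Fixed point of the contraction t |-> d - t^2 of the disc |t| <= |d|. *)
Lemma solve_artin_schreier (d : F) :
  v d < 1 -> exists t, v t < 1 /\ t ^+ 2 + t = d.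
Proof.
move=> d1; pose t := fix t n := if n is m.+1 then d - t m ^+ 2 else 0.
have d0 := absv_ge0 vP d.
have tS n : t n.+1 = d - t n ^+ 2 by [].
have td n : v (t n) <= v d.
  elim: n => [|n IH]; first by rewrite (absv0 vP).
  rewrite tS (absvD_le vP) // (absvN vP) // (absvX vP) // expr2.
  apply: le_trans (_ : v d * 1 <= _); last by rewrite mulr1.
  by apply: ler_pM; rewrite ?(absv_ge0 vP) //; apply: le_trans IH (ltW d1).
have step n k : v (t (n + k)%N - t n) <= v d ^+ n.
  elim: n => [|n IH].
    by rewrite subr0 expr0; apply: le_trans (td _) (ltW d1).
  rewrite addSn !tS.
  have -> : d - t (n + k)%N ^+ 2 - (d - t n ^+ 2) =
            - ((t (n + k)%N + t n) * (t (n + k)%N - t n)) by ring.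
  rewrite (absvN vP) // (absvM vP) // exprS ler_pM ?(absv_ge0 vP) //.
  by rewrite (absvD_le vP).
have [l lP] : exists l : F, forall e : R, 0 < e ->
    exists N, forall n : nat, (N <= n)%N -> v (t n - l) < e.
  apply: vC => e e0.
  have [|N NP] := @expr_lt1_small _ (v d) e _ e0; first by rewrite d0.
  exists N => m n Nm Nn; have [mn|nm] := leqP m n.
    rewrite (absvB vP) // -(subnKC mn); exact: le_lt_trans (step _ _) (NP _ _).
  by rewrite -(subnKC (ltnW nm)); apply: le_lt_trans (step _ _) (NP _ _).
have ld : v l < 1.
  have [N NP] := lP 1 ltr01; rewrite -[l](subrK (t N)) (absvD_lt vP) //.
    by rewrite (absvB vP) // NP.
  exact: le_lt_trans (td _) d1.
exists l; split=> //; apply/eqP; rewrite -subr_eq0 -(absv_eq0 vP).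
apply: contraT => n0.
have e0 : 0 < v (l ^+ 2 + l - d) by rewrite lt_def n0 (absv_ge0 vP).
have [N NP] := lP _ e0.
have h1 := NP N (leqnn _); have h2 := NP N.+1 (leqnSn _).
have h3 : v ((t N + l) * (t N - l)) < v (l ^+ 2 + l - d).
  rewrite (absvM vP) //; apply: le_lt_trans h1; rewrite ler_piMl ?(absv_ge0 vP) //.
  by rewrite (absvD_le vP) // ?(ltW ld) //; apply: le_trans (td _) (ltW d1).
(* Since t_(N+1) = d - t_N^2, this combination equals l^2 + l - d, which would thus be strictly
   smaller than itself. *)
have : v (- (t N.+1 - l) - (t N + l) * (t N - l)) < v (l ^+ 2 + l - d).
  by apply: (absvD_lt vP); rewrite (absvN vP).
by rewrite tS (_ : - _ - _ = l ^+ 2 + l - d) ?ltxx //; ring.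
Qed.

(** The substitution y = x + 2 x t turns y^2 = c into t^2 + t = (c - x^2) / (2 x)^2, whose right
    side is small by hypothesis. The residue characteristic may be 2. *)
Lemma hensel_sqrt (x c : F) : v (x ^+ 2 - c) < v (2 * x) ^+ 2 -> nzsquare c.
Proof.
move=> h; have x20 : 2 * x != 0.
  apply: contraTneq h => ->; by rewrite (absv0 vP) // expr0n -leNgt (absv_ge0 vP).
have [two0 x0] : 2 != 0 :> F /\ x != 0 by apply/andP; rewrite -negb_or -mulf_eq0.
have v2x : 0 < v (2 * x) ^+ 2 by rewrite exprn_gt0 // (absv_gt0 vP).
pose d := (c - x ^+ 2) / (2 * x) ^+ 2.
have [|t [_ tP]] := @solve_artin_schreier d.
  by rewrite (absvM vP) // (absvV vP) // (absvX vP) // ltr_pdivrMr // mul1r (absvB vP).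
have cE : c = (x + 2 * x * t) ^+ 2.
  have -> : (x + 2 * x * t) ^+ 2 = x ^+ 2 + (2 * x) ^+ 2 * (t ^+ 2 + t) by ring.
  by rewrite tP mulrC divfK ?expf_neq0 //; ring.
exists (x + 2 * x * t) => //; apply/eqP=> y0.
move: h; rewrite cE y0 expr0n subr0 (absvM vP) // (absvX vP) // exprMn.
suff : v 2 ^+ 2 * v x ^+ 2 <= v x ^+ 2 by lra.
by rewrite ler_piMl ?exprn_ge0 ?(absv_ge0 vP) // exprn_ile1 ?(absv_ge0 vP) // (absv_nat_le1 vP).
Qed.

(* An unramified quadratic extension has only norms of even valuation. *)
Lemma unramified_not_norm (c u x y : F) :
    v 2 = 1 -> v c = 1 -> ~ nzsquare c -> (forall z, v u != v z ^+ 2) ->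
  u <> x ^+ 2 - c * y ^+ 2.
Proof.
move=> v2 vc csq uval E.
have vy : v (c * y ^+ 2) = v y ^+ 2 by rewrite (absvM vP) // vc mul1r (absvX vP).
(* If [x] and [y] have different values, the value of [u] is the larger of v x^2 and v y^2, against
   [uval]. *)
have [e|ne] := eqVneq (v x) (v y); last first.
  have : v (x ^+ 2) != v (- (c * y ^+ 2)).
    by rewrite (absvN vP) // vy (absvX vP) // eqrXn2 ?(absv_ge0 vP).
  move/(absvD_neq vP); rewrite -E (absvN vP) // vy (absvX vP) //.
  by case: leP => _ h; [have := uval y|have := uval x]; rewrite h eqxx.
have y0 : y != 0.
  apply/eqP=> y0; have x0 : x = 0.
    by apply/eqP; rewrite -(absv_eq0 vP) e y0 (absv0 vP).
  by have := uval 0; rewrite E x0 y0 expr0n mulr0 subr0 (absv0 vP) // expr0n eqxx.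
have vy0 : 0 < v y by rewrite (absv_gt0 vP).
(* For equal values x / y is an approximate square root of [c]: the error u / y^2 has value at most
   1, and not 1 because [v u] is not the square of a value. *)
apply: csq; apply: (@hensel_sqrt (x / y)).
have -> : (x / y) ^+ 2 - c = u / y ^+ 2 by rewrite E; field.
have -> : v (2 * (x / y)) = 1.
  by rewrite !(absvM vP) // v2 (absvV vP) // e divff ?mul1r // gt_eqF.
rewrite expr1n (absvM vP) // (absvV vP) // (absvX vP) // ltr_pdivrMr ?exprn_gt0 // mul1r.
rewrite lt_neqAle uval E (absvD_le vP) // ?(absvN vP) // ?vy //.
by rewrite (absvX vP) // e.
Qed.

End Hensel.

(** * A non-norm in the dyadic case *)

Section DyadicUnits.
Variables (R : realType) (F : fieldType) (v : F -> R) (om c : F).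
Hypotheses (vP : nonarch_absolute_value v) (v2 : v 2 < 1).

Lemma absvD_even x y : v x = 1 -> v y <= 1 -> v (x + 2 * y) = 1.
Proof.
move=> x1 y1; rewrite (absvD_domr vP) // x1 (absvM vP) //.
by apply: le_lt_trans v2; rewrite ler_piMr ?(absv_ge0 vP).
Qed.

Hypotheses (om2 : om ^+ 2 = om + 1 + 2 * c) (vc : v c <= 1).

Lemma absv_cube_root : v om = 1.
Proof.
have e : v (om ^+ 2 - om) = 1.
  by rewrite om2 (_ : _ - _ = 1 + 2 * c); [rewrite absvD_even ?(absv1 vP)|ring].
have [h|h|//] := ltgtP (v om) 1.
  have : v (om ^+ 2 - om) < 1; last by rewrite e ltxx.
  by apply: (absvD_lt vP); rewrite ?(absvN vP) // (absvX vP) // expr_lt1 ?(absv_ge0 vP).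
have h2 : v om < v om ^+ 2 by rewrite expr2 ltr_pMr // (lt_trans ltr01).
move: e; rewrite (absvD_domr vP) //; last by rewrite (absvN vP) // (absvX vP).
by rewrite (absvX vP) // => e; have := lt_trans h h2; rewrite e ltxx.
Qed.

Lemma absv_cube_root_add1 : v (om + 1) = 1.
Proof.
have : v (om * (om + 1)) = 1.
  rewrite (_ : om * (om + 1) = 1 + 2 * (om + c)).
    by rewrite absvD_even ?(absv1 vP) // (absvD_le vP) ?absv_cube_root.
  by rewrite mulrDr mulr1 -expr2 om2; ring.
by rewrite (absvM vP) absv_cube_root mul1r.
Qed.

End DyadicUnits.

Section Dyadic.
Variables (R : realType) (F : fieldType) (v : F -> R) (th om c : F).
Hypotheses (vP : nonarch_absolute_value v) (v2 : v 2 < 1).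
Hypotheses (th2 : th ^+ 2 = 2) (th0 : th != 0).
Hypotheses (om2 : om ^+ 2 = om + 1 + 2 * c) (vc : v c <= 1).
Hypothesis discrete : forall x, v x < 1 -> v x <= v th.
Hypothesis residues : forall x, v x <= 1 ->
  exists2 r, r \in [:: 0; 1; om; om + 1] & v (x - r) < 1.

Let g := v th.
Let g0 : 0 < g. Proof. by rewrite (absv_gt0 vP). Qed.
Let g2E : v 2 = g ^+ 2. Proof. by rewrite -th2 (absvX vP). Qed.

Let g1 : g < 1.
Proof.
by rewrite ltNge; apply/negP=> /(exprn_ege1 2); rewrite -g2E leNgt v2.
Qed.

Let g2g : g ^+ 2 < g. Proof. by rewrite expr2 gtr_pMl. Qed.

(** Squares skip a level: if x^2 is 1 modulo [th] then so is x, by discreteness [th] divides x - 1,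
    and x^2 - 1 = (x - 1)^2 + 2 (x - 1) is divisible by th^2 = 2. *)
Let small_sq_sub1 x : v x <= 1 -> v (x ^+ 2 - 1) < 1 -> v (x ^+ 2 - 1) <= g ^+ 2.
Proof.
move=> x1 h.
have hx : v (x - 1) <= 1 by rewrite (absvD_le vP) ?(absvN vP) ?(absv1 vP).
have h1 : v (2 * (x - 1)) <= g ^+ 2.
  by rewrite (absvM vP) // g2E ler_piMr ?exprn_ge0 ?(ltW g0).
have : v ((x - 1) ^+ 2) < 1.
  have -> : (x - 1) ^+ 2 = (x ^+ 2 - 1) - 2 * (x - 1) by ring.
  apply: (absvD_lt vP) => //; rewrite (absvN vP) //.
  by apply: le_lt_trans h1 _; rewrite -g2E.
rewrite (absvX vP) // expr_lt1 ?(absv_ge0 vP) // => /discrete hg.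
have -> : x ^+ 2 - 1 = (x - 1) ^+ 2 + 2 * (x - 1) by ring.
by rewrite (absvD_le vP) // (absvX vP) // ler_pXn2r ?qualifE /= ?(absv_ge0 vP).
Qed.

Let vom : v om = 1 := absv_cube_root vP v2 om2 vc.

(** Modulo [th], the substitution t = 1 / (1 + w) turns om (1 + w)^2 + w = 0 into t^2 + t = om,
    impossible in F_4 since om + om^2 = 1 is the trace of [om]. The four residues are checked one by
    one, after splitting off the difference between [w] and its residue. *)
Let residue_poly w : v w <= 1 -> v (om * (1 + w) ^+ 2 + w) = 1.
Proof.
move=> w1; have [r rin re] := residues w1.
pose e := w - r.
have r1 : v r <= 1.
  by move: rin; rewrite !inE => /or4P[] /eqP->;
    rewrite ?(absv0 vP) ?(absv1 vP) ?(absvD_le vP) ?(absv1 vP) ?vom ?ler01.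
have -> : om * (1 + w) ^+ 2 + w =
    e * (om * (2 * (1 + r) + e) + 1) + (om * (1 + r) ^+ 2 + r).
  by rewrite /e; ring.
have r1' : v (1 + r) <= 1 by rewrite (absvD_le vP) ?(absv1 vP).
have o1 : v om <= 1 by rewrite vom.
have i1 : v 1 <= 1 by rewrite (absv1 vP).
have M x y : v x <= 1 -> v y <= 1 -> v (x * y) <= 1.
  by move=> x1 y1; rewrite (absvM vP) // mulr_ile1 ?(absv_ge0 vP).
have A x y : v x <= 1 -> v y <= 1 -> v (x + y) <= 1 by exact: (absvD_le vP).
have two1 : v 2 <= 1 := ltW v2.
suff E : v (om * (1 + r) ^+ 2 + r) = 1.
  rewrite (absvD_dom vP) // E (absvM vP) //.
  apply: (le_lt_trans _ re); rewrite ler_piMr ?(absv_ge0 vP) //.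
  by apply: (A) => //; apply: (M) => //; apply: (A); [exact: M|exact: ltW re].
move: rin; rewrite !inE => /or4P[] /eqP->.
- by rewrite !addr0 expr1n mulr1.
- rewrite (_ : _ + _ = 1 + 2 * (2 * om)); last by ring.
  by rewrite (absvD_even vP v2) ?(absv1 vP) // M.
- have -> : om * (1 + om) ^+ 2 + om =
            om * (om ^+ 2) + 2 * (om ^+ 2) + 2 * om by ring.
  rewrite om2; have -> : om * (om + 1 + 2 * c) + 2 * (om + 1 + 2 * c) + 2 * om =
            om ^+ 2 + om + 2 * (om * c + (om + 1 + 2 * c) + om) by ring.
  rewrite om2; have -> : forall z, om + 1 + 2 * c + om + 2 * z = 1 + 2 * (c + om + z).
    by move=> z; ring.
  by rewrite (absvD_even vP v2) ?(absv1 vP) // !(A, M).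
- have -> : om * (1 + (om + 1)) ^+ 2 + (om + 1) =
            om * (om ^+ 2) + 4 * om ^+ 2 + 5 * om + 1 by ring.
  rewrite om2; have -> : om * (om + 1 + 2 * c) + 4 * (om + 1 + 2 * c) + 5 * om + 1 =
            om ^+ 2 + 1 + 2 * (om * c + 2 * (om + 1 + 2 * c) + om + 2 * om) by ring.
  rewrite om2; have -> : forall z, om + 1 + 2 * c + 1 + 2 * z = om + 2 * (1 + c + z).
    by move=> z; ring.
  by rewrite (absvD_even vP v2) // !(A, M).
Qed.

Lemma dyadic_not_sum_two_squares x y : 1 + om * th <> x ^+ 2 + y ^+ 2.
Proof.
wlog xy : x y / v x <= v y.
  have [h|h] := leP (v x) (v y); first exact.
  by move=> /(_ y x (ltW h)); rewrite (addrC (y ^+ 2)).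
set b := 1 + om * th => E.
have vb1 : v (b - 1) = g by rewrite /b addrC addKr (absvM vP) // vom mul1r.
have vb : v b = 1.
  by rewrite -[b](subrK 1) (absvD_dom vP) ?(absv1 vP) // vb1.
have y0 : y != 0.
  apply/eqP=> y0; move: xy; rewrite y0 (absv0 vP) // => x0.
  have : v x == 0 by rewrite eq_le x0 (absv_ge0 vP).
  rewrite (absv_eq0 vP) // => /eqP x00; move: vb.
  by rewrite E x00 y0 expr0n addr0 (absv0 vP) // => /esym/eqP; rewrite oner_eq0.
have vy0 : 0 < v y by rewrite (absv_gt0 vP).
(* The shift by 1 exhibits x^2 + y^2 as (x + y)^2 up to a multiple of 2; the cases are z a unit and
   z divisible by [th]. *)
pose z := x / y + 1.
have vz : v z <= 1.
  by rewrite (absvD_le vP) ?(absv1 vP) // (absvM vP) // (absvV vP) // ler_pdivrMr // mul1r.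
have bz : b = y ^+ 2 * (z ^+ 2 - 2 * z + 2) by rewrite E /z; field.
have [zg|gz] := leP (v z) g; last first.
  have z0 : z != 0 by rewrite -(absv_gt0 vP) // (lt_trans g0).
  have vz0 : 0 < v z by rewrite (absv_gt0 vP).
  have vz1 : v z = 1.
    apply/eqP; rewrite eq_le vz /=.
    have : v (th / z) <= g.
      by apply: discrete; rewrite (absvM vP) // (absvV vP) // ltr_pdivrMr ?mul1r.
    by rewrite (absvM vP) // (absvV vP) // ler_pdivrMr // ler_pMr.
  have vy1 : v y = 1.
    have : v (z ^+ 2 - 2 * z + 2) = 1.
      have -> : z ^+ 2 - 2 * z + 2 = z ^+ 2 + 2 * (1 - z) by ring.
      by rewrite (absvD_even vP v2) ?(absvX vP) ?vz1 ?expr1n // (absvD_le vP) ?(absvN vP) ?(absv1 vP).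
    move=> e; move: vb; rewrite bz (absvM vP) // e mulr1 (absvX vP) //.
    by move/eqP; rewrite pexpr_eq1 ?(absv_ge0 vP) // => /eqP.
  (* This is x + y. Then b = n^2 modulo 2, so n^2 - 1 has value exactly g, which [small_sq_sub1]
     forbids. *)
  pose n := y * z.
  have bn : v (b - n ^+ 2) <= g ^+ 2.
    have -> : b - n ^+ 2 = 2 * (y ^+ 2 * (1 - z)) by rewrite bz /n; ring.
    rewrite (absvM vP) // g2E ler_piMr ?exprn_ge0 ?(ltW g0) //.
    by rewrite (absvM vP) // (absvX vP) // vy1 expr1n mul1r (absvD_le vP) ?(absvN vP) ?(absv1 vP).
  have nE : v (n ^+ 2 - 1) = g.
    have -> : n ^+ 2 - 1 = - (b - n ^+ 2) + (b - 1) by ring.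
    by rewrite (absvD_dom vP) ?vb1 // (absvN vP) // (le_lt_trans bn).
  have : v (n ^+ 2 - 1) <= g ^+ 2.
    by rewrite small_sq_sub1 ?nE // /n (absvM vP) // vy1 vz1 mulr1.
  by rewrite nE leNgt g2g.
pose w := z / th; pose m := th * y.
have vw : v w <= 1 by rewrite (absvM vP) // (absvV vP) // ler_pdivrMr // mul1r.
have bw : b = m ^+ 2 * (w ^+ 2 + 1 - th * w).
  have -> : m ^+ 2 * (w ^+ 2 + 1 - th * w) =
            y ^+ 2 * (z ^+ 2 - th ^+ 2 * z + th ^+ 2) by rewrite /m /w; field.
  by rewrite th2 bz.
have vthw : v (th * w) <= g by rewrite (absvM vP) // ler_piMr ?(absv_ge0 vP).
have v2w : v (2 * w) <= g ^+ 2 by rewrite (absvM vP) // -g2E ler_piMr ?(absv_ge0 vP).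
have m0 : m != 0 by rewrite mulf_neq0.
have : v (w ^+ 2 + 1) <= 1.
  by rewrite (absvD_le vP) ?(absv1 vP) // (absvX vP) // exprn_ile1 ?(absv_ge0 vP).
(* If w^2 + 1 is small then so is w - 1, and the cofactor of m^2 in [b] has value exactly g. As v b
   = 1, g would be the square of a value, impossible for the largest value below 1. *)
rewrite le_eqVlt => /orP[/eqP w1|w1]; last first.
  have : v ((w - 1) ^+ 2) < 1.
    have -> : (w - 1) ^+ 2 = w ^+ 2 + 1 - 2 * w by ring.
    apply: (absvD_lt vP) => //; rewrite (absvN vP) //.
    by apply: le_lt_trans v2w _; rewrite -g2E.
  rewrite (absvX vP) // expr_lt1 ?(absv_ge0 vP) // => /discrete hg.
  have e : v (w ^+ 2 + 1 - th * w) = g.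
    have -> : w ^+ 2 + 1 - th * w =
              (2 * w + (w - 1) ^+ 2 - th * (w - 1)) - th by ring.
    have [vm vn] : v (2 * w + (w - 1) ^+ 2) <= g ^+ 2 /\ v (- (th * (w - 1))) <= g ^+ 2.
      split; last by rewrite (absvN vP) // (absvM vP) // expr2 ler_pM ?(absv_ge0 vP).
      by rewrite (absvD_le vP) // (absvX vP) // ler_pXn2r ?qualifE /= ?(absv_ge0 vP).
    by rewrite (absvD_dom vP) ?(absvN vP) //; apply: le_lt_trans g2g; rewrite (absvD_le vP).
  have mg : v m^-1 ^+ 2 = g.
    have vm0 : v m != 0 by rewrite (absv_eq0 vP).
    have e1 := vb; rewrite bw (absvM vP) e (absvX vP) in e1.
    apply: (mulfI (expf_neq0 2 vm0)).
    by rewrite e1 (absvV vP) -exprMn divff // expr1n.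
  have : v m^-1 <= g.
    by apply: discrete; rewrite -(expr_lt1 (n := 2)) ?(absv_ge0 vP) // mg.
  move=> h; suff : g <= g ^+ 2 by rewrite leNgt g2g.
  by rewrite -{1}mg ler_pXn2r ?qualifE /= ?(absv_ge0 vP) // ltW.
have vm : v m = 1.
  have : v (w ^+ 2 + 1 - th * w) = 1.
    by rewrite (absvD_domr vP) // (absvN vP) // w1 (le_lt_trans vthw).
  move=> e; move: vb; rewrite bw (absvM vP) // e mulr1 (absvX vP) //.
  by move/eqP; rewrite pexpr_eq1 ?(absv_ge0 vP) // => /eqP.
(* Now b = k^2 modulo [th], hence k^2 = 1 modulo th^2 by [small_sq_sub1]. Dividing b - k^2 by [th]
   leaves om + m^2 w = 0 modulo [th]. *)
pose k := m * (1 + w).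
have bk : b - k ^+ 2 = m ^+ 2 * (- (th * w) - 2 * w) by rewrite bw /k; ring.
have v2w' : v (2 * w) <= g by apply: le_trans v2w (ltW g2g).
have vbk : v (b - k ^+ 2) <= g.
  by rewrite bk (absvM vP) // (absvX vP) // vm expr1n mul1r (absvD_le vP) ?(absvN vP).
have vk : v (k ^+ 2 - 1) <= g ^+ 2.
  have v1w : v (1 + w) <= 1 by rewrite (absvD_le vP) ?(absv1 vP).
  apply: small_sq_sub1; first by rewrite (absvM vP) // vm mul1r.
  have -> : k ^+ 2 - 1 = - (b - k ^+ 2) + (b - 1) by ring.
  by apply: le_lt_trans g1; rewrite (absvD_le vP) ?(absvN vP) ?vb1.
have small : v (om + m ^+ 2 * w) < 1.
  have -> : om + m ^+ 2 * w = ((k ^+ 2 - 1) - m ^+ 2 * (2 * w)) / th.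
    have -> : k ^+ 2 = b - m ^+ 2 * (- (th * w) - 2 * w) by rewrite -bk; ring.
    by rewrite /b; field.
  rewrite (absvM vP) // (absvV vP) // ltr_pdivrMr // mul1r; apply: le_lt_trans g2g.
  by rewrite (absvD_le vP) // (absvN vP) // (absvM vP) // (absvX vP) // vm expr1n mul1r.
(* Multiplying by (1 + w)^2 and replacing k^2 = m^2 (1 + w)^2 by 1 gives the insoluble residue
   equation. *)
have := residue_poly vw.
have -> : om * (1 + w) ^+ 2 + w =
  (om + m ^+ 2 * w) * (1 + w) ^+ 2 - (k ^+ 2 - 1) * w by rewrite /k; ring.
move=> e1; suff : v ((om + m ^+ 2 * w) * (1 + w) ^+ 2 - (k ^+ 2 - 1) * w) < 1.
  by rewrite e1 ltxx.
have v1w : v (1 + w) <= 1 by rewrite (absvD_le vP) ?(absv1 vP).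
apply: (absvD_lt vP); rewrite ?(absvN vP) // (absvM vP) //.
  apply: le_lt_trans small; rewrite ler_piMr ?(absv_ge0 vP) //.
  by rewrite (absvX vP) // exprn_ile1 ?(absv_ge0 vP).
apply: le_lt_trans (le_lt_trans vk (lt_trans g2g g1)).
by rewrite ler_piMr ?(absv_ge0 vP).
Qed.

End Dyadic.

(** * Square roots of rational numbers in number fields *)

Lemma rat_integral_int (x : rat) :
  integralOver (intr : int -> rat) x -> exists z : int, x = z%:~R.
Proof.
case=> P monP rootP.
have /(Cint_rat_Aint (Crat_rat x)) : ratr x \in Aint.
  apply: (@root_monic_Aint (map_poly (intr : int -> algC) P)).
  - have -> : map_poly (intr : int -> algC) P = map_poly ratr (map_poly (intr : int -> rat) P).
      by rewrite -map_poly_comp; apply: eq_map_poly => z /=; rewrite ratr_int.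
    by rewrite fmorph_root.
  - exact: monic_map.
  by apply/polyOverP=> i; rewrite coef_map /= intr_int.
by case/intrP=> z; rewrite -(ratr_int _ z) => /fmorph_inj ->; exists z.
Qed.

Lemma rat_sqr_int (x : rat) (n : int) :
  x ^+ 2 = n%:~R -> exists z : int, x = z%:~R /\ z ^+ 2 = n.
Proof.
move=> xn; have [|z xz] := @rat_integral_int x.
  exists ('X^2 - n%:P); first by rewrite monicXnsubC.
  by rewrite rmorphB /= map_polyXn map_polyC /root !hornerE xn subrr.
exists z; split=> //; apply/eqP; rewrite -(eqr_int rat) rmorphXn /= -xz; exact/eqP.
Qed.

Lemma rat_sqr_nat (x : rat) (n : nat) :
  x ^+ 2 = n%:R -> exists k : nat, (k ^ 2)%N = n.
Proof.
case/(@rat_sqr_int _ n)=> z [_ zn]; exists `|z|%N.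
by apply/eqP; rewrite -eqz_nat -zn -abszX gez0_abs // exprn_even_ge0.
Qed.

(** Its parity is multiplicative and trivial on squares: a character of the positive integers modulo
    squares, used to separate square classes. *)
Definition sum_logn (ls : seq nat) (n : nat) := (\sum_(l <- ls) logn l n)%N.

Lemma sum_lognM ls m n : (0 < m)%N -> (0 < n)%N ->
  sum_logn ls (m * n) = (sum_logn ls m + sum_logn ls n)%N.
Proof.
by move=> m0 n0; rewrite /sum_logn -big_split; apply: eq_bigr => l _; rewrite /= lognM.
Qed.

Lemma sum_logn_sqr ls k : ~~ odd (sum_logn ls (k ^ 2)).
Proof.
rewrite /sum_logn; elim: ls => [|l ls IH]; first by rewrite big_nil.
by rewrite big_cons lognX oddD oddM /= (negPf IH).
Qed.

Section QuadraticExtension.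
Variables (L : fieldExtType rat).
Implicit Types (E : {subfield L}) (r x y : L).

Lemma natr_numfield_neq0 n : (0 < n)%N -> n%:R != 0 :> L.
Proof.
by case: n => // n _; apply: pchar0_natf_neq0 => i; rewrite pchar_lalg pchar_num.
Qed.

Lemma char0_2 : 2 != 0 :> L. Proof. exact: natr_numfield_neq0. Qed.

(** In y = a + b r, squaring shows that 2 a b r lies in [E]. So if [r] is not in [E], one of [a] and
    [b] vanishes. *)
Lemma sqrt_mem_adjoin E r y : r ^+ 2 \in E -> y ^+ 2 \in E ->
  y \in <<E; r>>%VS -> y \in E \/ y * r \in E.
Proof.
move=> Er2 Ey2 /(memv_adjoin_sqrt Er2)[a [b [Ea Eb yE]]].
have [Er|E'r] := boolP (r \in E); first by left; rewrite yE rpredD ?rpredM.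
have [a0|a0] := eqVneq a 0.
  by right; rewrite yE a0 add0r -mulrA rpredM.
left; have [b0|b0] := eqVneq b 0; first by rewrite yE b0 mul0r addr0.
case/negP: E'r; have ab0 : 2 * a * b != 0 by rewrite !mulf_neq0 ?char0_2.
have -> : r = (y ^+ 2 - a ^+ 2 - b ^+ 2 * r ^+ 2) / (2 * a * b).
  by rewrite yE; field; rewrite a0 b0 char0_2.
have E2 : 2 \in E by exact: rpred_nat.
apply: rpred_div; last by rewrite !rpredM.
by apply: rpredB; [apply: rpredB => //; exact: rpredX|rewrite rpredM // rpredX].
Qed.

(* Multiplicative independence modulo squares, tested on the parity of the
   number of prime factors taken in ls. *)
Lemma sqrt_notin_adjoin (ls : seq nat) (rs : seq L) (y : L) (n : nat) :
    {in rs, forall r, exists m : nat, [/\ r ^+ 2 = m%:R, (0 < m)%N & ~~ odd (sum_logn ls m)]} ->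
    y ^+ 2 = n%:R -> (0 < n)%N -> odd (sum_logn ls n) -> y \notin <<1 & rs>>%VS.
Proof.
elim/last_ind: rs y n => [|rs r IH] y n rsP yn n0 on.
  apply/negP; rewrite Fadjoin_nil => /vlineP[k yk].
  have /rat_sqr_nat[m mn] : k ^+ 2 = n%:R.
    by apply: (fmorph_inj (in_alg L)); rewrite rmorphXn rmorph_nat -yn yk.
  by move: on; rewrite -mn (negPf (sum_logn_sqr _ _)).
have [|m [rm m0 om]] := rsP r; first by rewrite mem_rcons mem_head.
have rsP' : {in rs, forall r, exists m : nat,
    [/\ r ^+ 2 = m%:R, (0 < m)%N & ~~ odd (sum_logn ls m)]}.
  by move=> x xs; apply: rsP; rewrite mem_rcons inE xs orbT.
have nat1 k : k%:R \in <<1 & rs>>%VS by apply: rpred_nat.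
rewrite adjoin_rcons; apply/negP=> /sqrt_mem_adjoin[]; rewrite ?rm ?yn //.
  exact/negP/(IH _ n).
apply/negP/(IH _ (n * m)%N); rewrite ?exprMn ?yn ?rm ?natrM ?muln_gt0 ?n0 //.
by rewrite sum_lognM // oddD on (negPf om).
Qed.

Lemma conjugation E r : r \notin E -> r ^+ 2 \in E -> <<E; r>>%VS = fullv ->
  exists s : {rmorphism L -> L}, {in E, forall x, s x = x} /\ s r = - r.
Proof.
move=> E'r Er2 Efull.
pose P := 'X^2 - (r ^+ 2)%:P.
have EP : P \is a polyOver E.
  by apply: rpredB; [apply: rpredX; exact: polyOverX|rewrite polyOverC].
have minP : minPoly E r = P.
  have dv : minPoly E r %| P.
    by apply: minPoly_dvdp; rewrite // /root !hornerE subrr.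
  have P0 : P != 0 by rewrite -size_poly_eq0 size_XnsubC.
  apply/eqP; rewrite -eqp_monic ?monic_minPoly ?monicXnsubC // -dvdp_size_eqp //.
  rewrite eqn_leq dvdp_leq // size_XnsubC // size_minPoly ltnS.
  by rewrite ltn_neqAle eq_sym adjoin_deg_eq1 E'r.
have root_r : root (map_poly \1%VF (minPoly E r)) (- r).
  rewrite (_ : map_poly _ _ = minPoly E r).
    by rewrite minP /root !hornerE sqrrN subrr.
  by apply/polyP=> i; rewrite coef_map /= lfunE.
have := kHomExtendP (sub1v _) (kHom1 _ _) root_r.
rewrite Efull => /kHom_monoid_morphism fM.
pose s : {rmorphism L -> L} := HB.pack (fun_of_lfun (kHomExtend E \1 r (- r)))
  (GRing.isMonoidMorphism.Build _ _ _ fM).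
exists s; split=> [x Ex|]; first by rewrite /= kHomExtend_id // lfunE.
exact: (kHomExtend_val (kHom1 1 _) root_r).
Qed.

End QuadraticExtension.

(** * Congruences for x^2 - d y^2 = 4 *)

Lemma square_of_even_logn n : (0 < n)%N ->
  (forall l, prime l -> ~~ odd (logn l n)) -> exists k, n = (k ^ 2)%N.
Proof.
have [N] := ubnP n; elim: N n => // N IH n nN n0 ev.
have [n1|n1] := leqP n 1; first by exists 1%N; lia.
have pr := pdiv_prime n1; set l := pdiv n in pr.
have ln : (l %| n)%N := pdiv_dvd n.
have l2n : (l ^ 2 %| n)%N.
  rewrite pfactor_dvdn //; have := ev l pr.
  have : (0 < logn l n)%N by rewrite logn_gt0 mem_primes pr n0.
  by case: logn => [|[|]].
have [m nE] := dvdnP l2n.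
have m0 : (0 < m)%N by move: n0; rewrite nE muln_gt0 => /andP[].
have l1 := prime_gt1 pr.
case: (IH m) => // [|l' pl'|k kE].
- apply: (@leq_trans n) => //; rewrite nE -[X in (X < _)%N]muln1 ltn_pmul2l //.
  by rewrite (ltn_exp2l 0).
- have := ev l' pl'; rewrite nE lognM // ?expn_gt0 ?(ltnW l1) // lognX.
  by rewrite oddD oddM /= addbF.
by exists (k * l)%N; rewrite expnMn -kE.
Qed.

Lemma square_div n t k : (0 < t)%N -> (n * t ^ 2 = k ^ 2)%N -> exists u, n = (u ^ 2)%N.
Proof.
move=> t0 e; have : (t ^ 2 %| k ^ 2)%N by rewrite -e dvdn_mull.
rewrite dvdn_pexp2r // => /dvdnP[u kE]; exists u.
by apply/eqP; rewrite -(@eqn_pmul2r (t ^ 2)) ?expn_gt0 ?t0 // e kE expnMn.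
Qed.

Lemma even_logn_sqr l k : ~~ odd (logn l (k ^ 2)).
Proof. by rewrite lognX oddM. Qed.

(** The numbers [m] and m' = m - 4 share no odd prime. An odd prime dividing [m] but not [d]
    therefore has in [m] the same exponent as in y^2. *)
Lemma odd_prime_even_logn l m m' d y :
    prime l -> (l != 2)%N -> (0 < d)%N -> ~~ (l %| d)%N -> (0 < m')%N ->
    m = (m' + 4)%N -> (m * m' = d * y ^ 2)%N ->
  ~~ odd (logn l m).
Proof.
move=> pl l2 d0 ld m'0 mE e.
have m0 : (0 < m)%N by rewrite mE addn4.
have y0 : (0 < y)%N.
  have : (0 < d * y ^ 2)%N by rewrite -e muln_gt0 m0.
  by rewrite muln_gt0 expn_gt0 orbF => /andP[].
have [lm|lm] := boolP (l %| m)%N; last by rewrite lognE pl m0 (negPf lm).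
have lm' : ~~ (l %| m')%N.
  apply: contra l2 => lm'; move: lm; rewrite mE dvdn_addr // (_ : 4 = 2 ^ 2)%N //.
  by rewrite Euclid_dvdX // andbT dvdn_prime2.
have : logn l (m * m') = logn l (d * y ^ 2) by rewrite e.
rewrite !lognM ?expn_gt0 ?y0 // (@lognE l m') (negPf lm') !andbF addn0.
rewrite (@lognE l d) (negPf ld) !andbF add0n => ->.
by rewrite addnn odd_double.
Qed.

(** If m = 2 modulo 4 then m m' / 4 is 3 modulo 4, while [d] times a square is 0 or 1. If m = 4 k,
    one of k and k - 1 is odd, so [m] or [m'] has exponent exactly 2 at the prime 2, and the two
    exponents have an even sum. *)
Lemma even_logn2 m m' d y :
    (d %% 4 = 1)%N -> (0 < m')%N -> m = (m' + 4)%N -> (m * m' = d * y ^ 2)%N ->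
  ~~ odd (logn 2 m).
Proof.
move=> d1 m'0 mE e.
have d0 : (0 < d)%N by case: d d1 {e}.
have m0 : (0 < m)%N by rewrite mE addn4.
have y0 : (0 < y)%N.
  have : (0 < d * y ^ 2)%N by rewrite -e muln_gt0 m0.
  by rewrite muln_gt0 expn_gt0 orbF => /andP[].
have [k mk] : exists k, m = (4 * k)%N \/ m = (4 * k + 2)%N \/ odd m.
  exists (m %/ 4)%N; have := divn_eq m 4; have : (m %% 4 < 4)%N by rewrite ltn_mod.
  by case: (m %% 4)%N => [|[|[|[|//]]]] _ h; lia.
case: mk => [mk|[mk|om]]; last first.
- by rewrite lognE dvdn2 om andbF.
- have m2 : m' = (2 * (2 * k - 1))%N by lia.
  have k0 : (0 < k)%N by lia.
  have ye : ~~ odd y.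
    have : ~~ odd (d * y ^ 2) by rewrite -e m2 !oddM andbF.
    rewrite oddM oddX /= (_ : odd d) //.
    by rewrite (divn_eq d 4) d1 oddD oddM andbF.
  have [y1 y1E] : exists y1, y = (2 * y1)%N by exists (y./2); lia.
  have e1 : ((2 * k + 1) * (2 * k - 1) = d * y1 ^ 2)%N.
    apply/eqP; rewrite -(@eqn_pmul2l 4) //; apply/eqP.
    move: e; rewrite m2 mk y1E expnMn => e; lia.
  have dE := divn_eq d 4; rewrite d1 in dE.
  exfalso; have [j yj] : exists j, (y1 = 2 * j \/ y1 = 2 * j + 1)%N.
    by exists (y1./2); lia.
  rewrite dE in e1; move: (d %/ 4)%N e1 => v e1; case: k k0 {mk m2 e} e1 => // k _ e1.
  case: yj => yj; rewrite yj in e1.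
    have : (4 * (k * k + 2 * k) + 3 = 4 * ((v * 4 + 1) * (j * j)))%N by nia.
    lia.
  have : (4 * (k * k + 2 * k) + 3 = 4 * (v * (2 * j + 1) ^ 2 + j * j + j) + 1)%N by nia.
  lia.
have k0 : (0 < k)%N by lia.
have [ok|ek] := boolP (odd k).
  rewrite mk (lognM 2 (isT : (0 < 2 ^ 2)%N)) // pfactorK //.
  by rewrite oddD /= lognE dvdn2 ok andbF.
have m2 : m' = (2 ^ 2 * (k - 1))%N by lia.
have ok1 : odd (k - 1) by lia.
have l2m' : logn 2 m' = 2.
  by rewrite m2 lognM // ?(odd_gt0 ok1) // pfactorK // lognE dvdn2 ok1 andbF.
have : logn 2 (m * m') = logn 2 (d * y ^ 2) by rewrite e.
rewrite lognM // l2m' (lognM 2 d0) ?expn_gt0 ?y0 // (@lognE 2 d) dvdn2.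
rewrite (_ : odd d) ?andbF; last by rewrite (divn_eq d 4) d1 oddD oddM andbF.
by move/(congr1 odd); rewrite !oddD addbF /= (negPf (even_logn_sqr _ _)) => ->.
Qed.

Lemma sqr_mod8 t : (t ^ 2 %% 8 \in [:: 0; 1; 4])%N.
Proof.
rewrite -modnXm; have : (t %% 8 < 8)%N by rewrite ltn_mod.
by move: (t %% 8)%N => [|[|[|[|[|[|[|[|//]]]]]]]].
Qed.

Lemma no_mod8_solution a b t u :
    (a %% 8 = 3)%N -> (b %% 8 = 3)%N ->
  ~ (a * t ^ 2 = 2 * b * u ^ 2 + 1)%N /\ ~ (2 * a * t ^ 2 = b * u ^ 2 + 1)%N.
Proof.
move=> a3 b3; split=> /(congr1 (modn^~ 8%N)).
  rewrite -modnMm a3 -(modnDml (2 * b * _)) -(modnMm (2 * b)) -(modnMmr 2 b) b3.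
  by have := sqr_mod8 t; have := sqr_mod8 u; rewrite !inE
    => /or3P[]/eqP-> /or3P[]/eqP->.
rewrite -modnMm -(modnMmr 2 a) a3 -(modnDml (b * _)) -(modnMm b) b3.
by have := sqr_mod8 t; have := sqr_mod8 u; rewrite !inE
    => /or3P[]/eqP-> /or3P[]/eqP->.
Qed.

Lemma sqr_mul_dvd a t k : prime a -> (a * t = k ^ 2)%N -> exists u, t = (a * u ^ 2)%N.
Proof.
move=> pa e; have : (a %| k ^ 2)%N by rewrite -e dvdn_mulr.
rewrite Euclid_dvdX // andbT => /dvdnP[u kE]; exists u.
have a0 := prime_gt0 pa.
by apply/eqP; rewrite -(eqn_pmul2l a0) e kE; apply/eqP; ring.
Qed.

(** Otherwise [m] is [a] or 2 a times a square, and [m'] correspondingly 2 b or [b] times a square.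
    Removing the powers of 2 from m - m' = 4 leaves one of the two equations of
    [no_mod8_solution]. *)
Lemma no_odd_logn a b m m' y :
    prime a -> prime b -> a <> b -> (a %% 8 = 3)%N -> (b %% 8 = 3)%N ->
    (0 < m')%N -> m = (m' + 4)%N -> (m * m' = 2 * a * b * y ^ 2)%N ->
  odd (logn a m) -> ~~ odd (logn b m) -> False.
Proof.
move=> pa pb ab a3 b3 m'0 mE e oa eb.
have m0 : (0 < m)%N by rewrite mE addn4.
have [a0 b0] := (prime_gt0 pa, prime_gt0 pb).
have y0 : (0 < y)%N.
  have : (0 < 2 * a * b * y ^ 2)%N by rewrite -e muln_gt0 m0.
  by rewrite muln_gt0 expn_gt0 orbF => /andP[].
have oda : odd a by lia.
have odb : odd b by lia.
(* At all primes other than [a] and 2 the exponent of [m] is even, so a 2^tau m is a square. *)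
pose tau := odd (logn 2 m) : nat.
have [k kE] : exists k, (a * (m * 2 ^ tau) = k ^ 2)%N.
  have [||k] := @square_of_even_logn (a * (m * 2 ^ tau)).
  - by rewrite !muln_gt0 a0 m0 expn_gt0.
  - move=> l pl; rewrite lognM ?muln_gt0 ?m0 ?expn_gt0 // lognM ?expn_gt0 //.
    rewrite lognX (logn_prime l pa) (@logn_prime l 2) // !oddD oddM /tau.
    have [->|l2] := eqVneq l 2.
      by rewrite (_ : 2 == a = false) /= ?andbT; [case: odd|lia].
    rewrite andbF addbF; have [->|la] := eqVneq l a; first by rewrite oa.
    have [->|lb] := eqVneq l b; first by rewrite (negPf eb).
    rewrite /= (negPf (odd_prime_even_logn pl l2 _ _ m'0 mE e)) //.
      by rewrite !muln_gt0 a0 b0.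
    by rewrite !Euclid_dvdM // !dvdn_prime2 // !negb_or l2 la.
  by exists k.
have [t mt] := sqr_mul_dvd pa kE.
have t0 : (0 < t)%N.
  have : (0 < a * t ^ 2)%N by rewrite -mt muln_gt0 m0 expn_gt0.
  by rewrite muln_gt0 expn_gt0 orbF => /andP[].
have n8 := @no_mod8_solution a b.
have ev n : ~~ odd n -> exists n1, n = (2 * n1)%N by exists n./2; lia.
move: mt; rewrite /tau; case: (odd (logn 2 m)) => mt.
- have [t1 mt1] : exists t1, m = (2 * a * t1 ^ 2)%N.
    have : ~~ odd t.
      by have := congr1 odd mt; rewrite !(oddD, oddM, oddX) ?oda ?odb /= ?andbF ?addbF; case: (odd t).
    case/ev=> t1 tE; exists t1; apply/eqP.
    rewrite -(@eqn_pmul2r 2) //; apply/eqP.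
    by rewrite -[LHS]/(m * 2 ^ true)%N mt tE; ring.
  have t10 : (0 < t1)%N by case: t1 mt1 m0 => // ->; rewrite muln0.
  have e1 : (m' * t1 ^ 2 = b * y ^ 2)%N.
    apply/eqP; rewrite -(@eqn_pmul2l (2 * a)) ?muln_gt0 ?a0 //; apply/eqP.
    have := e; rewrite mt1 => e'; apply: etrans (etrans _ e') _; ring.
  have [w w2] : exists w, (b * m' = w ^ 2)%N.
    by apply: (@square_div _ t1 (b * y)) => //; rewrite -mulnA e1; ring.
  have [u m'u] := sqr_mul_dvd pb w2.
  have [u1 uE] : exists u1, u = (2 * u1)%N.
    apply: ev; rewrite mt1 m'u in mE.
    by have := congr1 odd mE; rewrite !(oddD, oddM, oddX) ?oda ?odb /= ?andbF ?addbF; case: (odd u).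
  have e2 : (a * t1 ^ 2 = 2 * b * u1 ^ 2 + 2)%N.
    by move: mE; rewrite mt1 m'u uE expnMn; lia.
  have [t2 tE] : exists t2, t1 = (2 * t2)%N.
    by apply: ev; have := congr1 odd e2; rewrite !(oddD, oddM, oddX) ?oda ?odb /= ?andbF ?addbF; case: (odd t1).
  apply: (proj2 (n8 t2 u1 a3 b3)).
  by move: e2; rewrite tE expnMn; lia.
have mt1 : m = (a * t ^ 2)%N by rewrite -mt muln1.
have e1 : (m' * t ^ 2 = 2 * b * y ^ 2)%N.
  apply/eqP; rewrite -(@eqn_pmul2l a) //; apply/eqP.
  have := e; rewrite mt1 => e'; apply: etrans (etrans _ e') _; ring.
have [w w2] : exists w, (b * (2 * m') = w ^ 2)%N.
  by apply: (@square_div _ t (2 * b * y)) => //; rewrite -!mulnA e1; ring.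
have [u m'u] := sqr_mul_dvd pb w2.
have [u1 uE] : exists u1, u = (2 * u1)%N.
  by apply: ev; have := congr1 odd m'u; rewrite !(oddD, oddM, oddX) ?oda ?odb /= ?andbF ?addbF; case: (odd u).
have m'u1 : m' = (2 * b * u1 ^ 2)%N by move: m'u; rewrite uE expnMn; lia.
have [t1 tE] : exists t1, t = (2 * t1)%N.
  apply: ev; rewrite mt1 m'u1 in mE.
  by have := congr1 odd mE; rewrite !(oddD, oddM, oddX) ?oda ?odb /= ?andbF ?addbF; case: (odd t).
have e2 : (2 * a * t1 ^ 2 = b * u1 ^ 2 + 2)%N.
  by move: mE; rewrite mt1 m'u1 tE expnMn; lia.
have [u2 uE2] : exists u2, u1 = (2 * u2)%N.
  by apply: ev; have := congr1 odd e2; rewrite !(oddD, oddM, oddX) ?oda ?odb /= ?andbF ?addbF; case: (odd u1).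
apply: (proj1 (n8 t1 u2 a3 b3)).
by move: e2; rewrite uE2 expnMn; lia.
Qed.

(** * Units and algebraic integers *)

(** Removing g = gcd(d, z) leaves d' coprime to z' with d' dividing g; then d'^2 divides d' g = d,
    so d' = 1. *)
Lemma squarefree_dvd_sqr d z : squarefree d -> (d %| z ^ 2)%N -> (d %| z)%N.
Proof.
move=> sqf dz.
have [d0|d0] := posnP d.
  by have := sqf 0%N; rewrite d0 dvdn0 => /(_ isT).
have g0 : (0 < gcdn d z)%N by rewrite gcdn_gt0 d0.
have [d' [z' [g [dE zE cop {}g0]]]] : exists d' z' g,
    [/\ d = d' * g, z = z' * g, coprime d' z' & 0 < g]%N.
  have dE : d = (d %/ gcdn d z * gcdn d z)%N by rewrite divnK ?dvdn_gcdl.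
  have zE : z = (z %/ gcdn d z * gcdn d z)%N by rewrite divnK ?dvdn_gcdr.
  exists (d %/ gcdn d z)%N, (z %/ gcdn d z)%N, (gcdn d z); split=> //.
  by rewrite /coprime -(eqn_pmul2r g0) muln_gcdl -dE -zE mul1n.
have : (d' %| g)%N.
  move: dz; rewrite dE zE expnMn (_ : z' ^ 2 * g ^ 2 = (z' ^ 2 * g) * g)%N; last by ring.
  by rewrite dvdn_pmul2r // Gauss_dvdr // coprimeXr.
case/dvdnP=> g' gE; have d'1 : d' = 1%N.
  by apply: sqf; rewrite dE gE; apply/dvdnP; exists g'; ring.
by rewrite dE zE d'1 mul1n dvdn_mull.
Qed.

Lemma squarefree_rat_int d (w : rat) (D : int) :
  squarefree d -> (0 < d)%N -> w ^+ 2 * d%:R = D%:~R -> exists y : int, w = y%:~R.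
Proof.
move=> sqf d0 wD; have [z [wz zD]] : exists z : int, w * d%:R = z%:~R /\ z ^+ 2 = D * d%:Z.
  by apply: rat_sqr_int; rewrite rmorphM /= -wD; ring.
have /squarefree_dvd_sqr : (d %| `|z| ^ 2)%N.
  by rewrite -abszX zD abszM /= dvdn_mull.
move=> /(_ sqf) dz; have {}dz : (d%:Z %| z)%Z by [].
case/dvdzP: dz => y zE.
exists y; apply: (mulIf (_ : d%:R != 0)); first by rewrite pnatr_eq0 -lt0n.
by rewrite wz zE rmorphM.
Qed.

(** Here x / 2 would be a square root of -1 modulo [l]. As (l - 1) / 2 is odd, its [l]-th power
    would be its opposite, against Fermat's little theorem. This is what rules out units of norm
    -1. *)
Lemma prime3mod4_sum_sqr l x :
  prime l -> (l %% 4 = 3)%N -> (l %| x ^ 2 + 4)%N -> False.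
Proof.
move=> pl l3 /dvdnP[k lx].
have x2 : (x%:R : 'F_l) ^+ 2 = - 4.
  apply/eqP; rewrite -subr_eq0 opprK -natrX -natrD lx natrM.
  by rewrite pchar_Fp_0 ?mulr0.
have l2 : (2 : 'F_l) != 0.
  rewrite -(dvdn_pcharf (pchar_Fp pl)) /=; apply/negP => /dvdn_leq; lia.
have y2 : (x%:R / 2 : 'F_l) ^+ 2 = -1 
  by rewrite expr_div_n x2 (_ : 4 = 2 ^+ 2) -?natrX // mulNr divff // natrX expf_neq0.
have y0 : (x%:R / 2 : 'F_l) != 0.
  by apply/eqP=> y0; move: y2; rewrite y0 expr0n => /esym/eqP; rewrite oppr_eq0 oner_eq0.
have [j lE] : exists j, l = (2 * (2 * j + 1) + 1)%N by exists (l %/ 4)%N; lia.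
have : (x%:R / 2 : 'F_l) ^+ (2 * (2 * j + 1) + 1) = x%:R / 2.
  by rewrite -lE -[in RHS](expf_card (x%:R / 2)) card_Fp.
rewrite exprD exprM y2 -[RHS]mul1r expr1 => /(mulIf y0).
rewrite exprD exprM sqrrN !expr1n mul1r expr1 => /eqP.
by rewrite -subr_eq0 -opprD oppr_eq0 -[1 + 1]/2 (negPf l2).
Qed.

Section AlgebraicIntegers.
Variables (L : fieldExtType rat).
Implicit Types (x y : L) (E : {subfield L}).

Lemma alg_integer_rat (c : rat) :
  alg_integer (c%:A : L) -> exists z : int, c = z%:~R.
Proof.
case=> P monP rootP; apply: rat_integral_int; exists P => //.
rewrite -(fmorph_root (in_alg L)) -map_poly_comp.
by rewrite (eq_map_poly (_ : _ =1 intr)) // => z; exact: (rmorph_int (in_alg L)).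
Qed.

Lemma alg_integerM x y : alg_integer x -> alg_integer y -> alg_integer (x * y).
Proof. exact: integral_mul. Qed.

Lemma alg_integerD x y : alg_integer x -> alg_integer y -> alg_integer (x + y).
Proof. exact: integral_add. Qed.

Lemma alg_integer1 : alg_integer (1 : L). Proof. exact: integral1. Qed.

Lemma alg_integer_rmorph (f : {rmorphism L -> L}) x :
  alg_integer x -> alg_integer (f x).
Proof.
move/(integral_rmorph f); case=> P monP rootP; exists P => //.
by rewrite (eq_map_poly (_ : _ =1 f \o intr)) // => z; rewrite /= rmorph_int.
Qed.

Lemma alg_integer_sqrt x : alg_integer (x ^+ 2) -> alg_integer x.
Proof.
case=> P monP rootP; exists (P \Po 'X^2).
  by rewrite monicE lead_coef_comp ?size_polyXn // (monicP monP) lead_coefXn expr1n mulr1.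
by rewrite map_comp_poly map_polyXn /root horner_comp hornerXn.
Qed.

Lemma unit_of_integersM E x y :
  unit_of_integers E x -> unit_of_integers E y -> unit_of_integers E (x * y).
Proof.
move=> [Ex ix [x' [Ex' ix' xx']]] [Ey iy [y' [Ey' iy' yy']]].
split; [exact: rpredM|exact: alg_integerM|exists (x' * y')].
by split; [exact: rpredM|exact: alg_integerM|rewrite mulrACA xx' yy' mulr1].
Qed.

Lemma unit_of_integers_neq0 E x : unit_of_integers E x -> x != 0.
Proof.
move=> [_ _ [v [_ _ xv]]]; apply: contra_eq_neq xv => ->.
by rewrite mul0r eq_sym oner_eq0.
Qed.

Lemma unit_of_integersV E x : unit_of_integers E x -> unit_of_integers E x^-1.
Proof.
move=> ux; have x0 := unit_of_integers_neq0 ux; have [Ex ix [v [Ev iv xv]]] := ux.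
have -> : x^-1 = v by apply: (mulfI x0); rewrite xv divff.
by split=> //; exists x; rewrite mulrC.
Qed.

Lemma unit_of_integers1 E : unit_of_integers E 1.
Proof.
by split; [exact: rpred1|exact: alg_integer1|exists 1; rewrite mulr1 rpred1;
  split=> //; exact: alg_integer1].
Qed.

Lemma unit_of_integersXz E x (n : int) :
  unit_of_integers E x -> unit_of_integers E (x ^ n).
Proof.
move=> ux; have unat (k : nat) : unit_of_integers E (x ^+ k).
  elim: k => [|k IH]; first exact: unit_of_integers1.
  by rewrite exprS; exact: unit_of_integersM.
by case: n => n; [exact: unat|rewrite NegzE -exprnN; exact/unit_of_integersV/unat].
Qed.

Lemma unit_of_integers_sqrt E x :
  x \in E -> unit_of_integers E (x ^+ 2) -> unit_of_integers E x.
Proof.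
move=> Ex [_ ix [v [Ev iv xv]]]; split=> //; first exact: alg_integer_sqrt.
(* The inverse of [x] is x v, integral because its square is [v]. *)
exists (x * v); split; first exact: rpredM.
  apply: alg_integer_sqrt; suff -> : (x * v) ^+ 2 = v by [].
  by rewrite exprMn expr2 (mulrA _ v) xv mul1r.
by rewrite mulrA.
Qed.

Lemma unit_of_integersS (E1 E2 : {vspace L}) x :
  (E1 <= E2)%VS -> unit_of_integers E1 x -> unit_of_integers E2 x.
Proof.
move=> /subvP sE [Ex ix [v [Ev iv xv]]]; split=> //; first exact: sE.
by exists v; split=> //; exact: sE.
Qed.

End AlgebraicIntegers.

(** * Fundamental units of real quadratic fields *)

Lemma intr_numfield_inj (L : fieldExtType rat) : injective (intr : int -> L).
Proof.
move=> m n; rewrite -!(rmorph_int (in_alg L)) => /fmorph_inj.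
exact: (@intr_inj rat).
Qed.

Section RealQuadraticUnit.
Variables (R : realType) (L : fieldExtType rat) (iota : {rmorphism L -> R}).
Variables (d : nat) (r e : L) (h : {rmorphism L -> L}).
Hypotheses (d_gt1 : (1 < d)%N) (d_sqf : squarefree d) (r2 : r ^+ 2 = d%:R).
Hypotheses (hr : h r = - r) (e_fund : fundamental_unit iota <<1; r>> e).

Let rmorph_ratA (c : rat) : h c%:A = c%:A.
Proof. by rewrite alg_num_field fmorph_rat. Qed.

Let A1 : r ^+ 2 \in (1%AS : {subfield L}).
Proof. by rewrite r2 rpred_nat. Qed.

Lemma quadratic_coords x : x \in <<1; r>>%VS ->
  exists a b : rat, x = a%:A + b%:A * r.
Proof.
case/(memv_adjoin_sqrt A1)=> _ [_ [/vlineP[a ->] /vlineP[b ->] ->]].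
by exists a, b.
Qed.

(** For u = a + b r the trace 2 a and the norm are rational and integral, hence integers. Then (2
    b)^2 d = x^2 - 4 N is an integer, and squarefreeness of [d] makes 2 b one. This replaces a
    description of the ring of integers. *)
Lemma quadratic_unit_coords u : unit_of_integers <<1; r>> u ->
  exists x y N : int, [/\ N = 1 \/ N = -1, u * h u = N%:~R, u + h u = x%:~R
    & x ^+ 2 - d%:Z * y ^+ 2 = 4 * N].
Proof.
move=> [Eu iu [v [Ev iv uv]]].
have [a [b uE]] := quadratic_coords Eu; have [a' [b' vE]] := quadratic_coords Ev.
have hu : h u = a%:A - b%:A * r.
  by rewrite uE rmorphD rmorphM /= !rmorph_ratA hr mulrN.
have hv : h v = a'%:A - b'%:A * r.
  by rewrite vE rmorphD rmorphM /= !rmorph_ratA hr mulrN.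
have nrm (c c' : rat) : (c%:A + c'%:A * r) * (c%:A - c'%:A * r) =
    (c ^+ 2 - c' ^+ 2 * d%:R)%:A :> L.
  have -> : (c%:A + c'%:A * r) * (c%:A - c'%:A * r) =
     c%:A ^+ 2 - c'%:A ^+ 2 * r ^+ 2 :> L by ring.
  by rewrite r2 -!in_algE -!rmorphXn -(rmorph_nat (in_alg L)) -rmorphM -rmorphB.
have iN w : alg_integer w -> alg_integer (w * h w).
  by move=> iw; apply: alg_integerM => //; exact: alg_integer_rmorph.
have [N NE] : exists N : int, a ^+ 2 - b ^+ 2 * d%:R = N%:~R.
  by apply: (@alg_integer_rat L); rewrite -nrm -uE -hu; exact: iN.
have [N' NE'] : exists N' : int, a' ^+ 2 - b' ^+ 2 * d%:R = N'%:~R.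
  by apply: (@alg_integer_rat L); rewrite -nrm -vE -hv; exact: iN.
have [x xE] : exists x : int, 2 * a = x%:~R.
  apply: (@alg_integer_rat L); rewrite (_ : (2 * a)%:A = u + h u).
    by apply: alg_integerD => //; exact: alg_integer_rmorph.
  by rewrite hu uE -in_algE rmorphM (rmorph_nat (in_alg L)) /=; ring.
have uN : u * h u = N%:~R by rewrite hu [in LHS]uE nrm NE -in_algE rmorph_int.
have vN : v * h v = N'%:~R by rewrite hv [in LHS]vE nrm NE' -in_algE rmorph_int.
have NN' : N * N' = 1.
  apply: (@intr_numfield_inj L); rewrite rmorphM /= -uN -vN mulrACA uv.
  by rewrite -rmorphM uv rmorph1 mulr1.
have bE : (2 * b) ^+ 2 * d%:R = (x ^+ 2 - 4 * N)%:~R.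
  by rewrite rmorphB rmorphXn rmorphM /= -xE -NE; ring.
have [y yE] := squarefree_rat_int d_sqf (ltnW d_gt1) bE.
exists x, y, N; split=> //.
- have /orP[/eqP->|/eqP->] : (N == 1) || (N == -1); [|by left|by right].
  have : N \is a GRing.unit by apply/unitrPr; exists N'.
  by rewrite qualifE /=.
- rewrite hu [in LHS]uE -(rmorph_int (in_alg L)) -xE rmorphM.
  by rewrite (rmorph_nat (in_alg L)) /=; ring.
apply/eqP; rewrite -(eqr_int rat) rmorphB rmorphXn !rmorphM /= -xE -yE -NE.
by apply/eqP; ring.
Qed.

Lemma quadratic_unit_conj u : unit_of_integers <<1; r>> u ->
  u * h u = 1 \/ u * h u = -1.
Proof. by case/quadratic_unit_coords=> _ [_ [N [[]-> -> _ _]]]; [left|right]. Qed.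

Lemma quadratic_unit_norm1 l u :
    prime l -> (l %% 4 = 3)%N -> (l %| d)%N -> unit_of_integers <<1; r>> u ->
  u * h u = 1.
Proof.
move=> pl l3 ld /quadratic_unit_coords[x [y [N [[]-> -> _ xy]]]] //.
case: (@prime3mod4_sum_sqr l `|x|%N) => //.
have -> : (`|x| ^ 2 + 4 = d * `|y| ^ 2)%N.
  apply/eqP; rewrite -!abszX -eqz_nat PoszD PoszM !gez0_abs ?sqr_ge0 //.
  by rewrite -(subrK (d%:Z * y ^+ 2) (x ^+ 2)) xy; apply/eqP; ring.
exact: dvdn_mulr.
Qed.

Let e_unit : unit_of_integers <<1; r>> e. Proof. by case: e_fund. Qed.

Let Ee : e \in <<1; r>>%VS. Proof. by case: e_unit. Qed.

(** A square root would again be a unit, say e^n up to sign, and e = e^(2n) has no integer solution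
    n. *)
Lemma fundamental_nonsquare z : z \in <<1; r>>%VS -> e <> z ^+ 2.
Proof.
move=> Ez ez; have [_ e1 gen] := e_fund.
have [|n zn] := gen z; first by apply: (@unit_of_integers_sqrt _ <<1; r>>%AS); rewrite // -ez.
have e0 := unit_of_integers_neq0 e_unit.
have : e = e ^ (n * 2).
  by rewrite {1}ez; case: zn => ->; rewrite ?sqrrN exprnP exprz_exp.
move/(congr1 iota); rewrite fmorphXz -{1}[iota e]expr1z => /ieexprIz.
rewrite (lt_trans ltr01 e1) gt_eqF // => /(_ isT isT); lia.
Qed.

Hypothesis e_norm1 : e * h e = 1.

(** With [x] the trace of [e], take m = x + 2 and m' = x - 2. As [e] has norm 1, (1 + e)^2 = e (e +
    h e + 2), so [e] and the integer [m] have the same square class, while m m' = x^2 - 4 = d y^2.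
    Positivity of m' is x > 2, that is (iota e - 1)^2 > 0. *)
Lemma fundamental_unit_trace : exists m m' y : nat,
  [/\ (0 < m')%N, m = (m' + 4)%N, (m * m' = d * y ^ 2)%N & e * m%:R = (1 + e) ^+ 2].
Proof.
have [x [y [N [_ eN ex xy]]]] := quadratic_unit_coords e_unit.
have N1 : N = 1.
  by apply: (@intr_numfield_inj L); rewrite -eN e_norm1.
have [_ e1 _] := e_fund.
have x2 : 2 < x.
  have ie : iota e * iota (h e) = 1 by rewrite -rmorphM e_norm1 rmorph1.
  have : iota e + iota (h e) = x%:~R by rewrite -rmorphD ex rmorph_int.
  rewrite -(ltr_int R) => <-.
  have : 0 < (iota e - 1) ^+ 2 by rewrite exprn_even_gt0 //= subr_eq0 gt_eqF.
  rewrite -subr_gt0 -(pmulr_rgt0 _ (lt_trans ltr01 e1)).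
  rewrite (_ : _ * _ = iota e ^+ 2 + iota e * iota (h e) - 2 * iota e); last by ring.
  by rewrite ie => h0; rewrite (_ : _ - _ = (iota e - 1) ^+ 2) //; ring.
exists (absz (x + 2)), (absz (x - 2)), (absz y).
have xm : (absz (x - 2))%:Z = x - 2 by rewrite gez0_abs //; lia.
have xp : (absz (x + 2))%:Z = x + 2 by rewrite gez0_abs //; lia.
split; first lia; first lia.
  apply/eqP; rewrite -abszX -eqz_nat !PoszM xm xp gez0_abs ?sqr_ge0 //.
  apply/eqP; have -> : (x + 2) * (x - 2) = x ^+ 2 - 4 by ring.
  by rewrite -[x ^+ 2](subrK (d%:Z * y ^+ 2)) xy N1; ring.
rewrite pmulrn xp rmorphD /= -ex.
have -> : e * (e + h e + 2) = e ^+ 2 + e * h e + 2 * e by ring.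
by rewrite e_norm1; ring.
Qed.

(** In Q(sqrt d) the complementary divisors [f] and [f'] have the same square class, since f f' =
    r^2. So it does not matter which of them is the class of [m]. *)
Let trace_square_class f f' m k : (f * f' = d)%N -> (0 < m)%N ->
    e * m%:R = (1 + e) ^+ 2 -> (m * f = k ^ 2)%N \/ (m * f' = k ^ 2)%N ->
  exists2 z, z \in <<1; r>>%VS & e = f%:R * z ^+ 2.
Proof.
move=> ff' m0 em mk.
have natE n : n%:R \in <<1; r>>%AS by exact: rpred_nat.
have nat0 := @natr_numfield_neq0 L.
have [f0 f'0] : (0 < f)%N /\ (0 < f')%N.
  by have := ltnW d_gt1; rewrite -ff' muln_gt0 => /andP[].
have k0 : (0 < k)%N.
  have : (0 < k ^ 2)%N by case: mk => <-; rewrite muln_gt0 m0.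
  by rewrite expn_gt0 orbF.
have Er : r \in <<1; r>>%VS by exact: memv_adjoin.
have E1e : 1 + e \in <<1; r>>%AS by rewrite rpredD ?rpred1.
have eE : e = (1 + e) ^+ 2 / m%:R by rewrite -em mulfK ?nat0.
case: mk => mk.
  exists ((1 + e) / k%:R); first exact: rpred_div E1e (natE k).
  have -> : f%:R * ((1 + e) / k%:R) ^+ 2 = (1 + e) ^+ 2 * f%:R / k%:R ^+ 2.
    by field; rewrite nat0.
  rewrite -natrX -mk natrM [LHS]eE; by field; rewrite !nat0.
exists ((1 + e) * r / (f%:R * k%:R)).
  exact: rpred_div (rpredM E1e Er) (rpredM (natE f) (natE k)).
have -> : f%:R * ((1 + e) * r / (f%:R * k%:R)) ^+ 2 =
          (1 + e) ^+ 2 * r ^+ 2 / (f%:R * k%:R ^+ 2).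
  by field; rewrite !nat0.
rewrite r2 -ff' -natrX -mk !natrM [LHS]eE; by field; rewrite !nat0.
Qed.

Let trace_not_trivial m k : (0 < m)%N -> e * m%:R = (1 + e) ^+ 2 ->
  (m * 1 = k ^ 2)%N \/ (m * d = k ^ 2)%N -> False.
Proof.
move=> m0 em mk; have [z Ez] := trace_square_class (mul1n d) m0 em mk.
by rewrite mul1r; exact: fundamental_nonsquare.
Qed.

(** Only [a] and [b] can have odd exponent in [m], so its class is 1, a, b or ab. The classes 1 and
    ab = d would make [e] a square of Q(sqrt d), and the other two agree there. *)
Lemma fundamental_unit_class_prime a b :
    prime a -> prime b -> a != b -> odd a -> odd b -> d = (a * b)%N -> (d %% 4 = 1)%N ->
  exists2 z, z \in <<1; r>>%VS & e = a%:R * z ^+ 2.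
Proof.
move=> pa pb ab oa ob dE d4; have [m [m' [y [m'0 mE my em]]]] := fundamental_unit_trace.
have m0 : (0 < m)%N by rewrite mE addn4.
have ba : b == a = false by rewrite eq_sym (negPf ab).
have [a0 b0] := (prime_gt0 pa, prime_gt0 pb).
have [a2 b2] : a != 2 /\ b != 2 by split; [apply: contraTneq oa|apply: contraTneq ob] => ->.
pose i : nat := odd (logn a m); pose j : nat := odd (logn b m).
have [k mk] : exists k, (m * (a ^ i * b ^ j) = k ^ 2)%N.
  apply: square_of_even_logn; first by rewrite !muln_gt0 m0 !expn_gt0 a0 b0.
  move=> l pl; rewrite lognM ?muln_gt0 ?expn_gt0 ?a0 ?b0 // lognM ?expn_gt0 ?a0 ?b0 //.
  rewrite !lognX (logn_prime l pa) (logn_prime l pb) !oddD !oddM /i /j.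
  have [->|la] := eqVneq l a; first by rewrite ?eqxx (negPf ab); case: (odd (logn a m)); case: (odd (logn b m)).
  have [->|lb] := eqVneq l b; first by rewrite ?eqxx ?ba; case: (odd (logn a m)); case: (odd (logn b m)).
  have [->|l2] := eqVneq l 2%N.
    by rewrite (negPf (even_logn2 d4 m'0 mE my)); case: (odd (logn a m)); case: (odd (logn b m)).
  rewrite (negPf (odd_prime_even_logn pl l2 (ltnW d_gt1) _ m'0 mE my)).
    by case: (odd (logn a m)); case: (odd (logn b m)).
  by rewrite dE Euclid_dvdM // !dvdn_prime2 // negb_or la.
move: mk; rewrite /i /j; case: (odd (logn a m)); case: (odd (logn b m)) => mk.
- by case: (@trace_not_trivial m k) => //; right; rewrite dE -mk !expn1.
- apply: (@trace_square_class a b m k) => //; left; by rewrite -mk expn1 muln1.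
- apply: (@trace_square_class a b m k) => //; right; by rewrite -mk expn1 mul1n.
- by case: (@trace_not_trivial m k) => //; left; rewrite -mk.
Qed.

(** By [no_odd_logn] the exponents of [m] at [a] and [b] have the same parity, so its class is 1, 2,
    ab or 2ab. The classes 1 and 2ab = d are excluded, and 2 and ab agree in Q(sqrt d). *)
Lemma fundamental_unit_class_two a b :
    prime a -> prime b -> a != b -> (a %% 8 = 3)%N -> (b %% 8 = 3)%N ->
    d = (2 * a * b)%N ->
  exists2 z, z \in <<1; r>>%VS & e = 2 * z ^+ 2.
Proof.
move=> pa pb ab a3 b3 dE; have [m [m' [y [m'0 mE my em]]]] := fundamental_unit_trace.
have m0 : (0 < m)%N by rewrite mE addn4.
have ba : b == a = false by rewrite eq_sym (negPf ab).
have [a0 b0] := (prime_gt0 pa, prime_gt0 pb).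
have [a2 b2] : (2 == a = false) /\ (2 == b = false) by lia.
pose i : nat := odd (logn a m); pose t : nat := odd (logn 2 m).
have ji : odd (logn b m) = odd (logn a m).
  have my' : (m * m' = 2 * a * b * y ^ 2)%N by rewrite my dE.
  have my'' : (m * m' = 2 * b * a * y ^ 2)%N by rewrite my dE; ring.
  case oa : (odd (logn a m)); case ob : (odd (logn b m)) => //.
    by case: (no_odd_logn pa pb _ a3 b3 m'0 mE my'); rewrite ?oa ?ob //; apply/eqP.
  case: (no_odd_logn pb pa _ b3 a3 m'0 mE my''); rewrite ?oa ?ob //.
  by apply/eqP; rewrite eq_sym.
have [k mk] : exists k, (m * (2 ^ t * (a * b) ^ i) = k ^ 2)%N.
  apply: square_of_even_logn; first by rewrite !muln_gt0 m0 !expn_gt0 muln_gt0 a0 b0.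
  move=> l pl; rewrite lognM ?muln_gt0 ?expn_gt0 ?muln_gt0 ?a0 ?b0 //.
  rewrite lognM ?expn_gt0 ?muln_gt0 ?a0 ?b0 // !lognX lognM //.
  rewrite (@logn_prime l 2) // (logn_prime l pa) (logn_prime l pb) !oddD !oddM oddD /i /t.
  have [->|l2] := eqVneq l 2%N.
    by rewrite ?eqxx ?a2 ?b2; case: (odd (logn a m)); case: (odd (logn 2 m)).
  have [->|la] := eqVneq l a; first by rewrite ?eqxx (negPf ab) ?(eq_sym a) ?a2; case: (odd (logn a m)); case: (odd (logn 2 m)).
  have [->|lb] := eqVneq l b; first by rewrite ji ?eqxx ?ba ?(eq_sym b) ?b2; case: (odd (logn a m)); case: (odd (logn 2 m)).
  rewrite (negPf (odd_prime_even_logn pl l2 (ltnW d_gt1) _ m'0 mE my)).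
    by case: (odd (logn a m)); case: (odd (logn 2 m)).
  by rewrite dE !Euclid_dvdM // !dvdn_prime2 // !negb_or l2 la.
have dE' : (2 * (a * b) = d)%N by rewrite dE mulnA.
move: mk; rewrite /i /t; case: (odd (logn 2 m)); case: (odd (logn a m)) => mk.
- by case: (@trace_not_trivial m k) => //; right; rewrite -dE' -mk !expn1.
- by apply: (@trace_square_class 2 (a * b) m k) => //; left; rewrite -mk expn1 muln1.
- by apply: (@trace_square_class 2 (a * b) m k) => //; right; rewrite -mk expn1 mul1n.
- by case: (@trace_not_trivial m k) => //; left; rewrite -mk.
Qed.

End RealQuadraticUnit.

(** * Units of a triquadratic field *)

(** For commuting involutions [f] and [g] generating a group of order 4, this is the relative norm
    to the field they fix. *)
Definition norm4 (K : fieldType) (f g : K -> K) (u : K) : K :=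
  u * f u * g u * f (g u).

(* For tau in the group generated by s1, s2, s3, the element (u tau(u))^2 is
   N(u)^-1 times the product of the norms of u to the three quadratic subfields
   fixed by tau, and N(u) = 1 or -1 for the units u considered. *)
Section ConjugateNorms.
Variables (K : fieldType) (s1 s2 s3 : {rmorphism K -> K}).
Hypothesis s2K : involutive s2.
Hypotheses (s21 : forall x, s2 (s1 x) = s1 (s2 x)) (s31 : forall x, s3 (s1 x) = s1 (s3 x))
  (s32 : forall x, s3 (s2 x) = s2 (s3 x)).
Variable u : K.
Let s12 x := s1 (s2 x).
Let s13 x := s1 (s3 x).
Let s23 x := s2 (s3 x).
Hypothesis norm_u : (norm4 s1 s3 u * s2 (norm4 s1 s3 u)) ^+ 2 = 1.

Let N8 := u * s1 u * s2 u * s3 u * s12 u * s13 u * s23 u * s1 (s23 u).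

Let N8E : N8 ^+ 2 = 1.
Proof.
rewrite -norm_u /norm4 /N8 /s12 /s13 /s23 !rmorphM !(s2K, s21, s31, s32); ring.
Qed.

Lemma norm_line_s2 : (u * s2 u) ^+ 4 = (norm4 s2 s3 u * norm4 s1 s2 u * norm4 s2 s13 u) ^+ 2.
Proof.
rewrite -[LHS]mulr1 -N8E /N8 /norm4 /s12 /s13 /s23 ?(s2K, s21, s31, s32).
by ring.
Qed.

Lemma norm_line_s23 : (u * s23 u) ^+ 4 = (norm4 s2 s3 u * norm4 s1 s23 u * norm4 s12 s23 u) ^+ 2.
Proof.
rewrite -[LHS]mulr1 -N8E /N8 /norm4 /s12 /s13 /s23 ?(s2K, s21, s31, s32).
by ring.
Qed.

Lemma norm_line_s1 : (u * s1 u) ^+ 4 = (norm4 s1 s3 u * norm4 s1 s2 u * norm4 s1 s23 u) ^+ 2.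
Proof.
rewrite -[LHS]mulr1 -N8E /N8 /norm4 /s12 /s13 /s23 ?(s2K, s21, s31, s32).
by ring.
Qed.

Lemma norm_line_s3 : (u * s3 u) ^+ 4 = (norm4 s2 s3 u * norm4 s1 s3 u * norm4 s3 s12 u) ^+ 2.
Proof.
rewrite -[LHS]mulr1 -N8E /N8 /norm4 /s12 /s13 /s23 ?(s2K, s21, s31, s32).
by ring.
Qed.

Lemma norm_line_s13 : (u * s13 u) ^+ 4 = (norm4 s1 s3 u * norm4 s2 s13 u * norm4 s12 s23 u) ^+ 2.
Proof.
rewrite -[LHS]mulr1 -N8E /N8 /norm4 /s12 /s13 /s23 ?(s2K, s21, s31, s32).
by ring.
Qed.

(** Of the seven subgroups of order 4 all contain the identity and three contain any given other
    element. The product of the seven norms is thus u^4 N(u)^3, and N(u)^2 = 1. *)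
Lemma norm_quadratic_subfields : u ^+ 8 =
  (norm4 s2 s3 u * norm4 s1 s3 u * norm4 s1 s2 u * norm4 s1 s23 u *
   norm4 s3 s12 u * norm4 s2 s13 u * norm4 s12 s23 u) ^+ 2.
Proof.
rewrite -[LHS]mulr1 -(expr1n _ 3) -N8E /N8 /norm4 /s12 /s13 /s23.
by rewrite !(s2K, s21, s31, s32); ring.
Qed.

End ConjugateNorms.

Lemma int_parity (n : int) : exists k : int, n = k * 2 \/ n = k * 2 + 1.
Proof.
exists (n %/ 2)%Z; have := divz_eq n 2.
have : (0 <= n %% 2 < 2)%Z by rewrite modz_ge0 // ltz_pmod.
by lia.
Qed.

(** * Generators of the unit group *)

Section UnitGroup.
Variables (R : realType) (K : fieldExtType rat) (iota : {rmorphism K -> R}).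
(* s1, s2, s3 change the sign of sqrt 2, sqrt (pq), sqrt (ps) respectively. *)
Variables (s1 s2 s3 : {rmorphism K -> K}).
Hypotheses (s1K : involutive s1) (s2K : involutive s2) (s3K : involutive s3).
Hypotheses (s21 : forall x, s2 (s1 x) = s1 (s2 x)) (s31 : forall x, s3 (s1 x) = s1 (s3 x))
  (s32 : forall x, s3 (s2 x) = s2 (s3 x)).
Variables e2 epq eps eqs e2pq e2ps e2qs : K.
Hypotheses (e2_gt1 : 1 < iota e2) (epq_gt1 : 1 < iota epq) (eps_gt1 : 1 < iota eps)
  (eqs_gt1 : 1 < iota eqs) (e2pq_gt1 : 1 < iota e2pq) (e2ps_gt1 : 1 < iota e2ps)
  (e2qs_gt1 : 1 < iota e2qs).
Let unitK := @unit_of_integers K fullv.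
Hypotheses (e2_unit : unitK e2) (epq_unit : unitK epq) (eps_unit : unitK eps)
  (eqs_unit : unitK eqs) (e2pq_unit : unitK e2pq) (e2ps_unit : unitK e2ps)
  (e2qs_unit : unitK e2qs).
Hypotheses (s1e2 : s1 e2 = - e2^-1) (s2e2 : s2 e2 = e2) (s3e2 : s3 e2 = e2).
Hypotheses (s1epq : s1 epq = epq) (s2epq : s2 epq = epq^-1) (s3epq : s3 epq = epq).
Hypotheses (s1eps : s1 eps = eps) (s2eps : s2 eps = eps) (s3eps : s3 eps = eps^-1).
Hypotheses (s1eqs : s1 eqs = eqs) (s2eqs : s2 eqs = eqs^-1) (s3eqs : s3 eqs = eqs^-1).
Hypotheses (s1e2pq : s1 e2pq = e2pq^-1) (s2e2pq : s2 e2pq = e2pq^-1)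
  (s3e2pq : s3 e2pq = e2pq).
Hypotheses (s1e2ps : s1 e2ps = e2ps^-1) (s2e2ps : s2 e2ps = e2ps)
  (s3e2ps : s3 e2ps = e2ps^-1).
Hypotheses (s1e2qs : s1 e2qs = e2qs^-1) (s2e2qs : s2 e2qs = e2qs^-1)
  (s3e2qs : s3 e2qs = e2qs^-1).

Let s12 x := s1 (s2 x).
Let s13 x := s1 (s3 x).
Let s23 x := s2 (s3 x).
Let N2 := norm4 s2 s3.
Let Npq := norm4 s1 s3.
Let Nps := norm4 s1 s2.
Let Nqs := norm4 s1 s23.
Let N2pq := norm4 s3 s12.
Let N2ps := norm4 s2 s13.
Let N2qs := norm4 s12 s23.

(** Squaring both sides absorbs the sign in the representation of a unit by a power of the
    fundamental unit. *)
Let power_up_to_sign (N : K -> K) e := forall u, unitK u -> exists n : int, N u ^+ 2 = (e ^ n) ^+ 2.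
Hypotheses (N2P : power_up_to_sign N2 e2) (NpqP : power_up_to_sign Npq epq)
  (NpsP : power_up_to_sign Nps eps) (NqsP : power_up_to_sign Nqs eqs)
  (N2pqP : power_up_to_sign N2pq e2pq) (N2psP : power_up_to_sign N2ps e2ps)
  (N2qsP : power_up_to_sign N2qs e2qs).

Hypotheses (epq_nsq : forall z, epq <> z ^+ 2) (eps_nsq : forall z, eps <> z ^+ 2)
  (eqs_nsq : forall z, eqs <> z ^+ 2).
Variables (r1 r2 r3 tpq tps xi : K) (nu : bool).
Hypotheses (r1E : r1 ^+ 2 = epq * eps) (r2E : r2 ^+ 2 = epq * eqs) (r3E : r3 ^+ 2 = e2qs).
Hypotheses (tpqE : tpq ^+ 2 = epq * e2pq) (tpsE : tps ^+ 2 = eps * e2ps).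
Hypothesis (xiE : xi ^+ 2 = epq ^+ nu * (tpq * tps)).
Hypothesis s13r3 : s1 (s3 r3) = - r3.

Let gt1_neq0 e : 1 < iota e -> e != 0.
Proof. by move=> e1; rewrite -(fmorph_eq0 iota) gt_eqF // (lt_trans ltr01). Qed.

Let e2_0 := gt1_neq0 e2_gt1.
Let epq_0 := gt1_neq0 epq_gt1.
Let eps_0 := gt1_neq0 eps_gt1.
Let eqs_0 := gt1_neq0 eqs_gt1.
Let e2pq_0 := gt1_neq0 e2pq_gt1.
Let e2ps_0 := gt1_neq0 e2ps_gt1.
Let e2qs_0 := gt1_neq0 e2qs_gt1.

Let pos (e : K) (n : int) : 1 < iota e -> 0 < iota (e ^ n).
Proof. by move=> e1; rewrite fmorphXz exprz_gt0 // (lt_trans ltr01). Qed.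

Let sqr_pos_inj (x y : K) : 0 < iota x -> 0 < iota y -> x ^+ 2 = y ^+ 2 -> x = y.
Proof.
move=> x0 y0 /eqP; rewrite eqf_sqr => /orP[/eqP//|/eqP xy].
by move: x0; rewrite xy rmorphN oppr_gt0 ltNge (ltW y0).
Qed.

Let iota_sqr_gt0 (x : K) : x != 0 -> 0 < iota (x ^+ 2).
Proof. by move=> x0; rewrite rmorphXn exprn_even_gt0 //= fmorph_eq0. Qed.

Let powK (e : K) (k : int) : e ^ (k * 2) = (e ^ k) ^+ 2.
Proof. by rewrite -exprz_exp. Qed.

Let sqr_expz (e : K) (n : int) : (e ^ n) ^+ 2 = (e ^+ 2) ^ n.
Proof. by rewrite !exprnP exprzAC. Qed.

Let nonsquare_even (e : K) (n : int) (x : K) :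
  (forall z, e <> z ^+ 2) -> e != 0 -> e ^ n = x ^+ 2 -> exists k, n = k * 2.
Proof.
move=> nsq e0 ex; have [k [nk|nk]] := int_parity n; first by exists k.
case: (nsq (x / e ^ k)); rewrite expr_div_n -ex nk expfzDr // powK expr1z.
by field; rewrite expfz_neq0.
Qed.

(** The embedding [iota] composed with [s1] makes [e] negative but keeps [x] and all nonzero squares
    positive. This is how the norm -1 of [e2] is used. *)
Let negative_even (e : K) (n : int) (x y : K) :
  iota (s1 e) < 0 -> 0 < iota (s1 x) -> y != 0 -> e ^ n * x = y ^+ 2 -> exists k, n = k * 2.
Proof.
move=> e0 x0 y0 ex; have [k [nk|nk]] := int_parity n; first by exists k.
have se0 : s1 e != 0 by rewrite -(fmorph_eq0 iota) lt_eqF.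
have : 0 < iota (s1 (y ^+ 2)) by rewrite rmorphXn iota_sqr_gt0 // fmorph_eq0.
rewrite -ex nk rmorphM fmorphXz expfzDr // powK expr1z rmorphM pmulr_lgt0 //.
rewrite rmorphM pmulr_rgt0 ?iota_sqr_gt0 ?expfz_neq0 //.
by rewrite ltNge (ltW e0).
Qed.

Let iota_s1e2 : iota (s1 e2) < 0.
Proof. by rewrite s1e2 rmorphN fmorphV oppr_lt0 invr_gt0 (lt_trans ltr01). Qed.

Let norm_sqr u : unitK u -> (Npq u * s2 (Npq u)) ^+ 2 = 1.
Proof.
move=> /NpqP[n nE]; rewrite exprMn -rmorphXn nE rmorphXn fmorphXz s2epq -exprMn.
by rewrite -expfzMl divff // exp1rz expr1n.
Qed.

Let pos_gt0 (x y : K) : 0 < iota x -> 0 < iota y -> 0 < iota (x * y).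
Proof. by move=> x0 y0; rewrite rmorphM mulr_gt0. Qed.

Let root4 (x y : K) : x != 0 -> 0 < iota y -> x ^+ 4 = y ^+ 2 -> x ^+ 2 = y.
Proof.
by move=> x0 y0 e; apply: sqr_pos_inj; rewrite ?iota_sqr_gt0 // -exprM.
Qed.

(** Both sides of the squared norm relation are squares of positive numbers, so one square root can
    be extracted without a sign. *)
Let lineE (N N' N'' : K -> K) (e e' e'' : K) (n n' n'' : int) (t u : K) :
    1 < iota e -> 1 < iota e' -> 1 < iota e'' -> u != 0 -> t != 0 ->
    N u ^+ 2 = (e ^ n) ^+ 2 -> N' u ^+ 2 = (e' ^ n') ^+ 2 ->
    N'' u ^+ 2 = (e'' ^ n'') ^+ 2 ->
    (u * t) ^+ 4 = (N u * N' u * N'' u) ^+ 2 ->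
  e ^ n * (e' ^ n' * e'' ^ n'') = (u * t) ^+ 2.
Proof.
move=> e1 e'1 e''1 u0 t0 nE n'E n''E h; symmetry; apply: root4.
- by rewrite mulf_neq0.
- by rewrite !pos_gt0 ?pos.
by rewrite h !exprMn nE n'E n''E; ring.
Qed.

Let even_exponents u : unitK u -> N2ps u ^+ 2 = 1 ->
  exists a b c f g h : int,
    u ^+ 4 = (e2 ^ a * epq ^ f * eps ^ b * eqs ^ c * e2pq ^ g * e2qs ^ h) ^+ 2.
Proof.
move=> uu N2ps1; have u0 := unit_of_integers_neq0 uu.
have [n2 n2E] := N2P uu; have [npq npqE] := NpqP uu; have [nps npsE] := NpsP uu.
have [nqs nqsE] := NqsP uu; have [n2pq n2pqE] := N2pqP uu; have [n2qs n2qsE] := N2qsP uu.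
have n2psE : N2ps u ^+ 2 = (e2ps ^ 0) ^+ 2 by rewrite N2ps1 expr0z expr1n.
have N1 := norm_sqr uu.
have s_neq0 (f : {rmorphism K -> K}) x : x != 0 -> f x != 0 by rewrite fmorph_eq0.
have l2 := lineE e2_gt1 eps_gt1 e2ps_gt1 u0 (s_neq0 s2 u u0) n2E npsE n2psE
  (norm_line_s2 s21 N1).
have l23 := lineE e2_gt1 eqs_gt1 e2qs_gt1 u0 (s_neq0 _ _ (s_neq0 _ u u0)) n2E nqsE n2qsE
  (norm_line_s23 s2K s21 N1).
have l1 := lineE epq_gt1 eps_gt1 eqs_gt1 u0 (s_neq0 s1 u u0) npqE npsE nqsE
  (norm_line_s1 s21 N1).
have l3 := lineE e2_gt1 epq_gt1 e2pq_gt1 u0 (s_neq0 s3 u u0) n2E npqE n2pqE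
  (norm_line_s3 s21 s31 s32 N1).
have l13 := lineE epq_gt1 e2ps_gt1 e2qs_gt1 u0 (s_neq0 _ _ (s_neq0 _ u u0)) npqE n2psE n2qsE
  (norm_line_s13 s2K s21 N1).
rewrite expr0z mulr1 in l2; rewrite expr0z mul1r in l13.
(* Only [e2] has a negative conjugate under [s1], so its exponent can be settled first. Each
   relation used afterwards contains just one exponent whose parity is open, [e2qs] = r3^2 being
   harmless in [l23]. *)
have [a n2a] : exists a, n2 = a * 2.
  apply: (negative_even iota_s1e2 _ _ l2); last by rewrite mulf_neq0 ?s_neq0.
  by rewrite fmorphXz s1eps pos.
have [b npsb] : exists b, nps = b * 2.
  apply: (nonsquare_even eps_nsq eps_0 (x := u * s2 u / e2 ^ a)).
  by rewrite expr_div_n -l2 n2a powK; field; rewrite expfz_neq0.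
have [c nqsc] : exists c, nqs = c * 2.
  apply: (nonsquare_even eqs_nsq eqs_0 (x := u * s2 (s3 u) / (e2 ^ a * r3 ^ n2qs))).
  rewrite expr_div_n -l23 n2a powK exprMn (sqr_expz r3) r3E.
  by field; rewrite !expfz_neq0.
have [f npqf] : exists f, npq = f * 2.
  apply: (nonsquare_even epq_nsq epq_0 (x := u * s1 u / (eps ^ b * eqs ^ c))).
  rewrite expr_div_n -l1 npsb nqsc !powK exprMn.
  by field; rewrite !expfz_neq0.
have [g n2pqg] : exists g, n2pq = g * 2.
  apply: (nonsquare_even _ e2pq_0 (x := u * s3 u / (e2 ^ a * epq ^ f))) => [z zE|].
    apply: (epq_nsq (z := tpq / z)).
    by rewrite expr_div_n tpqE -zE mulfK.
  rewrite expr_div_n -l3 n2a npqf !powK exprMn.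
  by field; rewrite !expfz_neq0.
have [h n2qsh] : exists h, n2qs = h * 2.
  have [h [nh|nh]] := int_parity n2qs; first by exists h.
  (* If the exponent were odd, [r3] would be [y] up to sign. But [y] is fixed by [s1] composed with
     [s3], which changes the sign of [r3]. *)
  pose y := u * s1 (s3 u) / (epq ^ f * e2qs ^ h).
  have y2 : r3 ^+ 2 = y ^+ 2.
    rewrite r3E expr_div_n -l13 npqf nh expfzDr // !powK expr1z exprMn.
    by field; rewrite !expfz_neq0.
  have sy : s1 (s3 y) = y.
    rewrite /y !(rmorphM, fmorphV) /= !fmorphXz s3epq s1epq s3e2qs fmorphV s1e2qs invrK.
    by rewrite !(s1K, s3K, s31) [s1 (s3 u) * u]mulrC.
  have : r3 = 0.
    have two0 : 2 != 0 :> K := char0_2 K.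
    apply: (mulfI two0); rewrite mulr0 mulrDl mul1r; apply/eqP; rewrite addr_eq0 -s13r3.
    by move/eqP: y2; rewrite eqf_sqr => /orP[]/eqP ->; rewrite ?rmorphN sy.
  by move=> r30; move: e2qs_0; rewrite -r3E r30 expr0n eqxx.
exists a, b, c, f, g, h.
have N8 : u ^+ 8 = (N2 u * Npq u * Nps u * Nqs u * N2pq u * N2ps u * N2qs u) ^+ 2 :=
  norm_quadratic_subfields s2K s21 s31 s32 N1.
apply: sqr_pos_inj.
- by rewrite -[4%N]/(2 * 2)%N exprM iota_sqr_gt0 // expf_neq0.
- by rewrite iota_sqr_gt0 // !mulf_neq0 ?expfz_neq0.
rewrite -exprM N8; set RHS := (X in _ = X).
have -> : forall A B C D E F G : K, (A * B * C * D * E * F * G) ^+ 2 =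
    A ^+ 2 * B ^+ 2 * C ^+ 2 * D ^+ 2 * E ^+ 2 * F ^+ 2 * G ^+ 2 by move=> *; ring.
rewrite n2E npqE npsE nqsE n2pqE n2psE n2qsE /RHS.
by rewrite n2a npqf npsb nqsc n2pqg n2qsh !powK expr0z; ring.
Qed.

Let unit_sqrt x : unitK (x ^+ 2) -> unitK x.
Proof. by apply: (@unit_of_integers_sqrt K fullv x); rewrite memvf. Qed.

Let unitM x y : unitK x -> unitK y -> unitK (x * y).
Proof. exact: (@unit_of_integersM K fullv). Qed.

Let unitXz x (n : int) : unitK x -> unitK (x ^ n).
Proof. exact: (@unit_of_integersXz K fullv). Qed.

Let r1_unit : unitK r1. Proof. by apply: unit_sqrt; rewrite r1E; exact: unitM. Qed.
Let r2_unit : unitK r2. Proof. by apply: unit_sqrt; rewrite r2E; exact: unitM. Qed.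
Let r3_unit : unitK r3. Proof. by apply: unit_sqrt; rewrite r3E. Qed.
Let tpq_unit : unitK tpq. Proof. by apply: unit_sqrt; rewrite tpqE; exact: unitM. Qed.
Let tps_unit : unitK tps. Proof. by apply: unit_sqrt; rewrite tpsE; exact: unitM. Qed.

Let xi_unit : unitK xi.
Proof.
apply: unit_sqrt; rewrite xiE; apply: unitM; last exact: unitM.
by rewrite exprnP; exact: unitXz.
Qed.

Let pow4E (x y : K) : x ^+ 2 = y -> x ^+ 4 = y ^+ 2.
Proof. by move=> <-; rewrite -exprM. Qed.

Let r1_4 := pow4E r1E.
Let r2_4 := pow4E r2E.
Let r3_4 := pow4E r3E.
Let tpq_4 := pow4E tpqE.

Let xi_4 : xi ^+ 4 = epq ^+ nu ^+ 2 * (epq * e2pq) * (eps * e2ps).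
Proof. by rewrite (pow4E xiE) -tpqE -tpsE; ring. Qed.

Let conjE := (s1e2, s2e2, s3e2, s1epq, s2epq, s3epq, s1eps, s2eps, s3eps, s1eqs,
  s2eqs, s3eqs, s1e2pq, s2e2pq, s3e2pq, s1e2ps, s2e2ps, s3e2ps, s1e2qs, s2e2qs, s3e2qs).

Let neq0 := (e2_0, epq_0, eps_0, eqs_0, e2pq_0, e2ps_0, e2qs_0).

(** Two generators are distinguished by a norm that is 1 on one and not on the other. It is applied
    to fourth powers because these are monomials in the fundamental units, whose conjugates are
    known, and because the norm -1 of [e2] then does no harm. *)
Let notin_of_norm (N : K -> K) (y e : K) (n : nat) (xs : seq K) :
    1 < iota e -> (0 < n)%N -> N (y ^+ 4) = e ^+ n ->
  {in xs, forall x, N (x ^+ 4) = 1} -> y \notin xs.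
Proof.
move=> e1 n0 Ny Nxs; apply/negP=> /Nxs; rewrite Ny => /(congr1 iota)/eqP.
by rewrite rmorphXn rmorph1 gt_eqF // exprn_egt1 // -lt0n.
Qed.

Local Ltac compute_norm :=
  rewrite ?(r1_4, r2_4, r3_4, tpq_4) /N2ps /N2pq /N2qs /Nqs /Nps /Npq /norm4 /s12 /s13 /s23
    ?(rmorphM, rmorphXn, fmorphV, rmorphN, conjE, invrK) /=; field; rewrite ?neq0.

Let N2ps_xi : N2ps (xi ^+ 4) = e2ps ^+ 4.
Proof. by rewrite xi_4; case: (nu); compute_norm. Qed.

Let N2pq_tpq : N2pq (tpq ^+ 4) = e2pq ^+ 8. Proof. by compute_norm. Qed.
Let N2qs_r3 : N2qs (r3 ^+ 4) = e2qs ^+ 8. Proof. by compute_norm. Qed.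
Let Nqs_r2 : Nqs (r2 ^+ 4) = eqs ^+ 8. Proof. by compute_norm. Qed.
Let Nps_r1 : Nps (r1 ^+ 4) = eps ^+ 8. Proof. by compute_norm. Qed.
Let Npq_epq : Npq (epq ^+ 4) = epq ^+ 16. Proof. by compute_norm. Qed.

Let generators_uniq : uniq [:: e2; epq; r1; r2; r3; tpq; xi].
Proof.
(* Generators are split off from the last one: each has a nontrivial norm to a quadratic subfield
   where all earlier ones have trivial norm. *)
rewrite -[X in uniq X]/(rcons (rcons (rcons (rcons (rcons (rcons [:: e2] epq) r1) r2) r3) tpq) xi).
rewrite !rcons_uniq /= andbT; apply/and5P; split.
- apply: (notin_of_norm (N := N2ps) _ _ N2ps_xi) => // x; rewrite !inE.
  by move=> /or4P[/eqP->|/eqP->|/eqP->|/or3P[]/eqP->]; compute_norm.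
- apply: (notin_of_norm (N := N2pq) _ _ N2pq_tpq) => // x; rewrite !inE.
  by move=> /or4P[/eqP->|/eqP->|/eqP->|/orP[]/eqP->]; compute_norm.
- apply: (notin_of_norm (N := N2qs) _ _ N2qs_r3) => // x; rewrite !inE.
  by move=> /or4P[]/eqP->; compute_norm.
- apply: (notin_of_norm (N := Nqs) _ _ Nqs_r2) => // x; rewrite !inE.
  by move=> /or3P[]/eqP->; compute_norm.
apply/andP; split.
- apply: (notin_of_norm (N := Nps) _ _ Nps_r1) => // x; rewrite !inE.
  by move=> /orP[]/eqP->; compute_norm.
- apply: (notin_of_norm (N := Npq) _ _ Npq_epq) => // x; rewrite !inE.
  by move=> /eqP->; compute_norm.
Qed.

Let N2psM (x y : K) : N2ps (x * y) = N2ps x * N2ps y.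
Proof. by rewrite /N2ps /norm4 /s13 !rmorphM; ring. Qed.

Let N2psXz (x : K) (n : int) : N2ps (x ^ n) = N2ps x ^ n.
Proof. by rewrite /N2ps /norm4 /s13 !fmorphXz !expfzMl. Qed.

Let N2ps_xi2 : N2ps xi ^+ 2 = e2ps ^+ 2.
Proof.
have xi0 := unit_of_integers_neq0 xi_unit.
apply: sqr_pos_inj; rewrite ?iota_sqr_gt0 //.
  by rewrite /N2ps /norm4 /s13 !mulf_neq0 ?fmorph_eq0.
by rewrite -!exprM -N2ps_xi -[xi ^+ 4]/(xi ^ 4) N2psXz.
Qed.

(* A unit with even exponents is, up to the generators, a square root of
   e2^a epq^m; conjugation by s1 and the nonsquareness of epq make a and m even. *)
Let generators_span u : unitK u -> exists (b : bool) (k : 'I_7 -> int),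
  u = (-1) ^+ b * \prod_(i < 7) tnth [tuple e2; epq; r1; r2; r3; tpq; xi] i ^ k i.
Proof.
move=> uu; have u0 := unit_of_integers_neq0 uu.
have [r10 r20 r30] : [/\ r1 != 0, r2 != 0 & r3 != 0].
  by split; apply: unit_of_integers_neq0; [exact: r1_unit|exact: r2_unit|exact: r3_unit].
have [tpq0 xi0] : tpq != 0 /\ xi != 0.
  by split; apply: unit_of_integers_neq0; [exact: tpq_unit|exact: xi_unit].
have [t tE] := N2psP uu.
have [||a [b [c [f [g [h uE]]]]]] := even_exponents (u := u * xi ^ (- t)).
- by apply: unitM => //; exact: unitXz.
- rewrite N2psM N2psXz exprMn tE (sqr_expz (N2ps xi)) N2ps_xi2 -sqr_expz -exprMn.
  by rewrite -expfzDr // subrr expr0z expr1n.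
pose w := r1 ^ b * r2 ^ c * tpq ^ g * r3 ^ h.
have w0 : w != 0 by rewrite !mulf_neq0 ?expfz_neq0.
(* The powers of [r1], [r2] and [tpq] in [w] also bring in [epq], with total exponent b + c + g. *)
pose m := f - b - c - g.
pose v := u * xi ^ (- t) / w.
have v0 : v != 0 by rewrite !mulf_neq0 ?invr_neq0 ?expfz_neq0.
have v2 : v ^+ 2 = e2 ^ a * epq ^ m.
  apply: sqr_pos_inj; first exact: iota_sqr_gt0.
    by rewrite pos_gt0 ?pos.
  rewrite -exprM expr_div_n uE /w.
  have q (x y : K) (n : int) : x ^+ 2 = y -> (x ^ n) ^+ 4 = (y ^ n) ^+ 2.
    by move=> <-; rewrite -sqr_expz -exprM.
  rewrite !(exprMn 4) (q _ _ _ r1E) (q _ _ _ r2E) (q _ _ _ tpqE) (q _ _ _ r3E).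
  rewrite /m !expfzDr // !expfzMl -!invr_expz.
  by field; rewrite ?expfz_neq0 ?neq0.
have [a' aE] : exists a', a = a' * 2.
  by apply: (negative_even iota_s1e2 _ v0 (esym v2)); rewrite fmorphXz s1epq pos.
have [m' mE] : exists m', m = m' * 2.
  apply: (nonsquare_even epq_nsq epq_0 (x := v / e2 ^ a')).
  by rewrite expr_div_n v2 aE powK; field; rewrite expfz_neq0.
have : v ^+ 2 = (e2 ^ a' * epq ^ m') ^+ 2 by rewrite v2 aE mE !powK exprMn.
have uv : u = v * w * xi ^ t.
  by rewrite /v divfK // -mulrA -expfzDr // addNr expr0z mulr1.
pose k (i : 'I_7) := nth 0 [:: a'; m'; b; c; h; g; t] i.
have kE : \prod_(i < 7) tnth [tuple e2; epq; r1; r2; r3; tpq; xi] i ^ k i =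
    e2 ^ a' * epq ^ m' * w * xi ^ t.
  by rewrite !big_ord_recl big_ord0 !(tnth_nth 0) /k /w /=; ring.
move/eqP; rewrite eqf_sqr => /orP[]/eqP vE; [exists false, k|exists true, k].
  by rewrite kE mul1r {1}uv vE.
by rewrite kE {1}uv vE; ring.
Qed.

Theorem triquadratic_fundamental_system :
  fundamental_system [tuple e2; epq; r1; r2; r3; tpq; xi].
Proof.
split=> [|u|u uu]; [exact: generators_uniq| |exact: generators_span].
rewrite !inE => /or4P[/eqP->|/eqP->|/eqP->|/or4P[]/eqP->] //.
Qed.

End UnitGroup.

(** * Sign changes of square roots *)

Lemma squarefree_prod_primes (ls : seq nat) :
  all prime ls -> uniq ls -> squarefree (\prod_(l <- ls) l).
Proof.
move=> prs uls k kd; apply/eqP; apply: contraT => k1.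
have P0 : (0 < \prod_(l <- ls) l)%N.
  by rewrite big_seq prodn_cond_gt0 // => l /(allP prs); exact: prime_gt0.
have k0 : (0 < k)%N.
  by case: k kd {k1} => //; rewrite dvd0n; case: (\prod_(l <- ls) l)%N P0.
have k2 : (1 < k)%N by rewrite ltn_neqAle eq_sym k1.
have pl := pdiv_prime k2; set l := pdiv k in pl.
have lk : (0 < logn l k)%N by rewrite logn_gt0 mem_primes pl k0 pdiv_dvd.
have : (logn l (k ^ 2) <= logn l (\prod_(l <- ls) l))%N by rewrite dvdn_leq_log.
have -> : logn l (\prod_(l <- ls) l) = count_mem l ls.
  elim: ls prs {uls kd P0} => [|x ls IH] /=; first by rewrite big_nil logn1.
  case/andP=> px prs; rewrite big_cons lognM ?(prime_gt0 px) //.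
    by rewrite IH // logn_prime // (eq_sym l).
  by rewrite big_seq prodn_cond_gt0 // => y /(allP prs); exact: prime_gt0.
rewrite count_uniq_mem // lognX; by case: (l \in ls); lia.
Qed.

(** The norm N is fixed by [f] and [g], so its trace over their group is 4 N. Since traces lie in
    the quadratic field, so does N, and it is a unit there. *)
Lemma norm4_fundamental_power (R : realType) (K : fieldExtType rat)
    (iota : {rmorphism K -> R}) (f g : {rmorphism K -> K}) (r e : K) :
    involutive f -> involutive g -> (forall x, f (g x) = g (f x)) ->
    (forall x, x + f x + g x + f (g x) \in <<1; r>>%VS) ->
    fundamental_unit iota <<1; r>> e ->
  forall u, unit_of_integers fullv u -> exists n : int, norm4 f g u ^+ 2 = (e ^ n) ^+ 2.
Proof.
move=> fK gK fgC trE [_ _ gen] u uu.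
have N_fix x : f (norm4 f g x) = norm4 f g x /\ g (norm4 f g x) = norm4 f g x.
  split; rewrite /norm4 !rmorphM.
    by rewrite !fK; ring.
  by rewrite -!fgC !gK; ring.
have N_mem x : norm4 f g x \in <<1; r>>%VS.
  have [fN gN] := N_fix x; have := trE (norm4 f g x); rewrite gN fN.
  have -> : norm4 f g x + norm4 f g x + norm4 f g x + norm4 f g x = 4 *: norm4 f g x.
    by rewrite (scaler_nat 4); ring.
  by move=> h; rewrite -[norm4 f g x]scale1r -(mulVf (_ : 4 != 0 :> rat)) // -scalerA memvZ.
have iN x : alg_integer x -> alg_integer (norm4 f g x).
  by move=> ix; do ![apply: alg_integerM|apply: alg_integer_rmorph].
have [_ iu [v [_ iv uv]]] := uu.
have [|n nE] := gen (norm4 f g u).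
  split; [exact: N_mem|exact: iN|exists (norm4 f g v); split; [exact: N_mem|exact: iN|]].
  have -> : norm4 f g u * norm4 f g v = norm4 f g (u * v).
    by rewrite /norm4 !rmorphM; ring.
  by rewrite uv /norm4 !rmorph1 !mulr1.
by exists n; case: nE => ->; rewrite ?sqrrN.
Qed.

(** The factor [c] accommodates sqrt(pq) sqrt(ps) = p sqrt(qs), where the product of generators is
    not itself the normalized square root. *)
Lemma trace_mem_adjoin (K : fieldExtType rat) (f g : K -> K) (r : K) :
    (forall x, exists a b : rat, x + f x + g x + f (g x) = a%:A + b%:A * r) ->
  forall (c : rat) r', r = c%:A * r' -> forall x, x + f x + g x + f (g x) \in <<1; r'>>%VS.
Proof.
move=> tr c r' rE x; have [a [b ->]] := tr x.
have ratE y : y%:A \in <<1; r'>>%VS by apply: subvP (subv_adjoin _ _) _ _; rewrite memvZ ?mem1v.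
by rewrite rE mulrA rpredD ?rpredM ?ratE ?memv_adjoin.
Qed.

(** * Coordinates, sign changes and partial traces of a triquadratic field *)

Section TriquadraticField.
Variables (K : fieldExtType rat) (d1 d2 d3 : K) (n1 n2 n3 : nat).
Hypotheses (d1E : d1 ^+ 2 = n1%:R) (d2E : d2 ^+ 2 = n2%:R) (d3E : d3 ^+ 2 = n3%:R).
Hypothesis K_gen : <<1 & [:: d1; d2; d3]>>%VS = fullv.

(** The binary digits of the index tell which of [d1], [d2], [d3] occur in the monomial. *)
Lemma triquadratic_coords (x : K) : exists a : nat -> rat,
  x = (a 0)%:A + (a 1)%:A * d1 + ((a 2)%:A + (a 3)%:A * d1) * d2 +
      ((a 4)%:A + (a 5)%:A * d1 + ((a 6)%:A + (a 7)%:A * d1) * d2) * d3.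
Proof.
have natE n (E : {subfield K}) : n%:R \in E by exact: rpred_nat.
have E1 y : y \in <<1; d1>>%VS -> exists a b : rat, y = a%:A + b%:A * d1.
  case/(memv_adjoin_sqrt (E := 1%AS)) => [|_ [_ [/vlineP[a ->] /vlineP[b ->] ->]]].
    by rewrite d1E natE.
  by exists a, b.
have : x \in <<1 & [:: d1; d2; d3]>>%VS by rewrite K_gen memvf.
rewrite !adjoin_cons Fadjoin_nil.
case/memv_adjoin_sqrt=> [|y [z [Ey Ez ->]]]; first by rewrite d3E natE.
case/memv_adjoin_sqrt: Ey => [|a [b [/E1[a0 [a1 ->]] /E1[a2 [a3 ->]] ->]]].
  by rewrite d2E natE.
case/memv_adjoin_sqrt: Ez => [|c [d [/E1[a4 [a5 ->]] /E1[a6 [a7 ->]] ->]]].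
  by rewrite d2E natE.
by exists (nth 0 [:: a0; a1; a2; a3; a4; a5; a6; a7]).
Qed.

Let fixA (f : {rmorphism K -> K}) (c : rat) : f c%:A = c%:A.
Proof. by rewrite alg_num_field fmorph_rat. Qed.

Lemma triquadratic_rmorph_eq (f g : {rmorphism K -> K}) :
  f d1 = g d1 -> f d2 = g d2 -> f d3 = g d3 -> f =1 g.
Proof.
move=> e1 e2 e3 x; have [a ->] := triquadratic_coords x.
by rewrite !(rmorphD, rmorphM) /= !fixA e1 e2 e3.
Qed.

Variables s1 s2 s3 : {rmorphism K -> K}.
Hypotheses (s1d1 : s1 d1 = - d1) (s1d2 : s1 d2 = d2) (s1d3 : s1 d3 = d3).
Hypotheses (s2d1 : s2 d1 = d1) (s2d2 : s2 d2 = - d2) (s2d3 : s2 d3 = d3).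
Hypotheses (s3d1 : s3 d1 = d1) (s3d2 : s3 d2 = d2) (s3d3 : s3 d3 = - d3).

Let sE := (s1d1, s1d2, s1d3, s2d1, s2d2, s2d3, s3d1, s3d2, s3d3).

Let involP (f : {rmorphism K -> K}) :
  f (f d1) = d1 -> f (f d2) = d2 -> f (f d3) = d3 -> involutive f.
Proof. by move=> e1 e2 e3; apply: (@triquadratic_rmorph_eq (f \o f) idfun). Qed.

Lemma triquadratic_involutive : [/\ involutive s1, involutive s2 & involutive s3].
Proof. by split; apply: involP; rewrite !(rmorphN, sE, opprK). Qed.

Let commP (f g : {rmorphism K -> K}) :
  f (g d1) = g (f d1) -> f (g d2) = g (f d2) -> f (g d3) = g (f d3) ->
  forall x, f (g x) = g (f x).
Proof. by move=> e1 e2 e3; apply: (@triquadratic_rmorph_eq (f \o g) (g \o f)). Qed.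

Lemma triquadratic_commute : [/\ forall x, s2 (s1 x) = s1 (s2 x),
  forall x, s3 (s1 x) = s1 (s3 x) & forall x, s3 (s2 x) = s2 (s3 x)].
Proof. by split; apply: commP; rewrite !(rmorphN, sE). Qed.

Lemma trace_d1 x : exists a b : rat, x + s2 x + s3 x + s2 (s3 x) = a%:A + b%:A * d1.
Proof.
have [a ->] := triquadratic_coords x; exists (4 * a 0%N), (4 * a 1%N).
rewrite -!in_algE !rmorphM !(rmorph_nat (in_alg K)) /=.
by rewrite !(rmorphD, rmorphM, fixA, rmorphN, sE) /=; ring.
Qed.

Lemma trace_d2 x : exists a b : rat, x + s1 x + s3 x + s1 (s3 x) = a%:A + b%:A * d2.
Proof.
have [a ->] := triquadratic_coords x; exists (4 * a 0%N), (4 * a 2%N).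
rewrite -!in_algE !rmorphM !(rmorph_nat (in_alg K)) /=.
by rewrite !(rmorphD, rmorphM, fixA, rmorphN, sE) /=; ring.
Qed.

Lemma trace_d3 x : exists a b : rat, x + s1 x + s2 x + s1 (s2 x) = a%:A + b%:A * d3.
Proof.
have [a ->] := triquadratic_coords x; exists (4 * a 0%N), (4 * a 4%N).
rewrite -!in_algE !rmorphM !(rmorph_nat (in_alg K)) /=.
by rewrite !(rmorphD, rmorphM, fixA, rmorphN, sE) /=; ring.
Qed.

Lemma trace_d2d3 x : exists a b : rat, x + s1 x + s2 (s3 x) + s1 (s2 (s3 x)) = a%:A + b%:A * (d2 * d3).
Proof.
have [a ->] := triquadratic_coords x; exists (4 * a 0%N), (4 * a 6%N).
rewrite -!in_algE !rmorphM !(rmorph_nat (in_alg K)) /=.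
by rewrite !(rmorphD, rmorphM, fixA, rmorphN, sE) /=; ring.
Qed.

Lemma trace_d1d2 x : exists a b : rat, x + s3 x + s1 (s2 x) + s3 (s1 (s2 x)) = a%:A + b%:A * (d1 * d2).
Proof.
have [a ->] := triquadratic_coords x; exists (4 * a 0%N), (4 * a 3%N).
rewrite -!in_algE !rmorphM !(rmorph_nat (in_alg K)) /=.
by rewrite !(rmorphD, rmorphM, fixA, rmorphN, sE) /=; ring.
Qed.

Lemma trace_d1d3 x : exists a b : rat, x + s2 x + s1 (s3 x) + s2 (s1 (s3 x)) = a%:A + b%:A * (d1 * d3).
Proof.
have [a ->] := triquadratic_coords x; exists (4 * a 0%N), (4 * a 5%N).
rewrite -!in_algE !rmorphM !(rmorph_nat (in_alg K)) /=.
by rewrite !(rmorphD, rmorphM, fixA, rmorphN, sE) /=; ring.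
Qed.

(** The last conjugate is left unreduced so as to match [norm4] for the composites [s1 \o s2] and
    [s2 \o s3]. *)
Lemma trace_d1d2d3 x : exists a b : rat, x + s1 (s2 x) + s2 (s3 x) + s1 (s2 (s2 (s3 x))) = a%:A + b%:A * (d1 * (d2 * d3)).
Proof.
have [a ->] := triquadratic_coords x; exists (4 * a 0%N), (4 * a 7%N).
rewrite -!in_algE !rmorphM !(rmorph_nat (in_alg K)) /=.
by rewrite !(rmorphD, rmorphM, fixA, rmorphN, sE) /=; ring.
Qed.

End TriquadraticField.

(** * The units of K *)

Lemma modn8_mod4 n : (n %% 8 = 3 \/ n %% 8 = 7)%N -> (n %% 4 = 3)%N.
Proof. by lia. Qed.

Lemma modn4_odd n : (n %% 4 = 3)%N -> odd n. Proof. by lia. Qed.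

Lemma mod4_prod a b : (a %% 4 = 3)%N -> (b %% 4 = 3)%N -> (a * b %% 4 = 1)%N.
Proof. by move=> a3 b3; rewrite -modnMm a3 b3. Qed.

Lemma quadratic_conj_fix (K : fieldExtType rat) (d : nat) (r x : K) (h : {rmorphism K -> K}) :
  r ^+ 2 = d%:R -> h r = r -> x \in <<1; r>>%VS -> h x = x.
Proof.
move=> r2 hr /(memv_adjoin_sqrt (E := 1%AS)) []; first by rewrite r2 rpred_nat.
move=> _ [_ [/vlineP[a ->] /vlineP[b ->] ->]].
by rewrite rmorphD rmorphM hr !alg_num_field !fmorph_rat.
Qed.

(** The unit 1 + sqrt 2 has norm -1 and is a power of [e] up to sign, so [e] cannot have norm 1. *)
Lemma fundamental_unit_sqrt2_norm (R : realType) (K : fieldExtType rat)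
    (iota : {rmorphism K -> R}) (r e : K) (h : {rmorphism K -> K}) :
  r ^+ 2 = 2 -> h r = - r -> fundamental_unit iota <<1; r>> e -> e * h e = -1.
Proof.
move=> r2 hr e_fund; have [ue _ gen] := e_fund.
have sq2 : squarefree 2 by have := @squarefree_prod_primes [:: 2] isT isT; rewrite big_seq1.
have [e1|//] := quadratic_unit_conj (isT : (1 < 2)%N) sq2 r2 hr ue.
have uu : unit_of_integers <<1; r>> (1 + r).
  have ir : alg_integer r by apply: alg_integer_sqrt; rewrite r2; exact: integral_nat.
  have Er : r \in <<1; r>>%VS by exact: memv_adjoin.
  split; first by rewrite rpredD ?rpred1.
    by apply: alg_integerD => //; exact: alg_integer1.
  exists (r - 1); split; first by rewrite rpredB ?rpred1.
    by apply: integral_sub => //; exact: alg_integer1.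
  have -> : (1 + r) * (r - 1) = r ^+ 2 - 1 by ring.
  by rewrite r2 -[2]/(1 + 1) addrK.
have uE : (1 + r) * h (1 + r) = -1.
  rewrite rmorphD rmorph1 hr; have -> : (1 + r) * (1 - r) = 1 - r ^+ 2 by ring.
  by rewrite r2 -[2]/(1 + 1) opprD addNKr.
have [n nE] := gen _ uu; exfalso.
have e0 := unit_of_integers_neq0 ue.
have : (1 + r) * h (1 + r) = 1.
  case: nE => ->; rewrite ?rmorphN ?mulrNN fmorphXz -expfzMl e1 exp1rz //.
move/eqP; rewrite uE -subr_eq0 -opprD oppr_eq0 -[1 + 1]/2; exact/negP/char0_2.
Qed.

Section UnitsOfK.
Variables (R : realType) (p q s : nat).
Hypotheses (p_prime : prime p) (q_prime : prime q) (s_prime : prime s).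
Hypotheses (pqs_distinct : uniq [:: p; q; s]).
Hypotheses (p8 : (p %% 8 = 7)%N) (q8 : (q %% 8 = 3)%N) (s8 : (s %% 8 = 3)%N).
Variables (K : fieldExtType rat) (iota0 : {rmorphism K -> R}) (sqrt2 sqrtpq sqrtps : K).
Hypotheses (sqrt2P : pos_sqrt iota0 2%:R sqrt2)
  (sqrtpqP : pos_sqrt iota0 (p * q)%:R sqrtpq) (sqrtpsP : pos_sqrt iota0 (p * s)%:R sqrtps).
Hypothesis K_gen : <<1 & [:: sqrt2; sqrtpq; sqrtps]>>%VS = fullv.

Let p4 : (p %% 4 = 3)%N. Proof. by apply: modn8_mod4; right. Qed.
Let q4 : (q %% 4 = 3)%N. Proof. by apply: modn8_mod4; left. Qed.
Let s4 : (s %% 4 = 3)%N. Proof. by apply: modn8_mod4; left. Qed.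
Let po := modn4_odd p4.
Let qo := modn4_odd q4.
Let so := modn4_odd s4.

Let neqs : [/\ p != q, p != s & q != s].
Proof. by move: pqs_distinct; rewrite /= !inE negb_or andbT => /andP[/andP[]]. Qed.

Let neqb : [/\ [/\ p == q = false, p == s = false & q == s = false],
  [/\ q == p = false, s == p = false & s == q = false],
  [/\ p == 2%N = false, q == 2%N = false & s == 2%N = false] &
  [/\ 2%N == p = false, 2%N == q = false & 2%N == s = false]].
Proof.
have [pq ps qs] := neqs; have [p2 q2 s2] : [/\ p != 2, q != 2 & s != 2]%N.
  by split; [apply: contraTneq po|apply: contraTneq qo|apply: contraTneq so] => ->.
by split; split; apply/negbTE; rewrite // eq_sym.
Qed.

Let p0 := prime_gt0 p_prime.
Let q0 := prime_gt0 q_prime.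
Let s0 := prime_gt0 s_prime.

Let sum_lognE ls l m : prime l -> prime m ->
  sum_logn ls (l * m) = (sum_logn ls l + sum_logn ls m)%N.
Proof. by move=> pl pm; rewrite sum_lognM ?prime_gt0. Qed.

Let sum_logn_prime ls l : prime l -> sum_logn ls l = count_mem l ls.
Proof.
move=> pl; rewrite /sum_logn; elim: ls => [|x ls IH] /=; first by rewrite big_nil.
by rewrite big_cons IH logn_prime // eq_sym.
Qed.

Let sqrt2E : sqrt2 ^+ 2 = 2%:R. Proof. by case: sqrt2P. Qed.
Let sqrtpqE : sqrtpq ^+ 2 = (p * q)%:R. Proof. by case: sqrtpqP. Qed.
Let sqrtpsE : sqrtps ^+ 2 = (p * s)%:R. Proof. by case: sqrtpsP. Qed.

(** Counting the prime factors among p, q, s gives a character that is even on 2, pq and ps, whose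
    square roots generate [K], and odd on each of the three primes. *)
Lemma prime_nonsquare l (z : K) : l \in [:: p; q; s] -> (l%:R : K) <> z ^+ 2.
Proof.
move=> lpqs zl; have pl : prime l by move: lpqs; rewrite !inE => /or3P[]/eqP->.
have [[n1 n2 n3] [n4 n5 n6] [n7 n8 n9] [n10 n11 n12]] := neqb.
have neqE := (n1, n2, n3, n4, n5, n6, n7, n8, n9, n10, n11, n12, eqxx).
have : z \notin <<1 & [:: sqrt2; sqrtpq; sqrtps]>>%VS.
  apply: (@sqrt_notin_adjoin K [:: p; q; s] _ _ l); rewrite ?prime_gt0 //.
    move=> r; rewrite !inE => /or3P[]/eqP->.
    - by exists 2%N; rewrite sum_logn_prime //= ?neqE.
    - by exists (p * q)%N; rewrite muln_gt0 p0 q0 sum_lognE // !sum_logn_prime //= ?neqE.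
    - by exists (p * s)%N; rewrite muln_gt0 p0 s0 sum_lognE // !sum_logn_prime //= ?neqE.
  rewrite sum_logn_prime //; move: lpqs; rewrite !inE => /or3P[]/eqP-> /=;
    by rewrite ?neqE.
by rewrite K_gen memvf.
Qed.

(** The primes 2, q and s each divide exactly one of 2, pq and ps. The exponent at that prime
    separates the corresponding square root from the field generated by the other two. *)
Lemma sign_changes : exists s1 s2 s3 : {rmorphism K -> K},
  [/\ [/\ s1 sqrt2 = - sqrt2, s1 sqrtpq = sqrtpq & s1 sqrtps = sqrtps],
      [/\ s2 sqrt2 = sqrt2, s2 sqrtpq = - sqrtpq & s2 sqrtps = sqrtps]
    & [/\ s3 sqrt2 = sqrt2, s3 sqrtpq = sqrtpq & s3 sqrtps = - sqrtps]].
Proof.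
have [[n1 n2 n3] [n4 n5 n6] [n7 n8 n9] [n10 n11 n12]] := neqb.
have neqE := (n1, n2, n3, n4, n5, n6, n7, n8, n9, n10, n11, n12, eqxx).
have flip (l n : nat) (r : K) (rs : seq K) :
    {in rs, forall r, exists m : nat, [/\ r ^+ 2 = m%:R, (0 < m)%N & ~~ odd (sum_logn [:: l] m)]} ->
    r ^+ 2 = n%:R -> (0 < n)%N -> odd (sum_logn [:: l] n) ->
    {subset [:: sqrt2; sqrtpq; sqrtps] <= r :: rs} ->
  exists h : {rmorphism K -> K}, {in rs, forall x, h x = x} /\ h r = - r.
  move=> rsP rn n0 on gens.
  have [||h [hE hr]] := conjugation (sqrt_notin_adjoin rsP rn n0 on).
  - by rewrite rn; apply: (rpred_nat <<1 & rs>>%AS).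
  - apply/eqP; rewrite eqEsubv subvf -K_gen /=; apply/Fadjoin_seqP; rewrite sub1v; split=> // x.
    move/gens; rewrite inE => /orP[/eqP->|xs]; first exact: memv_adjoin.
    by apply: subvP (subv_adjoin _ _) _ _; exact: seqv_sub_adjoin.
  by exists h; split=> // x xs; apply: hE; exact: seqv_sub_adjoin.
have [|||||s1 [s1E s1r]] := @flip 2 2 sqrt2 [:: sqrtpq; sqrtps]; rewrite ?sum_logn_prime //.
  move=> r; rewrite !inE => /orP[]/eqP->.
    by exists (p * q)%N; rewrite muln_gt0 p0 q0 sum_lognE // !sum_logn_prime //= ?neqE.
  by exists (p * s)%N; rewrite muln_gt0 p0 s0 sum_lognE // !sum_logn_prime //= ?neqE.
have [|||||s2 [s2E s2r]] := @flip q (p * q)%N sqrtpq [:: sqrt2; sqrtps].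
- move=> r; rewrite !inE => /orP[]/eqP->.
    by exists 2%N; rewrite !sum_logn_prime //= ?neqE.
  by exists (p * s)%N; rewrite muln_gt0 p0 s0 sum_lognE // !sum_logn_prime //= ?neqE.
- by [].
- by rewrite muln_gt0 p0 q0.
- by rewrite sum_lognE // !sum_logn_prime //= ?neqE.
- by move=> x; rewrite !inE => /or3P[]->; rewrite ?orbT.
have [|||||s3 [s3E s3r]] := @flip s (p * s)%N sqrtps [:: sqrt2; sqrtpq].
- move=> r; rewrite !inE => /orP[]/eqP->.
    by exists 2%N; rewrite !sum_logn_prime //= ?neqE.
  by exists (p * q)%N; rewrite muln_gt0 p0 q0 sum_lognE // !sum_logn_prime //= ?neqE.
- by [].
- by rewrite muln_gt0 p0 s0.
- by rewrite sum_lognE // !sum_logn_prime //= ?neqE.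
- by move=> x; rewrite !inE => /or3P[]->; rewrite ?orbT.
exists s1, s2, s3; split; split=> //; by [apply: s1E; rewrite !inE eqxx ?orbT|
  apply: s2E; rewrite !inE eqxx ?orbT|apply: s3E; rewrite !inE eqxx ?orbT].
Qed.

Variables (eps : nat -> K) (epsP : fundamental_units iota0 eps).

Let sqrtqs : K := sqrtpq * sqrtps / p%:R.

Let pK0 : p%:R != 0 :> K. Proof. exact: natr_numfield_neq0. Qed.

Let sqrtqsP : pos_sqrt iota0 (q * s)%:R sqrtqs.
Proof.
have [_ pq_gt0] := sqrtpqP; have [_ ps_gt0] := sqrtpsP.
split; last by rewrite !rmorphM fmorphV rmorph_nat !mulr_gt0 // invr_gt0 ltr0n.
rewrite expr_div_n exprMn sqrtpqE sqrtpsE !natrM.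
by field.
Qed.

Let sqrt2M d r : pos_sqrt iota0 d%:R r -> pos_sqrt iota0 (2 * d)%:R (sqrt2 * r).
Proof.
move=> [r2 r0]; have [_ sqrt2_gt0] := sqrt2P.
by split; [rewrite exprMn sqrt2E r2 natrM|rewrite rmorphM mulr_gt0].
Qed.

Let quadratic d r e := [/\ (1 < d)%N, squarefree d, r ^+ 2 = d%:R
  & fundamental_unit iota0 <<1; r>> e].

Let quadraticP ls d r : all prime ls -> uniq ls -> d = (\prod_(l <- ls) l)%N -> (1 < d)%N ->
  pos_sqrt iota0 d%:R r -> quadratic d r (eps d).
Proof.
move=> prs uls dE d1 rP; have sqf : squarefree d by rewrite dE; exact: squarefree_prod_primes.
by split=> //; [case: rP|apply: epsP].
Qed.

Let quad_2 : quadratic 2 sqrt2 (eps 2).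
Proof. by apply: (@quadraticP [:: 2%N]) => //; rewrite big_seq1. Qed.

Let gt1_mul l m : prime l -> prime m -> (1 < l * m)%N.
Proof. by move=> /prime_gt1 l1 /prime_gt1 m1; rewrite (leq_trans l1) // leq_pmulr // ltnW. Qed.

Let quad_pq : quadratic (p * q) sqrtpq (eps (p * q)).
Proof.
have [[n1 _ _] _ _ _] := neqb.
apply: (@quadraticP [:: p; q]); rewrite ?gt1_mul //= ?p_prime ?q_prime ?inE ?n1 //.
by rewrite !big_cons big_nil muln1.
Qed.

Let quad_ps : quadratic (p * s) sqrtps (eps (p * s)).
Proof.
have [[_ n1 _] _ _ _] := neqb.
apply: (@quadraticP [:: p; s]); rewrite ?gt1_mul //= ?p_prime ?s_prime ?inE ?n1 //.
by rewrite !big_cons big_nil muln1.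
Qed.

Let quad_qs : quadratic (q * s) sqrtqs (eps (q * s)).
Proof.
have [[_ _ n1] _ _ _] := neqb.
apply: (@quadraticP [:: q; s]); rewrite ?gt1_mul //= ?q_prime ?s_prime ?inE ?n1 //.
by rewrite !big_cons big_nil muln1.
Qed.

Let gt1_mul2 l m : prime l -> prime m -> (1 < 2 * l * m)%N.
Proof.
by move=> pl pm; rewrite -mulnA (leq_trans (gt1_mul pl pm)) // leq_pmull.
Qed.

Let quad_2pq : quadratic (2 * p * q) (sqrt2 * sqrtpq) (eps (2 * p * q)).
Proof.
have [[n1 _ _] _ _ [n2 n3 _]] := neqb.
apply: (@quadraticP [:: 2; p; q]%N); rewrite ?gt1_mul2 //= ?p_prime ?q_prime ?inE ?n1 ?n2 ?n3 //.
  by rewrite !big_cons big_nil muln1 mulnA.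
by rewrite -mulnA; exact: sqrt2M.
Qed.

Let quad_2ps : quadratic (2 * p * s) (sqrt2 * sqrtps) (eps (2 * p * s)).
Proof.
have [[_ n1 _] _ _ [n2 _ n3]] := neqb.
apply: (@quadraticP [:: 2; p; s]%N); rewrite ?gt1_mul2 //= ?p_prime ?s_prime ?inE ?n1 ?n2 ?n3 //.
  by rewrite !big_cons big_nil muln1 mulnA.
by rewrite -mulnA; exact: sqrt2M.
Qed.

Let quad_2qs : quadratic (2 * q * s) (sqrt2 * sqrtqs) (eps (2 * q * s)).
Proof.
have [[_ _ n1] _ _ [_ n2 n3]] := neqb.
apply: (@quadraticP [:: 2; q; s]%N); rewrite ?gt1_mul2 //= ?q_prime ?s_prime ?inE ?n1 ?n2 ?n3 //.
  by rewrite !big_cons big_nil muln1 mulnA.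
by rewrite -mulnA; exact: sqrt2M.
Qed.

Let quad_unit d r e : quadratic d r e -> unit_of_integers fullv e.
Proof. by case=> _ _ _ [ue _ _]; apply: unit_of_integersS ue; exact: subvf. Qed.

Let quad_gt1 d r e : quadratic d r e -> 1 < iota0 e.
Proof. by case=> _ _ _ []. Qed.

Let quad_fix d r e (h : {rmorphism K -> K}) : quadratic d r e -> h r = r -> h e = e.
Proof.
by move=> [_ _ r2 [[Ee _ _] _ _]] hr; exact: quadratic_conj_fix r2 hr Ee.
Qed.

Let quad_norm1 d r e (h : {rmorphism K -> K}) l : prime l -> (l %% 4 = 3)%N -> (l %| d)%N ->
  quadratic d r e -> h r = - r -> e * h e = 1.
Proof.
by move=> pl l4 ld [d1 sqf r2 [ue _ _]] hr; exact: quadratic_unit_norm1 ld ue.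
Qed.

Let quad_inv d r e (h : {rmorphism K -> K}) l : prime l -> (l %% 4 = 3)%N -> (l %| d)%N ->
  quadratic d r e -> h r = - r -> h e = e^-1.
Proof.
move=> pl l4 ld quad hr; have e0 := unit_of_integers_neq0 (quad_unit quad).
by apply: (mulfI e0); rewrite divff //; exact: quad_norm1 ld quad hr.
Qed.

Lemma eps_pq_class : exists z, eps (p * q) = p%:R * z ^+ 2.
Proof.
have [s1 [s2 [s3 [_ [_ h _] _]]]] := sign_changes.
have [d1 sqf r2 fund] := quad_pq; have [n _ _] := neqs.
have N1 := quad_norm1 p_prime p4 (dvdn_mulr q (dvdnn p)) quad_pq h.
have [z _ zE] := fundamental_unit_class_prime d1 sqf r2 h fund N1 p_prime q_prime n po qo
  erefl (mod4_prod p4 q4).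
by exists z.
Qed.

Lemma eps_ps_class : exists z, eps (p * s) = p%:R * z ^+ 2.
Proof.
have [s1 [s2 [s3 [_ _ [_ _ h]]]]] := sign_changes.
have [d1 sqf r2 fund] := quad_ps; have [_ n _] := neqs.
have N1 := quad_norm1 p_prime p4 (dvdn_mulr s (dvdnn p)) quad_ps h.
have [z _ zE] := fundamental_unit_class_prime d1 sqf r2 h fund N1 p_prime s_prime n po so
  erefl (mod4_prod p4 s4).
by exists z.
Qed.

Lemma eps_qs_class : exists z, eps (q * s) = q%:R * z ^+ 2.
Proof.
have [s1 [s2 [s3 [_ _ [_ h1 h2]]]]] := sign_changes.
have [d1 sqf r2 fund] := quad_qs; have [_ _ n] := neqs.
have h : s3 sqrtqs = - sqrtqs.
  by rewrite /sqrtqs !rmorphM fmorphV rmorph_nat h1 h2 mulrN mulNr.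
have N1 := quad_norm1 q_prime q4 (dvdn_mulr s (dvdnn q)) quad_qs h.
have [z _ zE] := fundamental_unit_class_prime d1 sqf r2 h fund N1 q_prime s_prime n qo so
  erefl (mod4_prod q4 s4).
by exists z.
Qed.

(** The location of [z] matters later: it makes [z] invariant under the automorphism that changes
    the signs of both sqrt 2 and sqrt(qs), so sqrt 2 times [z] changes sign. *)
Lemma eps_2qs_class : exists2 z, z \in <<1; sqrt2 * sqrtqs>>%VS & eps (2 * q * s) = 2 * z ^+ 2.
Proof.
have [s1 [s2 [s3 [[h1 h2 h3] _ _]]]] := sign_changes.
have [d1 sqf r2 fund] := quad_2qs; have [_ _ n] := neqs.
have h : s1 (sqrt2 * sqrtqs) = - (sqrt2 * sqrtqs).
  by rewrite /sqrtqs !rmorphM fmorphV rmorph_nat h1 h2 h3 mulNr.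
have N1 := quad_norm1 q_prime q4 (dvdn_mulr s (dvdn_mull 2 (dvdnn q))) quad_2qs h.
exact: (fundamental_unit_class_two d1 sqf r2 h fund N1 q_prime s_prime n q8 s8).
Qed.

Let nonsquare_of_class l e z : l \in [:: p; q; s] -> e != 0 -> e = l%:R * z ^+ 2 ->
  forall y : K, e <> y ^+ 2.
Proof.
move=> lpqs e0 eE y ey; apply: (prime_nonsquare (z := y / z) lpqs).
have z0 : z != 0 by apply: contraNneq e0 => z0; rewrite eE z0 expr0n mulr0.
by rewrite expr_div_n -ey eE mulfK // expf_neq0.
Qed.

Let pos_root (x r : K) : r != 0 -> r ^+ 2 = x -> exists r', pos_sqrt iota0 x r'.
Proof.
move=> r0 rx; have [h|h|h] := ltgtP (iota0 r) 0.
- by exists (- r); split; rewrite ?sqrrN // rmorphN oppr_gt0.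
- by exists r.
- by move: r0; rewrite -(fmorph_eq0 iota0) h eqxx.
Qed.

Lemma eps_products_sqrt : exists r1 r2 r3,
  [/\ pos_sqrt iota0 (eps (p * q) * eps (p * s)) r1,
      pos_sqrt iota0 (eps (p * q) * eps (q * s)) r2
    & pos_sqrt iota0 (eps (2 * q * s)) r3].
Proof.
have [z1 z1E] := eps_pq_class; have [z2 z2E] := eps_ps_class.
have [z3 z3E] := eps_qs_class; have [z4 _ z4E] := eps_2qs_class.
have e1 := unit_of_integers_neq0 (quad_unit quad_pq).
have e2 := unit_of_integers_neq0 (quad_unit quad_ps).
have e3 := unit_of_integers_neq0 (quad_unit quad_qs).
have e4 := unit_of_integers_neq0 (quad_unit quad_2qs).
have root x (r : K) : x != 0 -> r ^+ 2 = x -> exists r', pos_sqrt iota0 x r'.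
  by move=> x0 rx; apply: (pos_root _ rx); apply: contraNneq x0 => r0; rewrite -rx r0 expr0n.
have [|r1 r1P] := root _ (p%:R * z1 * z2) (mulf_neq0 e1 e2).
  by rewrite z1E z2E; ring.
have [|r2 r2P] := root _ (sqrtpq * z1 * z3) (mulf_neq0 e1 e3).
  by rewrite !exprMn sqrtpqE z1E z3E natrM; ring.
have [|r3 r3P] := root _ (sqrt2 * z4) e4; first by rewrite exprMn sqrt2E z4E.
by exists r1, r2, r3.
Qed.

Theorem eps_fundamental_system (r1 r2 r3 tpq tps xi : K) (nu : bool) :
    r1 ^+ 2 = eps (p * q) * eps (p * s) -> r2 ^+ 2 = eps (p * q) * eps (q * s) ->
    r3 ^+ 2 = eps (2 * q * s) ->
    tpq ^+ 2 = eps (p * q) * eps (2 * p * q) -> tps ^+ 2 = eps (p * s) * eps (2 * p * s) ->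
    xi ^+ 2 = eps (p * q) ^+ nu * (tpq * tps) ->
  fundamental_system [tuple eps 2; eps (p * q); r1; r2; r3; tpq; xi].
Proof.
move=> r1E r2E r3E tpqE tpsE xiE.
have [s1 [s2 [s3 [[h11 h12 h13] [h21 h22 h23] [h31 h32 h33]]]]] := sign_changes.
have inv := triquadratic_involutive sqrt2E sqrtpqE sqrtpsE K_gen
  h11 h12 h13 h21 h22 h23 h31 h32 h33.
have com := triquadratic_commute sqrt2E sqrtpqE sqrtpsE K_gen
  h11 h12 h13 h21 h22 h23 h31 h32 h33.
have [s1K s2K s3K] := inv; have [s21 s31 s32] := com.
have fixp (h : {rmorphism K -> K}) : h (p%:R^-1) = p%:R^-1 by rewrite fmorphV rmorph_nat.
have hE := (h11, h12, h13, h21, h22, h23, h31, h32, h33, fixp).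
have dvp m : (p %| p * m)%N by exact: dvdn_mulr.
have dvp2 m : (p %| 2 * p * m)%N by rewrite dvdn_mulr // dvdn_mull.
have dvq m : (q %| q * m)%N by exact: dvdn_mulr.
have dvq2 m : (q %| 2 * q * m)%N by rewrite dvdn_mulr // dvdn_mull.
have [z1 z1E] := eps_pq_class; have [z2 z2E] := eps_ps_class.
have [z3 z3E] := eps_qs_class; have [z4 z4m z4E] := eps_2qs_class.
have u0 d r e (qd : quadratic d r e) := unit_of_integers_neq0 (quad_unit qd).
have [g1 g2 g3] : [/\ s1 sqrtqs = sqrtqs, s2 sqrtqs = - sqrtqs & s3 sqrtqs = - sqrtqs].
  by rewrite /sqrtqs !rmorphM !hE ?mulrN ?mulNr.
have gE := (hE, g1, g2, g3).
have tr1 c (f g : K -> K) (d r : K)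
    (t : forall x, exists a b : rat, x + f x + g x + f (g x) = a%:A + b%:A * d) :
    d = c%:A * r -> forall x, x + f x + g x + f (g x) \in <<1; r>>%VS.
  exact: trace_mem_adjoin.
have one (d : K) : d = 1%:A * d by rewrite scale1r mul1r.
have qsE : sqrtpq * sqrtps = (p%:R : rat)%:A * sqrtqs.
  by rewrite -in_algE rmorph_nat /sqrtqs; field.
have qsE2 : sqrt2 * (sqrtpq * sqrtps) = (p%:R : rat)%:A * (sqrt2 * sqrtqs).
  by rewrite qsE; ring.
have fundE d r e (qd : quadratic d r e) : fundamental_unit iota0 <<1; r>> e by case: qd.
have K12 : involutive (s1 \o s2) by move=> x /=; rewrite s21 s1K s2K.
have K13 : involutive (s1 \o s3) by move=> x /=; rewrite s31 s1K s3K.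
have K23 : involutive (s2 \o s3) by move=> x /=; rewrite s32 s2K s3K.
apply: (@triquadratic_fundamental_system R K iota0 s1 s2 s3 s1K s2K s3K s21 s31 s32
  (eps 2) (eps (p * q)) (eps (p * s)) (eps (q * s)) (eps (2 * p * q)) (eps (2 * p * s))
  (eps (2 * q * s)) (quad_gt1 quad_2) (quad_gt1 quad_pq) (quad_gt1 quad_ps)
  (quad_gt1 quad_qs) (quad_gt1 quad_2pq) (quad_gt1 quad_2ps) (quad_gt1 quad_2qs)
  (quad_unit quad_2) (quad_unit quad_pq) (quad_unit quad_ps) (quad_unit quad_qs)
  (quad_unit quad_2pq) (quad_unit quad_2ps) (quad_unit quad_2qs)) r1E r2E (r3E) tpqE tpsE xiE _.
- have e0 := u0 _ _ _ quad_2; apply: (mulfI e0); rewrite mulrN divff //.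
  exact: fundamental_unit_sqrt2_norm sqrt2E h11 (fundE _ _ _ quad_2).
- exact: quad_fix quad_2 h21.
- exact: quad_fix quad_2 h31.
- exact: quad_fix quad_pq h12.
- exact: quad_inv p_prime p4 (dvp q) quad_pq h22.
- exact: quad_fix quad_pq h32.
- exact: quad_fix quad_ps h13.
- exact: quad_fix quad_ps h23.
- exact: quad_inv p_prime p4 (dvp s) quad_ps h33.
- exact: quad_fix quad_qs g1.
- exact: quad_inv q_prime q4 (dvq s) quad_qs g2.
- exact: quad_inv q_prime q4 (dvq s) quad_qs g3.
- by apply: quad_inv p_prime p4 (dvp2 q) quad_2pq _; rewrite rmorphM !gE ?mulrN ?mulNr ?opprK.
- by apply: quad_inv p_prime p4 (dvp2 q) quad_2pq _; rewrite rmorphM !gE ?mulrN ?mulNr ?opprK.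
- by apply: quad_fix quad_2pq _; rewrite rmorphM !gE ?mulrN ?mulNr ?opprK.
- by apply: quad_inv p_prime p4 (dvp2 s) quad_2ps _; rewrite rmorphM !gE ?mulrN ?mulNr ?opprK.
- by apply: quad_fix quad_2ps _; rewrite rmorphM !gE ?mulrN ?mulNr ?opprK.
- by apply: quad_inv p_prime p4 (dvp2 s) quad_2ps _; rewrite rmorphM !gE ?mulrN ?mulNr ?opprK.
- by apply: quad_inv q_prime q4 (dvq2 s) quad_2qs _; rewrite rmorphM !gE ?mulrN ?mulNr ?opprK.
- by apply: quad_inv q_prime q4 (dvq2 s) quad_2qs _; rewrite rmorphM !gE ?mulrN ?mulNr ?opprK.
- by apply: quad_inv q_prime q4 (dvq2 s) quad_2qs _; rewrite rmorphM !gE ?mulrN ?mulNr ?opprK.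
- apply: (norm4_fundamental_power s2K s3K _ _ (fundE _ _ _ quad_2)) => //.
  exact: tr1 (trace_d1 sqrt2E sqrtpqE sqrtpsE K_gen h21 h22 h23 h31 h32 h33) (one _).
- apply: (norm4_fundamental_power s1K s3K _ _ (fundE _ _ _ quad_pq)) => //.
  exact: tr1 (trace_d2 sqrt2E sqrtpqE sqrtpsE K_gen h11 h12 h13 h31 h32 h33) (one _).
- apply: (norm4_fundamental_power s1K s2K _ _ (fundE _ _ _ quad_ps)) => //.
  exact: tr1 (trace_d3 sqrt2E sqrtpqE sqrtpsE K_gen h11 h12 h13 h21 h22 h23) (one _).
- apply: (norm4_fundamental_power s1K K23 _ _ (fundE _ _ _ quad_qs)).
    by move=> x /=; rewrite s31 s21.
  exact: tr1 (trace_d2d3 sqrt2E sqrtpqE sqrtpsE K_gen h11 h12 h13 h21 h22 h23 h31 h32 h33) qsE.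
- apply: (norm4_fundamental_power s3K K12 _ _ (fundE _ _ _ quad_2pq)).
    by move=> x /=; rewrite s31 s32.
  exact: tr1 (trace_d1d2 sqrt2E sqrtpqE sqrtpsE K_gen h11 h12 h13 h21 h22 h23 h31 h32 h33) (one _).
- apply: (norm4_fundamental_power s2K K13 _ _ (fundE _ _ _ quad_2ps)).
    by move=> x /=; rewrite s32 s21.
  exact: tr1 (trace_d1d3 sqrt2E sqrtpqE sqrtpsE K_gen h11 h12 h13 h21 h22 h23 h31 h32 h33) (one _).
- apply: (norm4_fundamental_power K12 K23 _ _ (fundE _ _ _ quad_2qs)).
    by move=> x /=; rewrite !(s31, s32, s21).
  exact: tr1 (trace_d1d2d3 sqrt2E sqrtpqE sqrtpsE K_gen h11 h12 h13 h21 h22 h23 h31 h32 h33) qsE2.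
- by apply: nonsquare_of_class z1E; rewrite ?inE ?eqxx // (u0 _ _ _ quad_pq).
- by apply: nonsquare_of_class z2E; rewrite ?inE ?eqxx // (u0 _ _ _ quad_ps).
- by apply: nonsquare_of_class z3E; rewrite ?inE ?eqxx ?orbT // (u0 _ _ _ quad_qs).
have [_ _ r2qs _] := quad_2qs.
have z4fix : s1 (s3 z4) = z4.
  apply: (quadratic_conj_fix (h := s1 \o s3) r2qs _ z4m).
  by rewrite /= !(rmorphM, rmorphN, gE) /sqrtqs; ring.
have : r3 ^+ 2 = (sqrt2 * z4) ^+ 2 by rewrite r3E z4E exprMn sqrt2E.
have w : s1 (s3 (sqrt2 * z4)) = - (sqrt2 * z4).
  by rewrite !rmorphM z4fix !gE mulNr.
by move/eqP; rewrite eqf_sqr => /orP[]/eqP->; rewrite ?rmorphN w.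
Qed.

End UnitsOfK.

(** * Absolute values of number fields *)

Section NumberFieldValues.
Variables (R : realType) (K : fieldExtType rat) (w : K -> R).
Hypothesis wP : nonarch_absolute_value w.

Lemma absv_coprime m n : coprime m n -> w m%:R < 1 -> w n%:R = 1.
Proof.
move=> mn m1; apply/eqP; rewrite eq_le absv_nat_le1 //= leNgt; apply/negP=> n1.
have [n0|n0] := posnP n.
  by move: mn m1; rewrite n0 /coprime gcdn0 => /eqP->; rewrite absv1 // ltxx.
case: (egcdnP m n0) => kn km e _.
have : w ((kn * n)%:R - (km * m)%:R) < 1.
  apply: (absvD_lt wP); rewrite ?absvN // natrM (absvM wP).
    by apply: le_lt_trans n1; rewrite ler_piMl ?(absv_ge0 wP) ?absv_nat_le1.
  by apply: le_lt_trans m1; rewrite ler_piMl ?(absv_ge0 wP) ?absv_nat_le1.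
have -> : (kn * n)%N = (km * m + 1)%N by rewrite e gcdnC (eqP mn).
by rewrite natrD addrC addKr (absv1 wP) ltxx.
Qed.

Lemma absv_nat_ndvd l n : prime l -> w l%:R < 1 -> ~~ (l %| n)%N -> w n%:R = 1.
Proof. by move=> pl l1 ln; apply: absv_coprime l1; rewrite prime_coprime. Qed.

(* The equation of x over Q has two terms of the same largest absolute value. *)
Lemma absv_algebraic (x : K) : x != 0 -> exists (e : nat) (c : rat),
  [/\ (0 < e <= \dim {:K})%N, c != 0 & w x ^+ e = w c%:A].
Proof.
move=> x0; set P := minPoly 1%AS x.
have szP : size P = (adjoin_degree 1%AS x).+1 by rewrite size_minPoly.
have P0 : P != 0 by rewrite monic_neq0 ?monic_minPoly.
have szD : (size P <= (\dim {:K}).+1)%N.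
  have := dimvS (subvf <<1%AS; x>>); rewrite dim_Fadjoin dimv1 muln1.
  by rewrite szP.
have sz0 : (0 < size P)%N by rewrite szP.
pose t (i : 'I_(size P)) := P`_i * x ^+ i.
have sum0 : \sum_i t i = 0 by rewrite -horner_coef minPolyxx.
have [i0 ti0] : exists i, t i != 0.
  have lt : ((size P).-1 < size P)%N by rewrite ltn_predL.
  exists (Ordinal lt); rewrite mulf_neq0 ?expf_neq0 //.
  by rewrite /= -[P`_ _]/(lead_coef P) lead_coef_eq0.
have [i imax] : exists i, forall k, w (t k) <= w (t i).
  have [i _ h] := @Order.TotalTheory.arg_maxP _ _ _ i0 xpredT (fun i => w (t i)) isT.
  by exists i => k; exact: h.
have wi0 : 0 < w (t i) by apply: lt_le_trans (imax i0); rewrite (absv_gt0 wP).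
have [k ki wk] : exists2 k, k != i & w (t k) = w (t i).
  apply/exists2P; apply: contrapT => h; have : w (t i) < w (t i); last by rewrite ltxx.
  have e : t i = - \sum_(k | k != i) t k.
    by move: sum0; rewrite (bigD1 i) //= => /eqP; rewrite addr_eq0 => /eqP.
  rewrite [in X in X < _]e (absvN wP).
  apply: (absv_sum_lt wP) => // k ki; rewrite lt_neqAle imax andbT.
  by apply/eqP => wk; apply: h; exists k.
have rat_coef (m : 'I_(size P)) : exists c : rat, P`_m = c%:A.
  by have /polyOverP/(_ m)/vlineP[c cE] := minPolyOver 1%AS x; exists c.
have main (a b : 'I_(size P)) : (a < b)%N -> w (t a) = w (t b) -> 0 < w (t a) ->
    exists (e : nat) (c : rat), [/\ (0 < e <= \dim {:K})%N, c != 0 & w x ^+ e = w c%:A].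
  move=> ab wab wa; have [[ca caE] [cb cbE]] := (rat_coef a, rat_coef b).
  have tb0 : t b != 0 by rewrite -(absv_gt0 wP) -wab.
  have ta0 : t a != 0 by rewrite -(absv_gt0 wP).
  have ca0 : ca != 0.
    by apply: contraNneq ta0 => c0; rewrite /t caE c0 scale0r mul0r.
  have cb0 : cb != 0.
    by apply: contraNneq tb0 => c0; rewrite /t cbE c0 scale0r mul0r.
  exists (b - a)%N, (ca / cb); split.
  - rewrite subn_gt0 ab /=; apply: leq_trans (leq_subr _ _) _.
    by rewrite -ltnS; apply: leq_trans (ltn_ord b) szD.
  - by rewrite mulf_neq0 ?invr_neq0.
  have A0 (c : rat) : c != 0 -> c%:A != 0 :> K by move=> c0; rewrite scaler_eq0 negb_or c0 oner_eq0.
  have e : w ca%:A * w x ^+ a = w cb%:A * (w x ^+ (b - a) * w x ^+ a).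
    by rewrite -exprD subnK ?(ltnW ab) // -!(absvX wP) -!(absvM wP) -caE -cbE.
  have wx0 : w x ^+ a != 0 by rewrite expf_neq0 ?(absv_eq0 wP).
  have wcb : w cb%:A != 0 by rewrite (absv_eq0 wP) A0.
  rewrite -in_algE rmorphM fmorphV /= (absvM wP) (absvV wP).
  apply: (mulIf wx0); apply: (mulfI wcb); rewrite -e.
  by field.
have [ab|ba|e] := ltngtP k i.
- by apply: (main k i) => //; rewrite wk.
- by apply: (main i k) => //; rewrite wk.
- by case/eqP: ki; apply: val_inj.
Qed.

Lemma absv_ratE (c : rat) : w c%:A = w (numq c)%:~R / w (denq c)%:~R.
Proof.
rewrite -{1}(divq_num_den c) -in_algE rmorphM fmorphV /= (absvM wP) (absvV wP).
by rewrite -!in_algE !rmorph_int.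
Qed.

Lemma absv_intE (n : int) : w n%:~R = w `|n|%N%:R.
Proof. by case: n => n //; rewrite NegzE rmorphN /= (absvN wP). Qed.

Hypothesis w_nontrivial : exists x, x != 0 /\ w x <> 1.

(** If [w] were 1 at every prime, it would be 1 on all nonzero rationals and, by [absv_algebraic],
    on all nonzero elements of [K]. *)
Lemma residue_prime : exists l, prime l /\ w l%:R < 1.
Proof.
apply: contrapT => h; have [x [x0 x1]] := w_nontrivial; apply: x1.
have nat1 n : (0 < n)%N -> w n%:R = 1.
  elim/ltn_ind: n => n IH n0; have [n1|n1] := leqP n 1.
    have -> : n = 1%N by apply/eqP; rewrite eqn_leq n1 n0.
    exact: (absv1 wP).
  have pl := pdiv_prime n1; rewrite -(divnK (pdiv_dvd n)) natrM (absvM wP).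
  rewrite IH ?divn_gt0 ?pdiv_leq ?pdiv_gt0 ?ltn_Pdiv ?prime_gt1 // mul1r.
  apply/eqP; rewrite eq_le absv_nat_le1 //= leNgt; apply/negP=> l1.
  by apply: h; exists (pdiv n).
have int1 (n : int) : n != 0 -> w n%:~R = 1 by move=> n0; rewrite absv_intE nat1 ?absz_gt0.
have [e [c [/andP[e0 _] c0]]] := absv_algebraic x0.
rewrite absv_ratE !int1 ?numq_eq0 ?denq_eq0 // divr1 => /eqP.
by rewrite pexpr_eq1 ?(absv_ge0 wP) // => /eqP.
Qed.

Lemma absv_rat_power l (c : rat) : prime l -> w l%:R < 1 -> c != 0 ->
  exists k : int, w c%:A = w l%:R ^ k.
Proof.
move=> pl l1 c0.
have l0 : w l%:R != 0 by rewrite (absv_eq0 wP) natr_numfield_neq0 ?prime_gt0.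
have nat_pow n : (0 < n)%N -> exists k : int, w n%:R = w l%:R ^ k.
  move=> n0; have [m lm nE] := pfactor_coprime pl n0; exists (logn l n).
  rewrite {1}nE natrM natrX (absvM wP) (absvX wP) -exprnP (absv_coprime lm l1) mul1r.
  by [].
have int_pow (n : int) : n != 0 -> exists k : int, w n%:~R = w l%:R ^ k.
  by move=> n0; rewrite absv_intE; apply: nat_pow; rewrite absz_gt0.
have [|a aE] := int_pow (numq c); first by rewrite numq_eq0.
have [|b bE] := int_pow (denq c); first by rewrite denq_eq0.
by exists (a - b); rewrite absv_ratE aE bE expfzDr // -invr_expz.
Qed.

(* Otherwise w(l) would have 2^k-th roots in the value group for all k, but
   this group has finite index over the powers of w(l). *)
Lemma nonsquare_value : exists u, forall x, w u != w x ^+ 2.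
Proof.
apply: contrapT => h.
have sq u : exists x, w u = w x ^+ 2.
  apply: contrapT => nx; apply: h; exists u => x; apply/eqP=> e.
  by apply: nx; exists x.
have [l [pl l1]] := residue_prime.
have roots k : exists x, w x ^+ (2 ^ k) = w l%:R.
  elim: k => [|k [x xE]]; first by exists l%:R; rewrite expr1.
  have [y yE] := sq x; exists y.
  by rewrite expnS exprM -yE.
(* Depth [\dim {:K}] suffices: the exponent e given by [absv_algebraic] would be a positive multiple
   of 2^dim, yet it is at most dim. *)
have [x xE] := roots (\dim {:K}).
have l0 : w l%:R != 0 by rewrite (absv_eq0 wP) natr_numfield_neq0 ?prime_gt0.
have x0 : x != 0.
  by apply: contraNneq l0 => x0; rewrite -xE x0 (absv0 wP) expr0n expn_eq0.
have [e [c [/andP[e0 eD] c0 ec]]] := absv_algebraic x0.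
have [m cm] := absv_rat_power pl l1 c0.
have lp : 0 < w l%:R by rewrite lt_def l0 (absv_ge0 wP).
have : w l%:R ^ (e : int) = w l%:R ^ (m * (2 ^ (\dim {:K}))%N%:Z).
  by rewrite -exprnP -{1}xE -exprM mulnC exprM ec cm exprnP exprz_exp.
move/(ieexprIz lp (negbT (lt_eqF l1))) => em.
have : (2 ^ \dim {:K} %| e)%N by rewrite -(absz_nat e) em abszM dvdn_mull.
move/(dvdn_leq e0) => /leq_trans/(_ eD).
by rewrite leqNgt ltn_expl.
Qed.

End NumberFieldValues.

(** * The residue field at a dyadic place *)

Lemma dyadic_int_sqrt d k : (d %% 8 = 1)%N ->
  exists m t : int, (m * 2 + 1) ^+ 2 = d%:Z + 2 ^+ (k + 3) * t.
Proof.
move=> d8; elim: k => [|k [m [t NE]]].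
  by exists 0, (- (d %/ 8)%N%:Z); have := divn_eq d 8; rewrite d8; lia.
have [u [tE|tE]] := int_parity t.
  by exists m, u; rewrite NE tE addSn [in RHS]exprS; move: (2 ^+ _) => Q; ring.
(* For odd t the odd root N = 2 m + 1 is replaced by N + 2^(k+2). This changes N^2 by 2^(k+3) N
   modulo 2^(k+4), which makes the new cofactor of 2^(k+3) even. *)
exists (m + 2 ^+ (k + 1)), (u + m + 1 + 2 ^+ k).
have -> : ((m + 2 ^+ (k + 1)) * 2 + 1) ^+ 2 =
  (m * 2 + 1) ^+ 2 + 2 ^+ (k + 1) * 4 * (m * 2 + 1) + (2 ^+ (k + 1)) ^+ 2 * 4 :> int by ring.
by rewrite NE tE addSn [2 ^+ (k + 3).+1]exprS !exprD; move: (2 ^+ k) => Q; ring.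
Qed.

Section DyadicPlace.
Variables (R : realType) (K : fieldExtType rat) (w : K -> R) (th om c : K).
Hypotheses (wP : nonarch_absolute_value w) (w2 : w 2 < 1).
Hypotheses (th2 : th ^+ 2 = 2) (om2 : om ^+ 2 = om + 1 + 2 * c) (wc : w c <= 1).

Let g := w th.
Let g2E : w 2 = g ^+ 2. Proof. by rewrite -th2 (absvX wP). Qed.
Let th0 : th != 0.
Proof. by apply: contraTneq (char0_2 K) => t0; rewrite -th2 t0 expr0n eqxx. Qed.
Let g0 : 0 < g. Proof. by rewrite (absv_gt0 wP). Qed.
Let g1 : g < 1.
Proof. by rewrite ltNge; apply/negP=> /(exprn_ege1 2); rewrite -g2E leNgt w2. Qed.
Let g2g : g ^+ 2 < g. Proof. by rewrite expr2 gtr_pMl. Qed.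
Let wom : w om = 1 := absv_cube_root wP w2 om2 wc.
Let wom1 : w (om + 1) = 1 := absv_cube_root_add1 wP w2 om2 wc.

Let odd_int (n : int) : odd `|n|%N -> w n%:~R = 1.
Proof.
move=> on; rewrite (absv_intE wP) //; apply: (absv_nat_ndvd wP (l := 2)) => //.
by rewrite dvdn2 on.
Qed.

Let even_int (n : int) : ~~ odd `|n|%N -> w n%:~R <= w 2.
Proof.
move=> en; rewrite (absv_intE wP) //.
have -> : `|n|%N = (2 * `|n|./2)%N by rewrite -[LHS]odd_double_half (negPf en) mul2n.
by rewrite natrM (absvM wP) ler_piMr ?(absv_ge0 wP) ?(absv_nat_le1 wP).
Qed.

Let rat_residue (a : rat) : w a%:A <= 1 -> w a%:A <= w 2 \/ w (a%:A - 1) <= w 2.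
Proof.
have cop := coprime_num_den a.
have [od|ed] := boolP (odd `|denq a|%N); last first.
  have on : odd `|numq a|%N.
    apply: contraT => en.
    have : (2 %| gcdn `|numq a| `|denq a|)%N by rewrite dvdn_gcd !dvdn2 en ed.
    by rewrite (eqP cop).
  rewrite (absv_ratE wP) odd_int // div1r => h.
  have wd := even_int ed; have : 0 < w (denq a)%:~R.
    by rewrite (absv_gt0 wP) -(rmorph_int (in_alg K)) fmorph_eq0 intr_eq0 denq_eq0.
  by move=> wd0; move: h; rewrite invf_le1 // leNgt (le_lt_trans wd).
have wd : w (denq a)%:~R = 1 by exact: odd_int.
have [on|en] := boolP (odd `|numq a|%N); last first.
  by left; rewrite (absv_ratE wP) wd divr1 even_int.
right; have -> : a%:A - 1 = (numq a - denq a)%:~R / (denq a)%:~R :> K.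
  have d0 : (denq a)%:~R != 0 :> K by rewrite -(absv_eq0 wP) wd oner_eq0.
  rewrite rmorphB mulrBl divff //; congr (_ - 1).
  by rewrite -{1}(divq_num_den a) -in_algE rmorphM fmorphV !rmorph_int.
by rewrite (absvM wP) (absvV wP) wd invr1 mulr1; apply: even_int; lia.
Qed.

Let rat_ratio (a b : rat) : b != 0 -> (a / b)%:A = a%:A / b%:A :> K.
Proof. by move=> b0; rewrite -!in_algE rmorphM fmorphV. Qed.

(** No cancellation can occur, since w a = w b g would give a rational number of value g. By
    [rat_residue], a rational of value at most 1 has value 1 or at most g^2. *)
Let sqrt2_max (a b : rat) : w (a%:A + b%:A * th) = Num.max (w a%:A) (w b%:A * g).
Proof.
have [->|b0] := eqVneq b 0.
  by rewrite scale0r mul0r addr0 (absv0 wP) mul0r max_l // (absv_ge0 wP).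
rewrite (absvD_neq wP) (absvM wP) //; apply/eqP => e.
have wb0 : w b%:A != 0 by rewrite (absv_eq0 wP) scaler_eq0 negb_or b0 oner_eq0.
have wr : w (a / b)%:A = g by rewrite rat_ratio // (absvM wP) (absvV wP) e mulrC mulKf.
have [|h|h] := @rat_residue (a / b); first by rewrite wr ltW.
  by move: h; rewrite wr g2E leNgt g2g.
have : w (1 + ((a / b)%:A - 1)) = w 1.
  by rewrite (absvD_domr wP) // (absv1 wP) (le_lt_trans h).
by rewrite addrC subrK wr (absv1 wP) => g1'; move: g1; rewrite g1' ltxx.
Qed.

Let sqrt2_residue (a b : rat) (z := a%:A + b%:A * th) : w z <= 1 ->
  w z <= g \/ w (z - 1) <= g.
Proof.
move=> wz; have /andP[wa wb] : (w a%:A <= 1) && (w b%:A * g <= 1).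
  by rewrite -ge_max -sqrt2_max.
(* If w b > 1, then the rational 1 / b would have value in the interval from g to 1, where
   [rat_residue] leaves no value below 1. *)
have wb1 : w b%:A <= 1.
  have [->|b0] := eqVneq b 0; first by rewrite scale0r (absv0 wP).
  have wb0 : 0 < w b%:A by rewrite (absv_gt0 wP) scaler_eq0 negb_or b0 oner_eq0.
  rewrite leNgt; apply/negP=> b1.
  have vE : w (b^-1)%:A = (w b%:A)^-1 by rewrite -in_algE fmorphV (absvV wP).
  have v1 : w (b^-1)%:A < 1 by rewrite vE invf_lt1.
  have [|h|h] := @rat_residue b^-1; first exact: ltW.
    move: h; rewrite vE g2E -[_^-1]mul1r ler_pdivrMr // => h.
    have : g * (w b%:A * g) <= g * 1 by rewrite ler_wpM2l // ltW.
    by move: h g1; rewrite expr2; lra.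
  have : w (1 + ((b^-1)%:A - 1)) = w 1.
    by rewrite (absvD_domr wP) // (absv1 wP) (le_lt_trans h).
  by rewrite addrC subrK (absv1 wP) => e; rewrite e ltxx in v1.
have wbt : w (b%:A * th) <= g by rewrite (absvM wP) ler_piMl ?(absv_ge0 wP).
have [h|h] := rat_residue wa; [left|right]; rewrite /z.
  by rewrite (absvD_le wP) // (le_trans h) // g2E ltW.
by rewrite addrAC (absvD_le wP) // (le_trans h) // g2E ltW.
Qed.

(* The residue field of Q(sqrt 2, om) at w is {0, 1, om, om + 1}. *)
Lemma dyadic_residue_subfield (a b a' b' : rat)
    (y := (a%:A + b%:A * th) + (a'%:A + b'%:A * th) * om) : w y <= 1 ->
  exists2 r, r \in [:: 0; 1; om; om + 1] & w (y - r) <= g.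
Proof.
set z := a%:A + b%:A * th in y *; set z' := a'%:A + b'%:A * th in y *.
have z'om : w (z' * om) = w z' by rewrite (absvM wP) wom mulr1.
(* Cancellation between z and z' om is excluded: for equal values z / z' is a unit of Q(sqrt 2), so
   its residue is 1, and y / z' has residue om + 1, a unit. The conjugate of z' serves to write z /
   z' in coordinates. *)
have wy : w y = Num.max (w z) (w z').
  have [e|ne] := eqVneq (w z) (w z'); last by rewrite /y (absvD_neq wP) z'om.
  rewrite -e maxxx; have [z0|z0] := eqVneq z 0.
    have z'0 : z' = 0 by apply/eqP; rewrite -(absv_eq0 wP) -e z0 (absv0 wP).
    by rewrite /y z0 z'0 mul0r addr0.
  have z'0 : z' != 0 by rewrite -(absv_eq0 wP) -e (absv_eq0 wP).
  have wcE : w (a'%:A + (- b')%:A * th) = w z'.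
    by rewrite /z' !sqrt2_max scaleNr (absvN wP).
  have zc0 : a'%:A - b'%:A * th != 0.
    by rewrite -mulNr -scaleNr -(absv_eq0 wP) wcE (absv_eq0 wP).
  pose D := a' ^+ 2 - 2 * b' ^+ 2.
  have DE : D%:A = z' * (a'%:A - b'%:A * th).
    rewrite /D -in_algE rmorphB rmorphXn !rmorphM (rmorph_nat (in_alg K)) -th2 /z' /=.
    by ring.
  have D0 : D != 0.
    by rewrite -(fmorph_eq0 (in_alg K)) /= DE mulf_neq0.
  have zz' : ((a * a' - 2 * b * b') / D)%:A + ((b * a' - a * b') / D)%:A * th = z / z'.
    rewrite !rat_ratio // DE -!in_algE !rmorphB !rmorphM !(rmorph_nat (in_alg K)) -th2 /=.
    by rewrite /z; field; rewrite z'0.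
  have wzz' : w (z / z') = 1 by rewrite (absvM wP) (absvV wP) e divff // (absv_eq0 wP).
  have [|h|h] := @sqrt2_residue ((a * a' - 2 * b * b') / D) ((b * a' - a * b') / D).
  - by rewrite zz' wzz'.
  - by move: h; rewrite zz' wzz' leNgt g1.
  have -> : y = z' * ((om + 1) + (z / z' - 1)) by rewrite /y; field.
  rewrite (absvM wP) [w (om + 1 + _)](absvD_domr wP) wom1 ?mulr1 -?e //.
  by rewrite -zz' (le_lt_trans h).
rewrite wy ge_max => /andP[/sqrt2_residue rz /sqrt2_residue rz'].
have [r r01 rE] : exists2 r, r \in [:: 0; 1] & w (z - r) <= g.
  by case: rz => h; [exists 0|exists 1]; rewrite ?inE ?eqxx ?orbT ?subr0.
have [r' r'01 r'E] : exists2 r, r \in [:: 0; 1] & w (z' - r) <= g.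
  by case: rz' => h; [exists 0|exists 1]; rewrite ?inE ?eqxx ?orbT ?subr0.
exists (r + r' * om).
  move: r01 r'01; rewrite !inE => /orP[]/eqP-> /orP[]/eqP->;
    by rewrite ?mul0r ?mul1r ?add0r ?addr0 ?(addrC 1) eqxx ?orbT.
have -> : y - (r + r' * om) = (z - r) + (z' - r') * om by rewrite /y; ring.
by rewrite (absvD_le wP) // (absvM wP) wom mulr1.
Qed.

(* sqrt r = N mod w for integers N, so x is approximated by a + b N. *)
Lemma dyadic_approx_sqrt d (r x a b : K) (e : R) :
    (d %% 8 = 1)%N -> r ^+ 2 = d%:R -> x = a + b * r -> 0 < e ->
  exists N : int, w (x - (a + b * N%:~R)) < e.
Proof.
move=> d8 r2 -> e0.
have wb0 := absv_ge0 wP b.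
have [||k kE] := @expr_lt1_small _ (w 2) (e / (w b + 1)).
- by rewrite (absv_ge0 wP) w2.
- by rewrite divr_gt0 // ltr_wpDl.
suff [N wN] : exists N : int, w (r - N%:~R) <= w 2 ^+ (k + 2).
  exists N; have -> : a + b * r - (a + b * N%:~R) = b * (r - N%:~R) by ring.
  rewrite (absvM wP); apply: le_lt_trans (_ : w b * (w 2 ^+ (k + 2)) < e).
    by rewrite ler_wpM2l.
  apply: le_lt_trans (_ : (w b + 1) * w 2 ^+ (k + 2) < e).
    by rewrite ler_wpM2r ?exprn_ge0 ?(absv_ge0 wP) // lerDl.
  by rewrite mulrC -ltr_pdivlMr ?ltr_wpDl // kE // leq_addr.
have [m [t NE]] := @dyadic_int_sqrt d k d8.
pose N : int := m * 2 + 1.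
have wN : w (2 * N%:~R) = w 2.
  rewrite (absvM wP) /N rmorphD rmorphM /= rmorph1 addrC (mulrC m%:~R).
  by rewrite (absvD_even wP w2) ?mulr1 ?(absv1 wP) ?(absv_int_le1 wP).
have w20 : 0 < w 2 by rewrite (absv_gt0 wP) char0_2.
have prod : w (r - N%:~R) * w (r + N%:~R) <= w 2 ^+ (k + 2) * w 2.
  rewrite -(absvM wP) -subr_sqr r2 -rmorphXn NE rmorphD rmorphM rmorphXn /=.
  have -> : d%:R - (d%:Z%:~R + 2%:~R ^+ (k + 3) * t%:~R) = - (2 ^+ (k + 3) * t%:~R) :> K.
    by rewrite -pmulrn; ring.
  rewrite (absvN wP) (absvM wP) (absvX wP) -exprSr addnS.
  by rewrite ler_piMr ?exprn_ge0 ?(absv_ge0 wP) ?(absv_int_le1 wP).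
(* The factors r - N and r + N differ by 2 N, of value w 2, so one of them has value at least w 2
   and the other inherits the rest of the bound. *)
have [h|h] := ltP (w (r - N%:~R)) (w 2).
  exists N; rewrite -(ler_pM2r w20); apply: le_trans prod.
  have -> : r + N%:~R = (r - N%:~R) + 2 * N%:~R by ring.
  by rewrite [w (r - _ + _)](absvD_dom wP) wN.
exists (- N); rewrite rmorphN /= opprK -(ler_pM2r w20); apply: le_trans prod.
by rewrite mulrC ler_wpM2r ?(absv_ge0 wP).
Qed.

End DyadicPlace.

(** * Completions *)

Section Completion.
Variables (R : realType) (K Kw : fieldType) (w : K -> R) (j : {rmorphism K -> Kw})
  (v : Kw -> R).
Hypothesis KwP : is_completion w j v.

Let vP : nonarch_absolute_value v. Proof. by case: KwP. Qed.
Let vj x : v (j x) = w x. Proof. by case: KwP. Qed.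

Lemma completion_approx y e : 0 < e -> exists x, v (y - j x) < e.
Proof. by case: KwP => _ _ h _; exact: h. Qed.

(** An element of [K] closer to [y] than [v y] has the same value as [y]. *)
Lemma completion_value y : exists x, v y = w x.
Proof.
have [->|y0] := eqVneq y 0; first by exists 0; rewrite -vj rmorph0.
have [|x xE] := @completion_approx y (v y); first by rewrite (absv_gt0 vP).
exists x; rewrite -vj -[j x](subrK y) (absvD_dom vP) //.
by rewrite (absvB vP).
Qed.

End Completion.

(** * Elements of the completion that are not norms *)

Lemma prime_nonnorm_odd (R : realType) (K : fieldExtType rat) (w : K -> R) (Kw : fieldType)
    (j : {rmorphism K -> Kw}) (v : Kw -> R) (l : nat) :
    finite_place w -> is_completion w j v -> w 2 = 1 -> w l%:R = 1 ->
    ~ nzsquare (j l%:R) ->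
  exists2 c, c != 0 & forall x y, c <> x ^+ 2 - j l%:R * y ^+ 2.
Proof.
move=> [wP w_nt] KwP w2 wl nsq; have [vP vj _ vC] := KwP.
have [u uE] := nonsquare_value wP w_nt.
have u0 : u != 0.
  by apply: contra_neqN (uE 0) => /eqP ->; rewrite absv0 // expr0n.
exists (j u); first by rewrite fmorph_eq0.
move=> x y; apply: (unramified_not_norm vP vC) => //; rewrite ?vj //.
  by rewrite -(rmorph_nat j) vj.
by move=> z; have [x' ->] := completion_value KwP z.
Qed.

Section DyadicCompletion.
Variables (R : realType) (p q s : nat).
Hypotheses (p_prime : prime p) (q_prime : prime q).
Hypotheses (p8 : (p %% 8 = 7)%N) (q8 : (q %% 8 = 3)%N) (s8 : (s %% 8 = 3)%N).
Variables (K : fieldExtType rat) (sqrt2 sqrtpq sqrtps : K).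
Hypotheses (sqrt2E : sqrt2 ^+ 2 = 2) (sqrtpqE : sqrtpq ^+ 2 = (p * q)%:R)
  (sqrtpsE : sqrtps ^+ 2 = (p * s)%:R).
Hypothesis K_gen : <<1 & [:: sqrt2; sqrtpq; sqrtps]>>%VS = fullv.
Variables (w : K -> R) (Kw : fieldType) (j : {rmorphism K -> Kw}) (v : Kw -> R).
Hypotheses (wP : nonarch_absolute_value w) (KwP : is_completion w j v) (w2 : w 2 < 1).

Let vP : nonarch_absolute_value v. Proof. by case: KwP. Qed.
Let vj x : v (j x) = w x. Proof. by case: KwP. Qed.

(** As pq = 5 modulo 8, om^2 - om = (pq - 1) / 4 = 1 + 2 c with c = (pq - 5) / 8 an integer. So [om]
    is a root of t^2 + t + 1 modulo 2. *)
Let om : K := (1 + sqrtpq) / 2.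
Let c : K := ((p * q - 5) %/ 8)%N%:R.

Let two0 : 2 != 0 :> K. Proof. exact: char0_2. Qed.

Let om2 : om ^+ 2 = om + 1 + 2 * c.
Proof.
have -> : om ^+ 2 = (1 + 2 * sqrtpq + sqrtpq ^+ 2) / 4.
  by rewrite /om; field; rewrite two0 -[4]/((2 * 2)%N%:R) natrM mulf_neq0.
have pqE : (p * q = 8 * ((p * q - 5) %/ 8) + 5)%N.
  have : (p * q %% 8 = 5)%N by rewrite -modnMm p8 q8.
  by move: (p * q)%N => n n5; lia.
rewrite sqrtpqE {1}pqE natrD natrM /om -/c.
by field; rewrite two0 -[4]/((2 * 2)%N%:R) natrM mulf_neq0.
Qed.

Let wc : w c <= 1. Proof. exact: absv_nat_le1. Qed.

(** Since qs = 1 modulo 8, sqrt(qs) is approximated by integers at [w]. Every [x] is then close to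
    an element of Q(sqrt 2, sqrt(pq)), whose residues are known. *)
Let K_residues (x : K) : w x <= 1 ->
  exists2 r, r \in [:: 0; 1; om; om + 1] & w (x - r) <= w sqrt2.
Proof.
move=> wx.
have [a0 [a1 [b0 [b1 xE]]]] : exists a0 a1 b0 b1 : rat * rat,
  x = (a0.1%:A + a0.2%:A * sqrt2) + (a1.1%:A + a1.2%:A * sqrt2) * sqrtpq +
    ((b0.1%:A + b0.2%:A * sqrt2) + (b1.1%:A + b1.2%:A * sqrt2) * sqrtpq) * sqrtps.
  have [a aE] := triquadratic_coords (n1 := 2) sqrt2E sqrtpqE sqrtpsE K_gen x.
  by exists (a 0, a 1), (a 2, a 3), (a 4, a 5), (a 6, a 7).
set A := _ + _ * sqrtpq in xE; set B := _ + _ * sqrtpq in xE.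
have [pK qK] : p%:R != 0 :> K /\ q%:R != 0 :> K by split; apply: natr_numfield_neq0; exact: prime_gt0.
have sqrt2_0 : sqrt2 != 0 by apply: contraTneq two0 => t0; rewrite -sqrt2E t0 expr0n eqxx.
pose sqrtqs := sqrtpq * sqrtps / p%:R.
have qs8 : (q * s %% 8 = 1)%N by rewrite -modnMm q8 s8.
have sqrtqsE : sqrtqs ^+ 2 = (q * s)%:R.
  by rewrite /sqrtqs expr_div_n exprMn sqrtpqE sqrtpsE !natrM; field.
have xE' : x = A + (B * sqrtpq / q%:R) * sqrtqs.
  have -> : B * sqrtpq / q%:R * sqrtqs = B * sqrtpq ^+ 2 * sqrtps / (q%:R * p%:R).
    by rewrite /sqrtqs; field; rewrite pK qK.
  by rewrite sqrtpqE natrM xE; field; rewrite pK qK.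
have g0 : 0 < w sqrt2 by rewrite (absv_gt0 wP).
have g1 : w sqrt2 < 1.
  rewrite ltNge; apply/negP=> /(exprn_ege1 2); rewrite -(absvX wP) sqrt2E.
  by rewrite leNgt w2.
have [N wN] := dyadic_approx_sqrt wP w2 qs8 sqrtqsE xE' g0.
set y := A + _ in wN.
(* Putting N for sqrt(qs) in (B sqrt(pq) / q) sqrt(qs) produces the coefficients p N and N / q. The
   substitution sqrt(pq) = 2 om - 1 then gives coordinates over Q(sqrt 2) in the basis 1, om. *)
have [P PE] : exists P : rat, P%:A = p%:R * N%:~R :> K.
  exists (p%:R * N%:~R).
  by rewrite -in_algE rmorphM (rmorph_nat (in_alg K)) (rmorph_int (in_alg K)).
have [Q QE] : exists Q : rat, Q%:A = N%:~R / q%:R :> K.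
  exists (N%:~R / q%:R).
  by rewrite -in_algE rmorphM fmorphV (rmorph_nat (in_alg K)) (rmorph_int (in_alg K)).
pose z := (a0.1 + P * b1.1 - (a1.1 + Q * b0.1))%:A +
          (a0.2 + P * b1.2 - (a1.2 + Q * b0.2))%:A * sqrt2 +
          ((2 * (a1.1 + Q * b0.1))%:A + (2 * (a1.2 + Q * b0.2))%:A * sqrt2) * om.
have yz : y = z.
  have -> : z = a0.1%:A + P%:A * b1.1%:A - (a1.1%:A + Q%:A * b0.1%:A) +
          (a0.2%:A + P%:A * b1.2%:A - (a1.2%:A + Q%:A * b0.2%:A)) * sqrt2 +
          (2 * (a1.1%:A + Q%:A * b0.1%:A) + (2 * (a1.2%:A + Q%:A * b0.2%:A)) * sqrt2) * om :> K.
    rewrite /z -!in_algE !(rmorphB, rmorphD, rmorphM, rmorph1) /=.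
    by ring.
  have pq2 : sqrtpq ^+ 2 = p%:R * q%:R by rewrite sqrtpqE natrM.
  rewrite /y /A /B PE QE /om.
  have e (B0 B1 : K) : (B0 + B1 * sqrtpq) * sqrtpq / q%:R = B0 * sqrtpq / q%:R + B1 * p%:R.
    have -> : (B0 + B1 * sqrtpq) * sqrtpq = B0 * sqrtpq + B1 * sqrtpq ^+ 2 by ring.
    by rewrite pq2; field.
  by rewrite e; field; rewrite two0 qK.
have wy : w y <= 1.
  have -> : y = x - (x - y) by ring.
  by rewrite (absvD_le wP) // (absvN wP) (le_trans (ltW wN)) // ltW.
rewrite yz in wy wN.
have [r rin wr] := dyadic_residue_subfield wP w2 sqrt2E om2 wc wy.
exists r => //; have -> : x - r = (x - z) + (z - r) by ring.
by rewrite (absvD_le wP) // ltW.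
Qed.

Let jth2 : j sqrt2 ^+ 2 = 2. Proof. by rewrite -rmorphXn sqrt2E rmorph_nat. Qed.

Let jom2 : j om ^+ 2 = j om + 1 + 2 * j c.
Proof. by rewrite -rmorphXn om2 !rmorphD rmorph1 rmorphM rmorph_nat. Qed.

Let v2 : v 2 < 1. Proof. by rewrite -(rmorph_nat j) vj. Qed.

Let sqrt2_0 : sqrt2 != 0.
Proof. by apply: contraTneq two0 => t0; rewrite -sqrt2E t0 expr0n eqxx. Qed.

Let g0 : 0 < v (j sqrt2). Proof. by rewrite vj (absv_gt0 wP). Qed.

Let g1 : v (j sqrt2) < 1.
Proof.
rewrite ltNge; apply/negP=> /(exprn_ege1 2); rewrite -(absvX vP) jth2.
by rewrite leNgt v2.
Qed.

Let residues (x : Kw) : v x <= 1 ->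
  exists2 r, r \in [:: 0; 1; j om; j om + 1] & v (x - r) <= v (j sqrt2).
Proof.
move=> x1; have [y xy] := completion_approx KwP x g0.
have [|r rin wr] := K_residues (x := y).
  rewrite -vj; have -> : j y = x - (x - j y) by ring.
  by rewrite (absvD_le vP) // (absvN vP) (le_trans (ltW xy)) // ltW.
exists (j r).
  by move: rin; rewrite !inE => /or4P[]/eqP->;
    rewrite ?rmorphD ?rmorph0 ?rmorph1 eqxx ?orbT.
have -> : x - j r = (x - j y) + j (y - r) by rewrite rmorphB; ring.
by rewrite (absvD_le vP) ?(ltW xy) // !vj.
Qed.

Lemma prime_nonnorm_dyadic : exists2 c, c != 0 & forall x y, c <> x ^+ 2 - j p%:R * y ^+ 2.
Proof.
have vc : v (j c) <= 1 by rewrite vj wc.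
(* As p = 7 modulo 8, 1 is a square root of -p up to 1 + p, a multiple of 8; its value is below v
   2^2, as Hensel's lemma demands. *)
have [m m0 mE] : nzsquare (j (- p%:R)).
  have [_ _ _ vC] := KwP; apply: (hensel_sqrt vP vC (x := 1)).
  rewrite mulr1 expr1n rmorphN rmorph_nat opprK -[1 + p%:R]/(1%:R + p%:R) -natrD.
  have -> : (1 + p = 2 ^ 3 * ((1 + p) %/ 8))%N by move: p8; lia.
  rewrite natrM natrX (absvM vP) (absvX vP).
  have v20 : 0 < v 2 by rewrite -(rmorph_nat j) vj (absv_gt0 wP).
  apply: le_lt_trans (_ : v 2 ^+ 3 < _).
    by rewrite ler_piMr ?exprn_ge0 ?(absv_ge0 vP) ?(absv_nat_le1 vP).
  by rewrite exprS gtr_pMl ?exprn_gt0.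
have vom : v (j om) = 1 := absv_cube_root vP v2 jom2 vc.
exists (1 + j om * j sqrt2) => [|x y].
  have : v (1 + j om * j sqrt2) = 1.
    by rewrite (absvD_domr vP) ?(absv1 vP) // (absvM vP) vom mul1r.
  by move=> e; rewrite -(absv_gt0 vP) e.
have -> : x ^+ 2 - j p%:R * y ^+ 2 = x ^+ 2 + (m * y) ^+ 2.
  by rewrite exprMn -mE rmorphN; ring.
apply: (dyadic_not_sum_two_squares vP v2 jth2 _ jom2 vc).
- by rewrite fmorph_eq0.
(* Discreteness: the nonzero representatives are units, so an element of value below 1 has
   representative 0 and hence value at most that of sqrt 2. *)
- move=> z z1; have [|r rin rE] := residues (x := z); first exact: ltW.
  have vr : v r < 1.
    have -> : r = z - (z - r) by ring.
    by apply: (absvD_lt vP); rewrite // (absvN vP) (le_lt_trans rE).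
  move: rin rE vr; rewrite !inE => /or4P[]/eqP->; rewrite ?subr0 // => _.
  + by rewrite (absv1 vP) ltxx.
  + by rewrite vom ltxx.
  + by rewrite (absv_cube_root_add1 vP v2 jom2 vc) ltxx.
- move=> z z1; have [r rin rE] := residues z1; exists r => //.
  exact: le_lt_trans rE g1.
Qed.

End DyadicCompletion.

(** The remaining places are those over [p], away from 2: there p = q (sqrt(pq) / q)^2 and [q] is a
    unit, so the unramified argument applies to [q]. *)
Lemma prime_nonnorm (R : realType) (p q s : nat) (K : fieldExtType rat)
    (sqrt2 sqrtpq sqrtps : K) (w : K -> R) (Kw : fieldType) (j : {rmorphism K -> Kw})
    (v : Kw -> R) :
    prime p -> prime q -> p != q ->
    (p %% 8 = 7)%N -> (q %% 8 = 3)%N -> (s %% 8 = 3)%N ->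
    sqrt2 ^+ 2 = 2%:R -> sqrtpq ^+ 2 = (p * q)%:R -> sqrtps ^+ 2 = (p * s)%:R ->
    <<1 & [:: sqrt2; sqrtpq; sqrtps]>>%VS = fullv ->
    finite_place w -> is_completion w j v -> ~ nzsquare (j p%:R) ->
  exists2 c, c != 0 & forall x y, c <> x ^+ 2 - j p%:R * y ^+ 2.
Proof.
move=> pp pq npq p8 q8 s8 sqrt2E sqrtpqE sqrtpsE K_gen wpl KwP nsq.
have [wP w_nt] := wpl.
have nat1 n : w n%:R = 1 \/ w n%:R < 1.
  by have := absv_nat_le1 wP n; rewrite le_eqVlt => /orP[/eqP|]; [left|right].
have [w2|w2] := nat1 2%N; last first.
  exact: (prime_nonnorm_dyadic pp pq p8 q8 s8 sqrt2E sqrtpqE sqrtpsE K_gen wP KwP w2).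
have [wp|wp] := nat1 p; first exact: (prime_nonnorm_odd wpl KwP w2 wp nsq).
have wq : w q%:R = 1.
  by apply: (absv_coprime wP _ wp); rewrite prime_coprime // dvdn_prime2.
have [p0 q0] : p%:R != 0 :> K /\ q%:R != 0 :> K.
  by split; apply: natr_numfield_neq0; exact: prime_gt0.
have pqE : p%:R = q%:R * (sqrtpq / q%:R) ^+ 2 :> K.
  by rewrite expr_div_n sqrtpqE natrM; field.
have sq0 : sqrtpq / q%:R != 0.
  by apply: contraNneq p0 => e; rewrite pqE e expr0n mulr0.
have [|c c0 cE] := prime_nonnorm_odd wpl KwP w2 wq.
  move=> [y y0 yE]; apply: nsq; exists (y * j (sqrtpq / q%:R)).
    by rewrite mulf_neq0 // fmorph_eq0.
  by rewrite pqE rmorphM yE rmorphXn exprMn.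
exists c => // x y cxy; apply: (cE x (j (sqrtpq / q%:R) * y)).
by rewrite cxy pqE rmorphM [j (_ ^+ 2)]rmorphXn; ring.
Qed.

(** * The square class of [Theta] and its local test *)

Theorem theorem4p5 (R : realType) (p q s : nat)
    (p_prime : prime p) (q_prime : prime q) (s_prime : prime s)
    (pqs_odd : [/\ odd p, odd q & odd s]) (pqs_distinct : uniq [:: p; q; s])
    (p_mod8 : p = 7 %[mod 8]) (q_mod8 : q = 3 %[mod 8]) (s_mod8 : s = 3 %[mod 8])
    (pqs_legendre : (legendre q p, legendre s p, legendre q s)
                      \in [:: (1, 1, 1); (-1, -1, 1)])
    (* K = Q(sqrt 2, sqrt pq, sqrt ps) with its embedding iota0 *)
    (K : fieldExtType rat) (iota0 : {rmorphism K -> R})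
    (sqrt2 sqrtpq sqrtps : K)
    (sqrt2P : pos_sqrt iota0 2%:R sqrt2)
    (sqrtpqP : pos_sqrt iota0 (p * q)%:R sqrtpq)
    (sqrtpsP : pos_sqrt iota0 (p * s)%:R sqrtps)
    (K_gen : <<1 & [:: sqrt2; sqrtpq; sqrtps]>>%VS = fullv)
    (eps : nat -> K) (epsP : fundamental_units iota0 eps)
    (tpq tps : K)
    (tpqP : pos_sqrt iota0 (eps (p * q)%N * eps (2 * p * q)%N) tpq)
    (tpsP : pos_sqrt iota0 (eps (p * s)%N * eps (2 * p * s)%N) tps)
    (Theta : K) (ThetaE : Theta = tpq * tps)
    (exactly_one :
       (nzsquare Theta /\ ~ nzsquare (eps (p * q)%N * Theta)) \/
       (~ nzsquare Theta /\ nzsquare (eps (p * q)%N * Theta)))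
    (w : K -> R) (wP : finite_place w)
    (Kw : fieldType) (j : {rmorphism K -> Kw}) (absw : Kw -> R)
    (KwP : is_completion w j absw)
    (eps_nonsquare : ~ nzsquare (j (eps (p * q)%N)))
    (B : {fset Kw}) (B_basis : basis_mod_squares B) :
  [/\ nzsquare Theta <-> nzsquare (j Theta),
      nzsquare (j Theta) <->
        (forall b, b \in B -> hilbert_symbol (j Theta) b = 1)
    & let mu := if all (fun b => hilbert_symbol (j Theta) b == 1) B
                then 1 else eps (p * q)%N in
      [/\ unique (fun m => m \in [:: 1; eps (p * q)%N] /\ nzsquare (m * Theta))
            mu,
          exists xi : K, xi != 0 /\ xi ^+ 2 = mu * Theta
        & exists r1 r2 r3 : K,
          [/\ pos_sqrt iota0 (eps (p * q)%N * eps (p * s)%N) r1,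
              pos_sqrt iota0 (eps (p * q)%N * eps (q * s)%N) r2,
              pos_sqrt iota0 (eps (2 * q * s)%N) r3
            & forall xi : K, xi != 0 -> xi ^+ 2 = mu * Theta ->
                fundamental_system
                  [tuple eps 2%N; eps (p * q)%N; r1; r2; r3; tpq; xi]]]].
Proof.
have [p8 q8 s8] : [/\ p %% 8 = 7, q %% 8 = 3 & s %% 8 = 3]%N by [].
set e := eps (p * q)%N in exactly_one eps_nonsquare tpqP *.
have [tpqE tpq_gt0] := tpqP; have [tpsE tps_gt0] := tpsP.
have [sqrt2E _] := sqrt2P; have [sqrtpqE _] := sqrtpqP; have [sqrtpsE _] := sqrtpsP.
have npq : p != q by move: pqs_distinct; rewrite /= !inE negb_or => /andP[/andP[]].
have [z eE] := eps_pq_class p_prime q_prime s_prime pqs_distinct p8 q8 s8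
  sqrt2P sqrtpqP sqrtpsP K_gen epsP.
rewrite -/e in eE.
have neq0_pos (x : K) : 0 < iota0 x -> x != 0.
  by move=> x0; rewrite -(fmorph_eq0 iota0) gt_eqF.
have Theta0 : Theta != 0 by rewrite ThetaE mulf_neq0 ?neq0_pos.
have e0 : e != 0.
  have : tpq ^+ 2 != 0 by rewrite expf_neq0 ?neq0_pos.
  by rewrite tpqE mulf_eq0 negb_or => /andP[].
have [p0 z0] : p%:R != 0 :> K /\ z != 0.
  by apply/andP; move: e0; rewrite eE mulf_eq0 expf_eq0 negb_or.
have Kw0 : [pchar Kw] =i pred0.
  by move=> l; rewrite (fmorph_pchar j) pchar_lalg pchar_num.
have jp_nonsquare : ~ nzsquare (j p%:R).
  move=> [y y0 yE]; apply: eps_nonsquare; exists (y * j z).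
    by rewrite mulf_neq0 ?fmorph_eq0.
  by rewrite eE rmorphM rmorphXn yE exprMn.
have square_j : nzsquare Theta -> nzsquare (j Theta).
  by move=> [y y0 ->]; exists (j y); rewrite ?fmorph_eq0 // rmorphXn.
have square_local : nzsquare (j Theta) -> nzsquare Theta.
  case: exactly_one => [[//]|[_ [y y0 yE]]] [m m0 mE].
  case: eps_nonsquare; exists (j y / m); first by rewrite mulf_neq0 ?invr_neq0 ?fmorph_eq0.
  by rewrite expr_div_n -rmorphXn -yE -mE rmorphM mulfK // fmorph_eq0.
have symbols : nzsquare (j Theta) <-> (forall b, b \in B -> hilbert_symbol (j Theta) b = 1).
  have [B0 _ _] := B_basis.
  split=> [jT b /B0 b0|TB]; first exact: hilbert_symbol_nzsquare.
  case: exactly_one => [[/square_j //]|[_ [y y0 yE]]].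
  (* Here e Theta = y^2 and e = p z^2, so [Theta] and [p] have the same square class and the
     non-norm found for [p] also serves for [Theta]. *)
  have TE : Theta = p%:R * (y / (p%:R * z)) ^+ 2.
    by rewrite expr_div_n -yE eE; field; rewrite p0 z0.
  have [c c0 cE] := prime_nonnorm p_prime q_prime npq p8 q8 s8 sqrt2E sqrtpqE sqrtpsE K_gen
    wP KwP jp_nonsquare.
  apply: (hilbert_symbol_nondegenerate Kw0 B_basis _ TB); last by rewrite fmorph_eq0.
  exists c => // x x'; rewrite TE rmorphM rmorphXn -mulrA -exprMn; exact: cE.
have squareE : all (fun b => hilbert_symbol (j Theta) b == 1) B <-> nzsquare Theta.
  split=> [/allP TB|/square_j/symbols TB]; last by apply/allP=> b /TB/eqP.
  by apply/square_local/symbols => b /TB/eqP.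
split; [by split|exact: symbols|].
(* The boolean [nu] turns [mu] into a power of [e]; it records the right case because e = 1 would be
   a local square. *)
set mu := if _ then _ else _; pose nu := mu != 1.
have e1 : e != 1 by apply: contra_notN eps_nonsquare => /eqP ->; exists 1; rewrite ?oner_eq0 ?rmorph1 ?expr1n.
have [nu_mu muT] : mu = e ^+ nu /\ nzsquare (mu * Theta).
  rewrite /nu /mu; case: ifP => [/squareE T|/negP nT].
    by rewrite eqxx mul1r.
  rewrite e1; split=> //; case: exactly_one => [[T]|[]//].
  by case: nT; apply/squareE.
split.
- split; first by split=> //; rewrite /mu; case: ifP => _; rewrite !inE eqxx ?orbT.
  move=> m []; rewrite !inE => /orP[]/eqP-> mT; rewrite /mu.
    rewrite mul1r in mT; by rewrite (introT idP (proj2 squareE mT)).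
  case: ifP => // /squareE T; case: exactly_one => [[_ /(_ mT)]|[/(_ T)]] //.
- have [xi xi0 xiE] := muT; by exists xi.
have [r1 [r2 [r3 [r1P r2P r3P]]]] := eps_products_sqrt p_prime q_prime s_prime
  pqs_distinct p8 q8 s8 sqrt2P sqrtpqP sqrtpsP K_gen epsP.
exists r1, r2, r3; split=> // xi xi0 xiE.
apply: (eps_fundamental_system p_prime q_prime s_prime pqs_distinct p8 q8 s8
  sqrt2P sqrtpqP sqrtpsP K_gen epsP (proj1 r1P) (proj1 r2P) (proj1 r3P) tpqE tpsE (nu := nu)).
by rewrite xiE nu_mu ThetaE.
Qed.
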